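(* There exists a compact almost Hermitian manifold $(M,J,\omega)$ of real dimension $4$ satisfying $$\ell^{1,0}=\ell^{0,1}<\frac{b_1}{2},$$ where $b_1$ is the first Betti number of $M$, while $d\omega\neq 0$.
   Context: All objects are smooth. An almost complex structure on a manifold $M$ is a section $J$ of $\mathrm{End}(TM)$ with $J^2=-\mathrm{Id}$. An almost Hermitian manifold $(M,J,g,\omega)$ consists of an almost complex structure $J$, a $J$-invariant Riemannian metric $g$, and the associated real non-degenerate $(1,1)$-form $\omega=g(J\cdot,\cdot)$; since $g$ is determined by $J$ and $\omega$, one also writes $(M,J,\omega)$. $J$ induces the bigrading of complex-valued forms $\mathcal A^r(M)=\bigoplus_{p+q=r}\mathcal A^{p,q}(M)$, and the exterior derivative decomposes as $d=\mu+\partial+\bar\partial+\bar\mu$, with components of bidegree $|\mu|=(2,-1)$, $|\partial|=(1,0)$, $|\bar\partial|=(0,1)$, $|\bar\mu|=(-1,2)$. For $\delta\in\{\mu,\partial,\bar\partial,\bar\mu,d\}$, $\delta^*$ is the formal $L^2$-adjoint with respect to $g$, $\Delta_\delta=\delta\delta^*+\delta^*\delta$, and $\mathcal H^{p,q}_\delta=\ker(\Delta_\delta)\cap\mathcal A^{p,q}$. The generalized Hodge numbers are $\ell^{p,q}=\dim_{\mathbb C}\big(\mathcal H^{p,q}_{\bar\partial}\cap\mathcal H^{p,q}_\mu\big)$. *)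

(* Defs.v *)
From HB Require Import structures.
From mathcomp Require Import all_boot all_order all_algebra.
From mathcomp Require Import all_classical all_reals all_analysis.
From mathcomp Require Import complex.

Set Implicit Arguments.
Unset Strict Implicit.
Unset Printing Implicit Defensive.

Import Order.TTheory GRing.Theory Num.Theory.
Import numFieldNormedType.Exports.

Local Open Scope classical_set_scope.
Local Open Scope ring_scope.
Local Open Scope complex_scope.

(* C^oo on an open set U: every iterated directional derivative exists and is
   continuous at each point of U. *)
Definition smooth_on (R : realType) (n : nat) (U : set 'rV[R]_n)
    (f : 'rV[R]_n -> R) : Prop :=
  forall (s : seq 'rV[R]_n) (x : 'rV[R]_n), U x ->
    let h := foldr (fun v h => 'D_v h) f s in
    {for x, continuous h} /\ forall v, derivable h x v.

(* A smooth n-manifold with a chosen chart (dom p, chart p) around each of its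
   points p; the atlas consists of these charts. The choice identifies T_pM
   with R^n, through the differential of chart p at p, so that tensors at p are
   matrices or multilinear maps on R^n. *)
Record manifold (R : realType) (n : nat) := Manifold {
  carrier :> ptopologicalType ;
  dom : carrier -> set carrier ;
  chart : carrier -> carrier -> 'rV[R]_n ;
  cinv : carrier -> 'rV[R]_n -> carrier ;
  carrier_hausdorff : hausdorff_space carrier ;
  carrier_second_countable : @second_countable carrier ;
  dom_open : forall p, open (dom p) ;
  dom_center : forall p, dom p p ;
  chart_open : forall p, open (chart p @` dom p) ;
  chartK : forall p q, dom p q -> cinv p (chart p q) = q ;
  chart_continuous : forall p, {within dom p, continuous (chart p)} ;
  cinv_continuous : forall p,
    {within chart p @` dom p, continuous (cinv p)} ;
  transition_smooth : forall p q (i : 'I_n),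
    smooth_on (chart p @` (dom p `&` dom q))
      (fun x => (chart q (cinv p x)) ord0 i)
}.

Arguments dom {R n m} p : rename.
Arguments chart {R n m} p : rename.
Arguments cinv {R n m} p : rename.

(* If x represents a point m in the chart at p, the matrix of the change of
   coordinates of T_mM from the chart at p to the chart at m. It acts on row
   vectors from the right, as do all matrices below. *)
Definition jac (R : realType) (n : nat) (M : manifold R n) (p : M)
    (x : 'rV[R]_n) : 'M[R]_n :=
  'J (chart (cinv p x) \o cinv p) x.

(* J and g at p are expressed in the chart at p: J u is u *m J p, and
   g(u, w) is u *m g p *m w^T. *)
Record almost_hermitian (R : realType) (n : nat) := AlmostHermitian {
  ah_manifold :> manifold R n ;
  ahJ : ah_manifold -> 'M[R]_n ;
  ahg : ah_manifold -> 'M[R]_n ;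
  ahJ_smooth : forall (p : ah_manifold) (i j : 'I_n),
    smooth_on (chart p @` dom p)
      (fun x => (jac p x *m ahJ (cinv p x) *m invmx (jac p x)) i j) ;
  ahJ_sqr : forall p, ahJ p *m ahJ p = - 1%:M ;
  ahg_smooth : forall (p : ah_manifold) (i j : 'I_n),
    smooth_on (chart p @` dom p)
      (fun x => (jac p x *m ahg (cinv p x) *m (jac p x)^T) i j) ;
  ahg_sym : forall p, (ahg p)^T = ahg p ;
  ahg_pos : forall p (v : 'rV[R]_n), v != 0 ->
    0 < (v *m ahg p *m v^T) ord0 ord0 ;
  ahg_invariant : forall p, ahJ p *m ahg p *m (ahJ p)^T = ahg p
}.

Arguments ahJ {R n a} p : rename.
Arguments ahg {R n a} p : rename.

Definition cmx (R : realType) (m n : nat) (A : 'M[R]_(m, n)) : 'M[R[i]]_(m, n) :=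
  map_mx (real_complex R) A.

(* Complex-valued k-forms, extended C-multilinearly to the complexified tangent
   spaces. The type contains arbitrary families of functions; the actual smooth
   forms are singled out by is_form. *)
Definition cform (R : realType) (n : nat) (M : manifold R n) (k : nat) : Type :=
  M -> ('I_k -> 'rV[R[i]]_n) -> R[i].

Section Forms.
Variables (R : realType) (n : nat) (M : manifold R n).

Definition in_chart (k : nat) (al : cform M k) (p : M) (x : 'rV[R]_n)
    (v : 'I_k -> 'rV[R[i]]_n) : R[i] :=
  al (cinv p x) (fun i => v i *m cmx (jac p x)).

Definition set_arg (k : nat) (v : 'I_k -> 'rV[R[i]]_n) (i : 'I_k)
    (u : 'rV[R[i]]_n) : 'I_k -> 'rV[R[i]]_n :=
  fun j => if j == i then u else v j.

Definition is_form (k : nat) (al : cform M k) : Prop :=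
  [/\ forall p v i (a : R[i]) u w,
        al p (set_arg v i (a *: u + w)) =
        a * al p (set_arg v i u) + al p (set_arg v i w),
      forall p v i j, i != j -> v i = v j -> al p v = 0
    & forall p v,
        smooth_on (chart p @` dom p) (fun x => complex.Re (in_chart al p x v)) /\
        smooth_on (chart p @` dom p) (fun x => complex.Im (in_chart al p x v))].

(* The derivative of F along the complexified tangent vector v. *)
Definition cderive (F : 'rV[R]_n -> R[i]) (x : 'rV[R]_n) (v : 'rV[R[i]]_n) :
    R[i] :=
  let D := fun w : 'rV[R]_n =>
    'D_w (fun y => complex.Re (F y)) x +i* 'D_w (fun y => complex.Im (F y)) x in
  D (map_mx (@complex.Re R) v) + Complex 0 1 * D (map_mx (@complex.Im R) v).

(* (d al)(v_0, .., v_k) = \sum_i (-1)^i v_i (al(v_0, .., ^v_i, .., v_k)), where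
   the v_i are extended to vector fields that are constant in the chart at p,
   hence commute. *)
Definition dext (k : nat) (al : cform M k) : cform M k.+1 := fun p v =>
  \sum_(i < k.+1) (-1) ^+ i *
    cderive (fun x => in_chart al p x (fun j => v (lift i j)))
      (chart p p) (v i).

(* "Z / B has dimension m": e is a family of representatives of a basis. *)
Definition is_dim_quotient (V : lmodType R[i]) (Z B : set V) (m : nat) : Prop :=
  exists e : 'I_m -> V, (forall i, Z (e i)) /\
    forall z, Z z ->
      exists! c : 'rV[R[i]]_m, B (z - \sum_(i < m) c ord0 i *: e i).

Definition is_dim (V : lmodType R[i]) (Z : set V) (m : nat) : Prop :=
  is_dim_quotient Z [set 0] m.

Definition closed_forms (k : nat) : set (cform M k) :=
  [set al | is_form al /\ dext al = 0].

Definition exact_forms (k : nat) : set (cform M k) :=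
  match k with
  | 0 => [set 0]
  | k'.+1 => [set be | exists al : cform M k', is_form al /\ be = dext al]
  end.

(* b_k = dim_C H^k_dR(M; C) *)
Definition is_betti (k b : nat) : Prop :=
  is_dim_quotient (@closed_forms k) (@exact_forms k) b.

End Forms.

(* Iterated Lebesgue integral; for nonnegative Borel functions this is the
   integral against Lebesgue measure on R^n (Tonelli). *)
Fixpoint lebesgue_int (R : realType) (n : nat) :
    ('rV[R]_n -> \bar R) -> \bar R :=
  match n return ('rV[R]_n -> \bar R) -> \bar R with
  | 0 => fun f => f 0
  | m.+1 => fun f =>
      (\int[@lebesgue_measure R]_t
        lebesgue_int (fun x : 'rV[R]_m => f (row_mx (t%:M : 'rV[R]_1) x)))%E
  end.

Definition borel (T : ptopologicalType) := g_sigma_algebraType (@open T).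

Section Hermitian.
Variables (R : realType) (n : nat) (M : almost_hermitian R n).

(* ahg expressed at the point x of the chart at p *)
Definition gram (p : M) (x : 'rV[R]_n) : 'M[R]_n :=
  jac p x *m ahg (cinv p x) *m (jac p x)^T.

(* dvol = sqrt (det g_ij) dx in each chart. *)
Definition riemannian_volume (vol : {measure set (borel M) -> \bar R}) : Prop :=
  forall (p : M) (A : set (borel M)), measurable A -> A `<=` dom p ->
    vol A = lebesgue_int (fun x =>
      (Num.sqrt (\det (gram p x)) * \1_(chart p @` A) x)%:E).

(* omega(u, w) = g(J u, w) *)
Definition fundamental_form : cform M 2 := fun p v =>
  (v ord0 *m cmx (ahJ p *m ahg p) *m (v ord_max)^T) ord0 ord0.

(* Projections of the complexified tangent space onto T^{1,0} and T^{0,1}, the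
   eigenspaces of J for 'i and -'i. *)
Definition proj10 (p : M) : 'M[R[i]]_n :=
  2^-1 *: (1%:M - Complex 0 1 *: cmx (ahJ p)).
Definition proj01 (p : M) : 'M[R[i]]_n :=
  2^-1 *: (1%:M + Complex 0 1 *: cmx (ahJ p)).

(* The component of bidegree (r, k - r) of a k-form. *)
Definition bidegree_part (k r : nat) (al : cform M k) : cform M k := fun p v =>
  \sum_(S : {set 'I_k} | #|S| == r)
    al p (fun i => v i *m (if i \in S then proj10 p else proj01 p)).

(* The component of bidegree (a, 1 - a) of d. *)
Definition d_component (a : int) (k : nat) (al : cform M k) : cform M k.+1 :=
  \sum_(r < k.+1) \sum_(s < k.+2 | s%:Z == r%:Z + a)
    bidegree_part s (dext (bidegree_part r al)).

Definition mu_op : forall k, cform M k -> cform M k.+1 := d_component 2.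
Definition del_op : forall k, cform M k -> cform M k.+1 := d_component 1.
Definition delbar_op : forall k, cform M k -> cform M k.+1 := d_component 0.
Definition mubar_op : forall k, cform M k -> cform M k.+1 := d_component (-1).

(* The Hermitian product of k-forms induced by g, in coordinates:
   1/k! g^{i_1 j_1} .. g^{i_k j_k} al_{i_1 .. i_k} conj(be_{j_1 .. j_k}). *)
Definition form_dot (k : nat) (al be : cform M k) (p : M) : R[i] :=
  (k`!%:R)^-1 *
  \sum_(I : {ffun 'I_k -> 'I_n}) \sum_(K : {ffun 'I_k -> 'I_n})
    (\prod_(a < k) (invmx (ahg p)) (I a) (K a))%:C *
    al p (fun a => delta_mx ord0 (I a)) *
    conjc (be p (fun a => delta_mx ord0 (K a))).

Variable vol : {measure set (borel M) -> \bar R}.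

Definition L2_dot (k : nat) (al be : cform M k) : R[i] :=
  Rintegral vol setT (fun p : borel M => complex.Re (form_dot al be p)) +i*
  Rintegral vol setT (fun p : borel M => complex.Im (form_dot al be p)).

(* ga = delta^* be. Since the L^2 product is definite on smooth forms, at most
   one ga satisfies this. *)
Definition is_adjoint (k : nat) (delta : cform M k -> cform M k.+1)
    (be : cform M k.+1) (ga : cform M k) : Prop :=
  is_form ga /\
  forall al, is_form al -> L2_dot (delta al) be = L2_dot al ga.

(* eta = Delta_delta al, with delta^* al = 0 when al is a function. *)
Definition is_laplacian (delta : forall k, cform M k -> cform M k.+1) (k : nat) :
    cform M k -> cform M k -> Prop :=
  match k return cform M k -> cform M k -> Prop with
  | 0 => fun al eta => is_adjoint (@delta 0) (delta 0 al) eta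
  | k'.+1 => fun al eta => exists (be : cform M k') (ga : cform M k'.+1),
      [/\ is_adjoint (@delta k') al be,
          is_adjoint (@delta k'.+1) (delta k'.+1 al) ga
        & eta = delta k' be + ga]
  end.

Definition harmonic (delta : forall k, cform M k -> cform M k.+1) (p q : nat) :
    set (cform M (p + q)) :=
  [set al | [/\ is_form al, bidegree_part p al = al
              & is_laplacian delta al 0]].

(* l^{p,q} = l *)
Definition is_hodge_number (p q l : nat) : Prop :=
  is_dim (@harmonic delbar_op p q `&` @harmonic mu_op p q) l.

End Hermitian.

(* Main.v *)
Require Import Defs.
From HB Require Import structures.
From mathcomp Require Import all_boot all_order all_algebra.
From mathcomp Require Import all_classical all_reals all_analysis.
From mathcomp Require Import measurable_realfun complex ring lra.
Set Implicit Arguments.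
Unset Strict Implicit.
Unset Printing Implicit Defensive.
Import Order.TTheory GRing.Theory Num.Theory.
Import numFieldNormedType.Exports.
Local Open Scope classical_set_scope.
Local Open Scope ring_scope.

(** M is the flat torus (R / 2 pi Z)^4 with coordinates (t, x, y, z). Fix (s, h) =
    (4/5, 3/5) and let J_t be left multiplication, on R^4 seen as the quaternions,
    by the imaginary unit n(t) = (s cos t, s sin t, h). In the orthonormal frame
    T = d_t, F1 = n, F2, F3 = n x F2, one has J T = F1, J F2 = F3 and the structure
    functions are constants. An element of the kernel of Delta_delta is killed by
    delta and by delta^*. For a (1,0)-form, delbar al = 0 is a system of four first
    order equations for its two coefficients, and commuting the operators T, F1,
    F2, F3 forces both to vanish. For a (0,1)-form, mu al = 0 kills the first
    coefficient, while delbar al = 0 and delbar^* al = 0 make the second one a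
    multiple of e^{- i h t}, which is not 2 pi-periodic since h is not an integer.
    Hence l^{1,0} = l^{0,1} = 0, whereas b_1 = 4. *)

(** * Smooth functions on R^n *)

(** For [s = 0] the vector n is constant and the torus is flat Kähler, with l^{1,0} = l^{0,1} = b_1
    / 2. Rotating n along t with [s] nonzero has two effects at once: brackets of (1,0)-fields
    acquire a (0,1)-part proportional to [s], so that mu sees the first coefficient of a (0,1)-form
    without differentiating it, and the entry s sin t of omega is no longer constant in t. The
    component [h] of n along the rotation axis is the frequency of the last candidate solution. The
    argument uses only s^2 + h^2 = 1, s <> 0, h^2 <> 2 s^2 and cos (2 pi h) <> 1; (4/5, 3/5) is a
    rational point of the circle meeting these conditions.

    The torus has translations as transition maps. All Jacobians are therefore the identity, a form
    is a family of 2 pi-periodic functions on R^4, and the analysis takes place on R^4. Since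
    smoothness is defined by iterated directional derivatives, linearity in the direction and the
    commutation of derivatives have to be established before anything else. *)

Section Directional.
Variables (R : realType) (V : normedModType R).
Implicit Types (f g : V -> R) (x u v : V).

Lemma is_derive_line f x v (h : R) : derivable f (x + h *: v) v ->
  is_derive h 1 (fun s : R => f (x + s *: v)) ('D_v f (x + h *: v)).
Proof.
have E : (fun k : R => k^-1 *: (((fun s : R => f (x + s *: v)) \o shift h) (k *: 1)
      - f (x + h *: v))) =
    (fun k : R => k^-1 *: ((f \o shift (x + h *: v)) (k *: v) - f (x + h *: v))).
  apply/funext => k /=; congr (_ *: (f _ - _)).
  by rewrite [k *: 1]mulr1 scalerDl addrCA.
by move=> d; split; rewrite /derivable /derive E.
Qed.

Lemma MVT_line f x v (h : R) : (forall y, derivable f y v) ->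
  exists2 t : R, `|t| <= `|h| & f (x + h *: v) - f x = h * 'D_v f (x + t *: v).
Proof.
move=> df.
have H (t : R) : is_derive t 1 (fun s : R => f (x + s *: v)) ('D_v f (x + t *: v)).
  exact/is_derive_line.
have C (i : interval R) : {within [set` i], continuous (fun s : R => f (x + s *: v))}.
  by apply: derivable_within_continuous => y _; have [] := H y.
case: (leP 0 h) => h0.
  have [t] := MVT_segment h0 (fun t _ => H t) (@C _).
  rewrite in_itv /= scale0r addr0 subr0 => /andP[t0 th] E; exists t.
    by rewrite !ger0_norm.
  by rewrite E mulrC.
have [t] := MVT_segment (ltW h0) (fun t _ => H t) (@C _).
rewrite in_itv /= scale0r addr0 sub0r => /andP[t0 th] E; exists t.
  by rewrite !ler0_norm ?lerN2 // ltW.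
by rewrite -opprB E mulrN opprK mulrC.
Qed.

(** Continuity at [x] becomes usable at the intermediate points [x + a *: u + b *: v] that the mean
    value theorem produces. The summand 1 in the denominator of the radius covers u = v = 0. *)
Lemma near_plane x u v (A : set V) : nbhs x A ->
  exists2 d : R, 0 < d & forall a b : R, `|a| <= d -> `|b| <= d ->
    A (x + a *: u + b *: v).
Proof.
move=> /nbhs_ballP[e /= e0 eA].
have n0 : 0 < `|u| + `|v| + 1 by rewrite ltr_wpDl // addr_ge0.
exists (e / (`|u| + `|v| + 1) / 2); first by rewrite !divr_gt0.
move=> a b ha hb; apply: eA; rewrite -ball_normE /ball_ /=.
rewrite -addrA opprD addNKr normrN.
apply: (le_lt_trans (ler_normD _ _)); rewrite !normrZ.
set d := e / _ / 2 in ha hb.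
have d0 : 0 < d by rewrite !divr_gt0.
have He : e = d * 2 * (`|u| + `|v| + 1).
  by rewrite /d divfK ?pnatr_eq0 // divfK // gt_eqF.
have h1 : `|a| * `|u| <= d * `|u| by rewrite ler_wpM2r.
have h2 : `|b| * `|v| <= d * `|v| by rewrite ler_wpM2r.
have h3 : 0 <= d * `|u| by rewrite mulr_ge0 // ltW.
have h4 : 0 <= d * `|v| by rewrite mulr_ge0 // ltW.
by rewrite He; nra.
Qed.

(** The increment along [u + v] is split at [x + h *: u]. Its second half is a value of ['D_v f] at
    a point tending to [x], so continuity of this single derivative is enough. *)
Lemma is_derive_add f x u v : (forall y, derivable f y v) ->
  derivable f x u -> {for x, continuous ('D_v f)} ->
  is_derive x (u + v) f ('D_u f x + 'D_v f x).
Proof.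
move=> dv du cv.
have cvg1 : (fun h : R => h^-1 *: (f (x + h *: u + h *: v) - f (x + h *: u)))
   @ 0^' --> 'D_v f x.
  apply/cvgrPdist_le => e e0.
  have /cvgrPdist_le/(_ _ e0) := cv.
  move=> /(near_plane u v)[d d0 dH].
  near=> h.
  have [t th ->] := @MVT_line f (x + h *: u) v h dv.
  rewrite scalerA mulVf ?scale1r; last by near: h; exact: nbhs_dnbhs_neq.
  have hd : `|h| <= d.
    by near: h; exact: dnbhs0_le.
  by apply: dH => //; exact: le_trans th hd.
have cvg2 : (fun h : R => h^-1 *: (f (x + h *: u) - f x)) @ 0^' --> 'D_u f x.
  have -> : (fun h : R => h^-1 *: (f (x + h *: u) - f x)) =
      (fun h : R => h^-1 *: ((f \o shift x) (h *: u) - f x)).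
    by apply/funext => h /=; rewrite [_ + x]addrC.
  exact: du.
have E : (fun h : R => h^-1 *: ((f \o shift x) (h *: (u + v)) - f x)) =
  (fun h : R => h^-1 *: (f (x + h *: u) - f x)) \+
  (fun h : R => h^-1 *: (f (x + h *: u + h *: v) - f (x + h *: u))).
  apply/funext => h /=; rewrite -scalerDr; congr (_ *: _).
  have -> : h *: (u + v) + x = x + h *: u + h *: v by rewrite scalerDr addrC addrA.
  ring.
have cv3 : (fun h : R => h^-1 *: ((f \o shift x) (h *: (u + v)) - f x)) @ 0^' -->
    'D_u f x + 'D_v f x.
  by rewrite E; apply: cvgD cvg2 cvg1.
split; first by apply/cvg_ex; eexists; exact: cv3.
exact: (cvg_lim (@norm_hausdorff _ _) cv3).
Unshelve. all: by end_near. Qed.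

Lemma is_derive_scale f x v (c : R) : derivable f x v ->
  is_derive x (c *: v) f (c * 'D_v f x).
Proof.
have [->|c0] := eqVneq c 0.
  by rewrite scale0r mul0r => _; exact: is_derive0.
move=> dv.
have cvg1 : (fun h : R => h^-1 *: (f (h *: v + x) - f x)) @ 0^' --> 'D_v f x.
  exact: dv.
have cvg2 : (fun h : R => (c * h)^-1 *: (f ((c * h) *: v + x) - f x)) @ 0^' --> 'D_v f x.
  apply: (cvg_comp _ _ _ cvg1).
  move=> A /=; rewrite /dnbhs /within /= => /nbhs_ballP[e /= e0 He].
  apply/nbhs_ballP; exists (e / `|c|) => /=; first by rewrite divr_gt0 // normr_gt0.
  move=> y; rewrite /ball /= !sub0r normrN ltr_pdivlMr ?normr_gt0 // => hy y0.
  apply: He; last by rewrite mulf_neq0.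
  by rewrite /ball /= sub0r normrN normrM mulrC.
have E : (fun h : R => h^-1 *: ((f \o shift x) (h *: (c *: v)) - f x)) =
  (fun h : R => c *: ((c * h)^-1 *: (f ((c * h) *: v + x) - f x))).
  apply/funext => h /=; rewrite !scalerA [h * c]mulrC; congr (_ *: _).
  by rewrite invfM mulrA mulfV // mul1r.
have cvg3 : (fun h : R => h^-1 *: ((f \o shift x) (h *: (c *: v)) - f x)) @ 0^' -->
    c * 'D_v f x.
  by rewrite E; exact: (@cvgZl_tmp _ R^o _ _ _ c _ _ cvg2).
split; first by apply/cvg_ex; exists (c * (derive f x v)); exact: cvg3.
exact: (cvg_lim (@norm_hausdorff _ _) cvg3).
Qed.

(** The mean value theorem is applied along [u] to the increment of [f] by [h *: v], then along [v]
    to ['D_u f]. The second difference is symmetric in [u] and [v], which [derive_comm] exploits. *)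
Lemma second_difference f x u v (h : R) :
    (forall y, derivable f y u) -> (forall y, derivable ('D_u f) y v) ->
  exists a b : R, [/\ `|a| <= `|h|, `|b| <= `|h| &
    f (x + h *: u + h *: v) - f (x + h *: u) - f (x + h *: v) + f x =
    h * (h * 'D_v ('D_u f) (x + a *: u + b *: v))].
Proof.
move=> du dvu.
pose g := fun y => f (y + h *: v) - f y.
have fs y : is_derive y u (fun y => f (y + h *: v)) ('D_u f (y + h *: v)).
  have := du (y + h *: v); rewrite /derivable => H.
  have E : (fun k : R => k^-1 *: (((fun y => f (y + h *: v)) \o shift y) (k *: u)
      - f (y + h *: v))) =
    (fun k : R => k^-1 *: ((f \o shift (y + h *: v)) (k *: u) - f (y + h *: v))).
    by apply/funext => k /=; rewrite -addrA.
  by split; rewrite /derivable /derive E.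
have dg y : is_derive y u g ('D_u f (y + h *: v) - 'D_u f y).
  exact: (@is_deriveB _ _ _ (fun y => f (y + h *: v)) f _ _ _ _ (fs y) (DeriveDef (du y) erefl)).
have [a ha Ea] := MVT_line x h (fun y => @ex_derive _ _ _ _ _ _ _ (dg y)).
have [b hb Eb] := MVT_line (x + a *: u) h dvu.
exists a, b; split => //.
rewrite -Eb -(@derive_val _ _ _ _ _ _ _ (dg (x + a *: u))) -Ea /g.
ring.
Qed.

(** Schwarz's theorem: the same second difference divided by h^2 is within e / 2 of either mixed
    derivative at [x]. *)
Lemma derive_comm f x u v :
    (forall y, derivable f y u) -> (forall y, derivable f y v) ->
    (forall y, derivable ('D_u f) y v) -> (forall y, derivable ('D_v f) y u) ->
    {for x, continuous ('D_v ('D_u f))} -> {for x, continuous ('D_u ('D_v f))} ->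
  'D_v ('D_u f) x = 'D_u ('D_v f) x.
Proof.
move=> du dv dvu duv c1 c2; apply/eqP; rewrite -subr_eq0 -normr_le0.
apply/ler_addgt0Pl => e e0; rewrite addr0.
have e2 : 0 < e / 2 by rewrite divr_gt0.
have /cvgrPdist_le/(_ _ e2) /(near_plane u v)[d1 d10 H1] := c1.
have /cvgrPdist_le/(_ _ e2) /(near_plane v u)[d2 d20 H2] := c2.
have [h [h0 hm1 hm2]] : exists h, [/\ 0 < h, h <= d1 & h <= d2].
  by exists (Num.min d1 d2); rewrite lt_min d10 d20 !ge_min !lexx orbT.
have hn : `|h| = h by rewrite gtr0_norm.
have [a [b [ha hb Eab]]] := second_difference x h du dvu.
have [a' [b' [ha' hb' Eab']]] := second_difference x h dv duv.
have {}Eab : 'D_v ('D_u f) (x + a *: u + b *: v) =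
             'D_u ('D_v f) (x + a' *: v + b' *: u).
  apply: (mulfI (lt0r_neq0 h0)); apply: (mulfI (lt0r_neq0 h0)).
  apply: (etrans (esym Eab)); apply: etrans Eab'.
  by rewrite [x + h *: u + _]addrAC [X in X + _]addrAC.
have k1 : `|'D_v ('D_u f) x - 'D_v ('D_u f) (x + a *: u + b *: v)| <= e / 2.
  by apply: H1; [apply: le_trans ha _ | apply: le_trans hb _]; rewrite hn.
have k2 : `|'D_u ('D_v f) x - 'D_u ('D_v f) (x + a' *: v + b' *: u)| <= e / 2.
  by apply: H2; [apply: le_trans ha' _ | apply: le_trans hb' _]; rewrite hn.
rewrite Eab in k1; rewrite (splitr e).
apply: le_trans (lerD k1 k2).
rewrite [X in _ <= _ + X]distrC; apply: le_trans (ler_normD _ _).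
by rewrite subrKA.
Qed.

End Directional.

Section Translation.
Local Open Scope complex_scope.
Variables (R : realType) (V : normedModType R).
Implicit Types (f : V -> R) (c x v : V).

Lemma growth_translate f (c x v : V) :
  (fun h : R => h^-1 *: (((fun y => f (y + c)) \o shift x) (h *: v) - f (x + c)))
  = (fun h => h^-1 *: ((f \o shift (x + c)) (h *: v) - f (x + c))).
Proof. by apply/funext => h /=; rewrite addrA. Qed.

Lemma derive_translate f (c x v : V) : 'D_v (fun y => f (y + c)) x = 'D_v f (x + c).
Proof. by rewrite /derive growth_translate. Qed.

Lemma derivable_translate f (c x v : V) :
  derivable f (x + c) v -> derivable (fun y => f (y + c)) x v.
Proof. by rewrite /derivable growth_translate. Qed.

Lemma continuous_translate f (c x : V) :
  {for (x + c), continuous f} -> {for x, continuous (fun y => f (y + c))}.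
Proof.
move=> cf; apply: (@continuous_comp _ _ _ (fun y : V => y + c) f) => //.
by apply: cvgD; [exact: cvg_id|exact: cvg_cst].
Qed.

End Translation.

Section Smooth.
Local Open Scope complex_scope.
Variables (R : realType) (n : nat).
Local Notation V := 'rV[R]_n.
Implicit Types (f g : V -> R) (x u v : V) (U : set V).

(** The induction strips the last direction of the list, the one that [foldr] applies first; hence
    stability of [P] under a single derivative suffices. *)
Lemma smooth_on_coind U (P : (V -> R) -> Prop) f :
    (forall g, P g -> forall x, U x ->
       {for x, continuous g} /\ forall v, derivable g x v) ->
    (forall g v, P g -> P ('D_v g)) ->
  P f -> smooth_on U f.
Proof.
move=> P1 PD + s; elim/last_ind: s f => [|s v IH] f Pf x Ux /=; first exact: P1.
by rewrite foldr_rcons; apply: IH => //; exact: PD.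
Qed.

Lemma smooth_on_derive U f v : smooth_on U f -> smooth_on U ('D_v f).
Proof. by move=> sf s x Ux; have := sf (rcons s v) x Ux; rewrite foldr_rcons. Qed.

Lemma foldr_derive_eq U f g (s : seq V) : open U -> {in U, f =1 g} ->
  {in U, foldr (fun v h => 'D_v h) f s =1 foldr (fun v h => 'D_v h) g s}.
Proof.
move=> oU fg; elim: s => //= v s IH x xU.
apply: near_eq_derive; near=> y; apply: IH; rewrite inE.
near: y; apply: open_nbhs_nbhs; split=> //; exact: set_mem.
Unshelve. all: by end_near. Qed.

Lemma near_eq_continuous (T : topologicalType) (f g : V -> T) x :
  (\forall y \near x, f y = g y) ->
  {for x, continuous f} -> {for x, continuous g}.
Proof.
move=> E c; suff : g @ x --> g x by [].
rewrite -(nbhs_singleton E).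
exact: (cvg_trans (near_eq_cvg E) c).
Qed.

Lemma smooth_on_eq U f g : open U -> {in U, f =1 g} -> smooth_on U f -> smooth_on U g.
Proof.
move=> oU fg sf s x Ux /=.
have [c d] := sf s x Ux.
have E : \forall y \near x, foldr (fun v h => 'D_v h) f s y =
    foldr (fun v h => 'D_v h) g s y.
  near=> y; apply: (foldr_derive_eq _ oU) => //; rewrite inE.
  by near: y; exact: open_nbhs_nbhs.
split; first exact: near_eq_continuous c.
by move=> v; exact: near_eq_derivable E (d v).
Unshelve. all: by end_near. Qed.

Record smooth f : Prop := Smooth { smooth_onT : smooth_on setT f }.

Lemma smooth_onW U f : smooth f -> smooth_on U f.
Proof. by move=> [sf] s x _; exact: sf. Qed.

Lemma smooth_locally f : (forall x, exists U, [/\ open U, U x & smooth_on U f]) ->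
  smooth f.
Proof. by move=> H; split=> s x _; have [U [oU Ux sf]] := H x; exact: sf. Qed.

Lemma smooth_continuous f : smooth f -> continuous f.
Proof. by move=> [sf] x; have [] := sf [::] x I. Qed.

Lemma smooth_derivable f x v : smooth f -> derivable f x v.
Proof. by move=> [sf]; have [_ d] := sf [::] x I; exact: d. Qed.

Lemma smooth_derive f v : smooth f -> smooth ('D_v f).
Proof. by move=> [sf]; split; exact: (smooth_on_derive v sf). Qed.

Lemma smooth_on_translate U f (c : V) : smooth_on U f ->
  smooth_on [set x | U (x + c)] (fun x => f (x + c)).
Proof.
move=> sf; apply: (@smooth_on_coind _
  (fun h => exists2 g, smooth_on U g & h = fun x => g (x + c))); last by exists f.
- move=> _ [g sg ->] x /= Ux; have [cg dg] := sg [::] _ Ux; split.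
    exact: continuous_translate.
  by move=> v; apply: derivable_translate.
- move=> _ v [g sg ->]; exists ('D_v g); first exact: smooth_on_derive.
  by apply/funext => x; rewrite derive_translate.
Qed.

Lemma smooth_translate f (c : V) : smooth f -> smooth (fun x => f (x + c)).
Proof.
by move=> [sf]; split=> l x _; exact: (@smooth_on_translate setT f c sf l x I).
Qed.

Lemma is_derive_coord (x v : V) i : is_derive x v (fun x : V => x ord0 i) (v ord0 i).
Proof.
have d : derivable (@id V) x v by exact: derivable_id.
split; first exact: ((derivable_mxP (@id V) x v).1 d ord0 i).
have := derive_mx d; rewrite derive_id => /matrixP/(_ ord0 i).
by rewrite mxE => ->.
Qed.

(* These functions are stable under 'D_v, hence smooth by coinduction. *)
Inductive smooth_expr : (V -> R) -> Prop :=
| SmoothBase f of smooth f : smooth_expr f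
| SmoothCst c : smooth_expr (cst c)
| SmoothCoord i : smooth_expr (fun x => x ord0 i)
| SmoothCos i : smooth_expr (fun x => cos (x ord0 i))
| SmoothSin i : smooth_expr (fun x => sin (x ord0 i))
| SmoothAdd f g of smooth_expr f & smooth_expr g : smooth_expr (f \+ g)
| SmoothMul f g of smooth_expr f & smooth_expr g : smooth_expr (f \* g).

Lemma is_derive_comp_coord (phi : R -> R) (d : R) (x v : V) i :
  is_derive (x ord0 i) 1 phi d ->
  is_derive x v (fun x : V => phi (x ord0 i)) (d * v ord0 i).
Proof.
move=> [dphi Dphi].
have E : (fun h : R => h^-1 *: (((fun x : V => phi (x ord0 i)) \o shift x) (h *: v)
      - phi (x ord0 i))) =
    (fun h => h^-1 *: ((phi \o shift (x ord0 i)) (h *: (v ord0 i *: (1 : R)))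
      - phi (x ord0 i))).
  by apply/funext => h /=; rewrite !mxE [_ *: (1 : R)]mulr1.
have [dd De] := is_derive_scale (v ord0 i) dphi.
split; first by rewrite /derivable E.
by rewrite -Dphi mulrC -De /derive E.
Qed.

Lemma is_derive_cos_coord (x v : V) i :
  is_derive x v (fun x : V => cos (x ord0 i)) (- sin (x ord0 i) * v ord0 i).
Proof. exact: is_derive_comp_coord. Qed.

Lemma is_derive_sin_coord (x v : V) i :
  is_derive x v (fun x : V => sin (x ord0 i)) (cos (x ord0 i) * v ord0 i).
Proof. exact: is_derive_comp_coord. Qed.

Lemma smooth_expr_derive f : smooth_expr f ->
  (forall x v, derivable f x v) /\ (forall v, smooth_expr ('D_v f)).
Proof.
elim=> {f} [f sf|c|i|i|i|f g ef [df IHf] eg [dg IHg]|f g ef [df IHf] eg [dg IHg]].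
- by split=> [x v|v]; [exact: smooth_derivable|apply: SmoothBase; exact: smooth_derive].
- split=> [x v|v]; first exact: derivable_cst.
  have -> : 'D_v (cst c : V -> R) = cst 0 by apply/funext => x; rewrite derive_cst.
  exact: SmoothCst.
- split=> [x v|v]; first by have [] := is_derive_coord x v i.
  have -> : 'D_v (fun x : V => x ord0 i) = cst (v ord0 i).
    by apply/funext => x; rewrite (@derive_val _ _ _ _ _ _ _ (is_derive_coord x v i)).
  exact: SmoothCst.
- split=> [x v|v]; first by have [] := is_derive_cos_coord x v i.
  have -> : 'D_v (fun x : V => cos (x ord0 i)) =
      (fun x : V => sin (x ord0 i)) \* cst (- v ord0 i).
    apply/funext => x; rewrite (@derive_val _ _ _ _ _ _ _ (is_derive_cos_coord x v i)) /=.
    by rewrite mulNr mulrN.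
  exact: SmoothMul (SmoothSin i) (SmoothCst _).
- split=> [x v|v]; first by have [] := is_derive_sin_coord x v i.
  have -> : 'D_v (fun x : V => sin (x ord0 i)) =
      (fun x : V => cos (x ord0 i)) \* cst (v ord0 i).
    by apply/funext => x; rewrite (@derive_val _ _ _ _ _ _ _ (is_derive_sin_coord x v i)).
  exact: SmoothMul (SmoothCos i) (SmoothCst _).
- split=> [x v|v]; first exact: derivableD.
  have -> : 'D_v (f \+ g) = 'D_v f \+ 'D_v g by apply/funext => x; exact: deriveD.
  exact: SmoothAdd.
- split=> [x v|v]; first exact: derivableM.
  have -> : 'D_v (f \* g) = (f \* 'D_v g) \+ (g \* 'D_v f).
    by apply/funext => x; exact: deriveM.
  by apply: SmoothAdd; apply: SmoothMul.
Qed.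

Lemma smooth_expr_continuous f : smooth_expr f -> continuous f.
Proof.
elim=> {f} [f sf|c|i|i|i|f g ef cf eg cg|f g ef cf eg cg] x.
- exact: smooth_continuous.
- exact: cst_continuous.
- exact: coord_continuous.
- by apply: continuous_comp; [exact: coord_continuous|exact: continuous_cos].
- by apply: continuous_comp; [exact: coord_continuous|exact: continuous_sin].
- exact: continuousD (cf x) (cg x).
- exact: continuousM (cf x) (cg x).
Qed.

Lemma smooth_expr_smooth f : smooth_expr f -> smooth f.
Proof.
move=> ef; split; move: ef; apply: smooth_on_coind => [g eg x _|g v eg]; last by case: (smooth_expr_derive eg).
by split; [exact: smooth_expr_continuous|case: (smooth_expr_derive eg)].
Qed.

Lemma smooth_cst c : smooth (cst c).
Proof. apply: smooth_expr_smooth; exact: SmoothCst. Qed.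

Lemma smooth_coord i : smooth (fun x => x ord0 i).
Proof. apply: smooth_expr_smooth; exact: SmoothCoord. Qed.

Lemma smooth_cos i : smooth (fun x => cos (x ord0 i)).
Proof. apply: smooth_expr_smooth; exact: SmoothCos. Qed.

Lemma smooth_sin i : smooth (fun x => sin (x ord0 i)).
Proof. apply: smooth_expr_smooth; exact: SmoothSin. Qed.

Lemma smoothD f g : smooth f -> smooth g -> smooth (fun x => f x + g x).
Proof.
by move=> sf sg; exact: smooth_expr_smooth (SmoothAdd (SmoothBase sf) (SmoothBase sg)).
Qed.

Lemma smoothM f g : smooth f -> smooth g -> smooth (fun x => f x * g x).
Proof.
by move=> sf sg; exact: smooth_expr_smooth (SmoothMul (SmoothBase sf) (SmoothBase sg)).
Qed.

Lemma smoothN f : smooth f -> smooth (fun x => - f x).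
Proof.
move=> sf; have -> : (fun x => - f x) = (fun x => cst (-1) x * f x).
  by apply/funext => x; rewrite mulN1r.
exact: smoothM (smooth_cst _) sf.
Qed.

Lemma smoothB f g : smooth f -> smooth g -> smooth (fun x => f x - g x).
Proof. by move=> sf sg; exact: smoothD sf (smoothN sg). Qed.

Lemma smooth_deriveD f g v x : smooth f -> smooth g ->
  'D_v (fun y => f y + g y) x = 'D_v f x + 'D_v g x.
Proof.
by move=> sf sg; exact: (deriveD (@smooth_derivable f x v sf) (@smooth_derivable g x v sg)).
Qed.

Lemma smooth_deriveB f g v x : smooth f -> smooth g ->
  'D_v (fun y => f y - g y) x = 'D_v f x - 'D_v g x.
Proof.
by move=> sf sg; exact: (deriveB (@smooth_derivable f x v sf) (@smooth_derivable g x v sg)).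
Qed.

Lemma smooth_deriveM f g v x : smooth f -> smooth g ->
  'D_v (fun y => f y * g y) x = f x * 'D_v g x + g x * 'D_v f x.
Proof.
by move=> sf sg; exact: (deriveM (@smooth_derivable f x v sf) (@smooth_derivable g x v sg)).
Qed.

Lemma smooth_derive_add f u v x : smooth f ->
  'D_(u + v) f x = 'D_u f x + 'D_v f x.
Proof.
move=> sf; apply: derive_val; apply: is_derive_add.
- by move=> y; exact: smooth_derivable.
- exact: smooth_derivable.
- exact: (smooth_continuous (smooth_derive v sf)).
Qed.

Lemma smooth_derive_scale f v x (c : R) : smooth f -> 'D_(c *: v) f x = c * 'D_v f x.
Proof.
by move=> sf; apply: derive_val; apply: is_derive_scale; exact: smooth_derivable.
Qed.

Lemma smooth_derive_basis f v x : smooth f ->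
  'D_v f x = \sum_i v ord0 i * 'D_(delta_mx ord0 i) f x.
Proof.
move=> sf; rewrite {1}(row_sum_delta v).
apply: (big_ind2 (fun w (d : R) => 'D_w f x = d)).
- exact: derive0.
- by move=> v1 ? v2 ? <- <-; exact: smooth_derive_add.
- by move=> i _; exact: smooth_derive_scale.
Qed.

Lemma smooth_derive_comm f u v x : smooth f ->
  'D_v ('D_u f) x = 'D_u ('D_v f) x.
Proof.
move=> sf; have [su sv] := (smooth_derive u sf, smooth_derive v sf).
have D g w : smooth g -> forall y, derivable g y w.
  by move=> sg y; exact: smooth_derivable.
have c1 : {for x, continuous ('D_v ('D_u f))}.
  exact: (smooth_continuous (smooth_derive v su)).
have c2 : {for x, continuous ('D_u ('D_v f))}.
  exact: (smooth_continuous (smooth_derive u sv)).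
exact: (derive_comm (D _ _ sf) (D _ _ sf) (D _ _ su) (D _ _ sv) c1 c2).
Qed.

End Smooth.

(** * Rigidity of the first order systems *)

(** Proof by certificate: once [ring] or [field] has checked the equality of differences, the known
    equation yields the wanted one. *)
Lemma eq_of_eq (K : zmodType) (l r x y : K) : l = r -> x - y = l - r -> x = y.
Proof. by move=> -> /eqP; rewrite subrr subr_eq0 => /eqP. Qed.

Section Structure.
Variables (K : numFieldType) (X : Type) (S : (X -> K) -> Prop).

(** Three summands are the longest combination met in the rigidity proofs; shorter ones follow by
    zero coefficients. *)
Record is_linear_op (D : (X -> K) -> X -> K) : Prop := IsLinearOp {
  linear_op_closed : forall f, S f -> S (D f) ;
  linear_op3 : forall c d e f g k, S f -> S g -> S k -> forall x,
    D (fun x => c * f x + d * g x + e * k x) x = c * D f x + d * D g x + e * D k x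
}.

Lemma linear_op2 D (LD : is_linear_op D) c d f g : S f -> S g -> forall x,
  D (fun x => c * f x + d * g x) x = c * D f x + d * D g x.
Proof.
move=> Sf Sg x.
have := linear_op3 LD c d 0 Sf Sg Sg x; rewrite mul0r addr0 => <-.
by congr (D _ x); apply/funext => y; rewrite mul0r addr0.
Qed.

Lemma linear_op1 D (LD : is_linear_op D) c f : S f -> forall x,
  D (fun x => c * f x) x = c * D f x.
Proof.
move=> Sf x.
have := linear_op2 LD c 0 Sf Sf x; rewrite mul0r addr0 => <-.
by congr (D _ x); apply/funext => y; rewrite mul0r addr0.
Qed.

Variables (T F1 F2 F3 : (X -> K) -> X -> K) (s h : K).

(* T acts on the span of the commuting F1, F2, F3 as an infinitesimal rotation
   with axis h F1 + s F3. *)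
Record structure_equations : Prop := StructureEquations {
  linT : is_linear_op T ; linF1 : is_linear_op F1 ;
  linF2 : is_linear_op F2 ; linF3 : is_linear_op F3 ;
  brT1 : forall f x, S f -> T (F1 f) x = F1 (T f) x + s * F2 f x ;
  brT2 : forall f x, S f -> T (F2 f) x = F2 (T f) x + h * F3 f x - s * F1 f x ;
  brT3 : forall f x, S f -> T (F3 f) x = F3 (T f) x - h * F2 f x ;
  br12 : forall f x, S f -> F1 (F2 f) x = F2 (F1 f) x ;
  br13 : forall f x, S f -> F1 (F3 f) x = F3 (F1 f) x
}.

Hypothesis SE : structure_equations.
Variable i : K.
Hypothesis ii : i * i = -1.

(** Compatibility of the two equations: when [T, F2] b is computed from them, the second order terms
    F3 F1 b and the multiples of F3 b cancel and s F1 b = 0 remains. Then [T, F1] b leaves s F2 b =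
    0, and the second equation gives F3 b = 0. *)
Lemma rigidity01 b : S b -> s != 0 ->
    (forall x, T b x + i * F1 b x = - (i * h) * b x) ->
    (forall x, F2 b x - i * F3 b x = 0) ->
  forall x, [/\ T b x = - (i * h) * b x, F1 b x = 0, F2 b x = 0 & F3 b x = 0].
Proof.
case: SE => LT L1 L2 L3 bT1 bT2 bT3 b12 b13 Sb s0 H1 H2.
have [[S1 S2] S3] :=
  (linear_op_closed L1 Sb, linear_op_closed L2 Sb, linear_op_closed L3 Sb).
have EF2 : F2 b = fun x => i * F3 b x.
  by apply/funext => x; apply/eqP; rewrite -subr_eq0 H2.
have ET : T b = fun x => (- i) * F1 b x + (- (i * h)) * b x.
  by apply/funext => x; rewrite -H1; ring.
have F1b x : F1 b x = 0.
  have e1 : T (F2 b) x = i * T (F3 b) x by rewrite EF2 linear_op1.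
  have e2 : F1 (F2 b) x = i * F1 (F3 b) x by rewrite EF2 linear_op1.
  have e3 : F2 (T b) x = - i * F2 (F1 b) x + - (i * h) * F2 b x.
    by rewrite ET linear_op2.
  have e4 : F3 (T b) x = - i * F3 (F1 b) x + - (i * h) * F3 b x.
    by rewrite ET linear_op2.
  have e5 : F2 b x = i * F3 b x by rewrite EF2.
  have e6 : F2 (F1 b) x = i * F3 (F1 b) x by rewrite -b12 // e2 b13.
  have E : i * T (F3 b) x = F2 (T b) x + h * F3 b x - s * F1 b x.
    by rewrite -e1 bT2.
  apply: (mulfI s0); apply: (eq_of_eq E).
  by rewrite bT3 // e4 e3 e6 e5; ring: ii.
have F1b0 : F1 b = fun x => 0 * b x by apply/funext => x; rewrite mul0r F1b.
have Tb : T b = fun x => - (i * h) * b x.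
  by apply/funext => x; rewrite -H1 F1b mulr0 addr0.
have F2b x : F2 b x = 0.
  have := bT1 b x Sb; rewrite F1b0 Tb !linear_op1 // F1b mul0r mulr0 add0r.
  by move=> /esym/eqP; rewrite mulf_eq0 (negPf s0) => /eqP.
split=> //; first by rewrite Tb.
have := H2 x; rewrite F2b sub0r => /eqP; rewrite oppr_eq0 mulf_eq0 => /orP[/eqP i0|/eqP //].
by move: ii; rewrite i0 mul0r => /eqP; rewrite eq_sym oppr_eq0 oner_eq0.
Qed.

(** The bracket [T, F2], applied to [b] and then to [a], expresses F1 b and F1 a linearly in [a] and
    [b]; hence so are T a and T b, and [T, F1] does the same for F2. Now F1 F2 b = F2 F1 b reads s a
    = h b, and F1 of this relation reads h a = 2 s b. The determinant of the two relations is h^2 -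
    2 s^2, whence the hypothesis on [h] and [s]. *)
Lemma rigidity10 a b : S a -> S b -> s != 0 -> h ^+ 2 != 2 * s ^+ 2 ->
    (forall x, T a x + i * F1 a x = - (i * s) * b x) ->
    (forall x, F2 a x + i * F3 a x = i * s / 2 * a x) ->
    (forall x, T b x + i * F1 b x = i * h * b x - i * s / 2 * a x) ->
    (forall x, F2 b x + i * F3 b x = 0) ->
  forall x, a x = 0 /\ b x = 0.
Proof.
case: SE => LT L1 L2 L3 bT1 bT2 bT3 b12 b13 Sa Sb s0 hs H1 H2 H3 H4.
have [[S1a S2a] S3a] :=
  (linear_op_closed L1 Sa, linear_op_closed L2 Sa, linear_op_closed L3 Sa).
have [[S1b S2b] S3b] :=
  (linear_op_closed L1 Sb, linear_op_closed L2 Sb, linear_op_closed L3 Sb).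
have F2bE : F2 b = fun x => (- i) * F3 b x.
  by apply/funext => x; apply: (eq_of_eq (H4 x)); ring.
have F2aE : F2 a = fun x => (- i) * F3 a x + i * s / 2 * a x.
  by apply/funext => x; apply: (eq_of_eq (H2 x)); ring.
have TbE : T b = fun x => (- i) * F1 b x + i * h * b x + - (i * s / 2) * a x.
  by apply/funext => x; apply: (eq_of_eq (H3 x)); ring.
have TaE : T a = fun x => (- i) * F1 a x + - (i * s) * b x.
  by apply/funext => x; apply: (eq_of_eq (H1 x)); ring.
have F1b : F1 b = fun x => s / 4 * a x.
  apply/funext => x.
  have e1 : T (F2 b) x = - i * T (F3 b) x by rewrite F2bE linear_op1.
  have e2 : F1 (F2 b) x = - i * F1 (F3 b) x by rewrite F2bE linear_op1.
  have e3 : F2 (T b) x =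
      - i * F2 (F1 b) x + i * h * F2 b x + - (i * s / 2) * F2 a x.
    by rewrite TbE linear_op3.
  have e4 : F3 (T b) x =
      - i * F3 (F1 b) x + i * h * F3 b x + - (i * s / 2) * F3 a x.
    by rewrite TbE linear_op3.
  have e5 : F2 b x = - i * F3 b x by rewrite F2bE.
  have e5' : F2 a x = - i * F3 a x + i * s / 2 * a x by rewrite F2aE.
  have e6 : F2 (F1 b) x = - i * F3 (F1 b) x by rewrite -b12 // e2 b13.
  have E : - i * T (F3 b) x = F2 (T b) x + h * F3 b x - s * F1 b x.
    by rewrite -e1 bT2.
  apply: (mulfI s0); apply: (eq_of_eq E).
  by rewrite bT3 // e4 e3 e6 e5 e5'; field: ii.
have F1a : F1 a = fun x => h / 2 * a x + - (s / 2) * b x.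
  apply/funext => x.
  have e1 : T (F2 a) x = - i * T (F3 a) x + i * s / 2 * T a x.
    by rewrite F2aE linear_op2.
  have e2 : F1 (F2 a) x = - i * F1 (F3 a) x + i * s / 2 * F1 a x.
    by rewrite F2aE linear_op2.
  have e3 : F2 (T a) x = - i * F2 (F1 a) x + - (i * s) * F2 b x.
    by rewrite TaE linear_op2.
  have e4 : F3 (T a) x = - i * F3 (F1 a) x + - (i * s) * F3 b x.
    by rewrite TaE linear_op2.
  have e5 : F2 b x = - i * F3 b x by rewrite F2bE.
  have e5' : F2 a x = - i * F3 a x + i * s / 2 * a x by rewrite F2aE.
  have e6 : F2 (F1 a) x = - i * F3 (F1 a) x + i * s / 2 * F1 a x.
    by rewrite -b12 // e2 b13.
  have e7 : T a x = - i * F1 a x + - (i * s) * b x by rewrite TaE.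
  have E : - i * T (F3 a) x + i * s / 2 * T a x =
      F2 (T a) x + h * F3 a x - s * F1 a x by rewrite -e1 bT2.
  apply: (mulfI s0); apply: (eq_of_eq E).
  by rewrite bT3 // e4 e3 e6 e5 e5' e7; field: ii.
have Tb : T b = fun x => i * h * b x + - (3 * i * s / 4) * a x.
  by apply/funext => x; rewrite TbE F1b; field.
have Ta : T a = fun x => - (i * h / 2) * a x + - (i * s / 2) * b x.
  by apply/funext => x; rewrite TaE F1a; field: ii.
have F2b x : F2 b x = - (i * s / 2) * b x.
  have E := bT1 b x Sb; apply: (mulfI s0); apply: (eq_of_eq (esym E)).
  by rewrite Tb F1b linear_op1 // linear_op2 // Ta F1a F1b; field: ii.
have F2a x : F2 a x = i * s / 2 * a x + - (i * h) * b x.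
  have E := bT1 a x Sa; apply: (mulfI s0); apply: (eq_of_eq (esym E)).
  by rewrite Ta F1a !linear_op2 // Ta Tb F1a F1b; field: ii.
have sa_hb x : s * a x = h * b x.
  have E := b12 b x Sb.
  have F2bf : F2 b = fun x => - (i * s / 2) * b x by apply/funext.
  move: E; rewrite F2bf F1b !linear_op1 // F2a F1b => E.
  have is0 : i * s / 4 != 0.
    rewrite !mulf_neq0 ?invr_eq0 ?pnatr_eq0 //; apply/eqP => i0.
    by move: ii; rewrite i0 mul0r => /eqP; rewrite eq_sym oppr_eq0 oner_eq0.
  by apply: (mulfI is0); apply: (eq_of_eq (esym E)); field.
have ha_sb x : h * a x = 2 * s * b x.
  have E : F1 (fun x => s * a x) x = F1 (fun x => h * b x) x.
    by congr (F1 _ x); apply/funext.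
  move: E; rewrite !linear_op1 // F1a F1b => E.
  have s4 : s / 4 != 0 by rewrite mulf_neq0 ?invr_eq0 ?pnatr_eq0.
  by apply: (mulfI s4); apply: (eq_of_eq E); field.
move=> x; have b0 : b x = 0.
  have hs' : h ^+ 2 - 2 * s ^+ 2 != 0 by rewrite subr_eq0.
  apply: (mulfI hs'); rewrite mulr0.
  have -> : (h ^+ 2 - 2 * s ^+ 2) * b x = h * (h * b x) - s * (2 * s * b x) by ring.
  by rewrite -sa_hb -ha_sb; ring.
by split=> //; apply: (mulfI s0); rewrite sa_hb b0 !mulr0.
Qed.

End Structure.

(** * Complex-valued functions and the frame *)

Section ComplexSmooth.
Local Open Scope complex_scope.
Variables (R : realType) (n : nat).
Local Notation V := 'rV[R]_n.
Implicit Types (F G : V -> R[i]) (f g : V -> R) (x u v : V) (c : R[i]).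

Definition csmooth F : Prop :=
  smooth (fun x => complex.Re (F x)) /\ smooth (fun x => complex.Im (F x)).

Definition cD v F : V -> R[i] := fun x =>
  'D_v (fun y => complex.Re (F y)) x +i* 'D_v (fun y => complex.Im (F y)) x.

Lemma Re_add (a b : R[i]) : complex.Re (a + b) = complex.Re a + complex.Re b.
Proof. by case: a; case: b. Qed.

Lemma Im_add (a b : R[i]) : complex.Im (a + b) = complex.Im a + complex.Im b.
Proof. by case: a; case: b. Qed.

Lemma Re_mul (a b : R[i]) : complex.Re (a * b) =
  complex.Re a * complex.Re b - complex.Im a * complex.Im b.
Proof. by case: a; case: b. Qed.

Lemma Im_mul (a b : R[i]) : complex.Im (a * b) =
  complex.Re a * complex.Im b + complex.Im a * complex.Re b.
Proof. by case: a; case: b. Qed.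

Lemma csmoothD F G : csmooth F -> csmooth G -> csmooth (fun x => F x + G x).
Proof.
move=> [F1 F2] [G1 G2]; split.
  by under eq_fun do rewrite Re_add; exact: smoothD F1 G1.
by under eq_fun do rewrite Im_add; exact: smoothD F2 G2.
Qed.

Lemma csmoothM F G : csmooth F -> csmooth G -> csmooth (fun x => F x * G x).
Proof.
move=> [F1 F2] [G1 G2]; split.
  by under eq_fun do rewrite Re_mul; exact: smoothB (smoothM F1 G1) (smoothM F2 G2).
by under eq_fun do rewrite Im_mul; exact: smoothD (smoothM F1 G2) (smoothM F2 G1).
Qed.

Lemma csmooth_cst c : csmooth (cst c).
Proof. by split; exact: smooth_cst. Qed.

Lemma csmooth_real f : smooth f -> csmooth (fun x => (f x)%:C).
Proof. by move=> sf; split => //=; exact: smooth_cst. Qed.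

Lemma csmooth_conj F : csmooth F -> csmooth (fun x => conjc (F x)).
Proof.
move=> [F1 F2]; split.
  by have -> : (fun x => complex.Re (conjc (F x))) = (fun x => complex.Re (F x))
    by apply/funext => x; case: (F x).
have -> : (fun x => complex.Im (conjc (F x))) = (fun x => - complex.Im (F x)).
  by apply/funext => x; case: (F x).
exact: smoothN.
Qed.

Lemma csmoothZ c F : csmooth F -> csmooth (fun x => c * F x).
Proof. exact: csmoothM (csmooth_cst c). Qed.

Lemma csmooth_sum (I : Type) (r : seq I) (P : pred I) (F : I -> V -> R[i]) :
  (forall i, csmooth (F i)) -> csmooth (fun x => \sum_(i <- r | P i) F i x).
Proof.
move=> sF; elim: r => [|i r IH].
  rewrite (_ : (fun x => _) = cst 0); first exact: csmooth_cst.
  by apply/funext => x; rewrite big_nil.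
rewrite (_ : (fun x => _) = if P i then
  (fun x => F i x + \sum_(j <- r | P j) F j x) else fun x => \sum_(j <- r | P j) F j x).
  by case: ifP => // _; exact: csmoothD.
by case: ifP => Pi; apply/funext => x; rewrite big_cons Pi.
Qed.

Lemma csmooth_cD v F : csmooth F -> csmooth (cD v F).
Proof. by move=> [F1 F2]; split; exact: smooth_derive. Qed.

Lemma cD_cst v c : cD v (cst c) = cst 0.
Proof.
by apply/funext => x; rewrite /cD; congr (_ +i* _); exact: derive_cst.
Qed.

Lemma cD_real v f : cD v (fun x => (f x)%:C) = fun x => ('D_v f x)%:C.
Proof.
by apply/funext => x; rewrite /cD; congr (_ +i* _); exact: derive_cst.
Qed.

Lemma cDD v F G x : csmooth F -> csmooth G ->
  cD v (fun x => F x + G x) x = cD v F x + cD v G x.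
Proof.
move=> [F1 F2] [G1 G2]; rewrite /cD -[RHS]/(_ +i* _).
under eq_fun do rewrite Re_add; under [in X in _ +i* X]eq_fun do rewrite Im_add.
by rewrite (smooth_deriveD _ _ F1 G1) (smooth_deriveD _ _ F2 G2).
Qed.

Lemma cDM v F G x : csmooth F -> csmooth G ->
  cD v (fun x => F x * G x) x = F x * cD v G x + G x * cD v F x.
Proof.
move=> [F1 F2] [G1 G2]; rewrite /cD.
under eq_fun do rewrite Re_mul; under [in X in _ +i* X]eq_fun do rewrite Im_mul.
rewrite (smooth_deriveB _ _ (smoothM F1 G1) (smoothM F2 G2)).
rewrite (smooth_deriveD _ _ (smoothM F1 G2) (smoothM F2 G1)).
rewrite (smooth_deriveM _ _ F1 G1) (smooth_deriveM _ _ F2 G2).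
rewrite (smooth_deriveM _ _ F1 G2) (smooth_deriveM _ _ F2 G1).
apply/eqP; rewrite eq_complex Re_add Im_add !Re_mul !Im_mul /=.
by apply/andP; split; apply/eqP; ring.
Qed.

Lemma cDZ v c F x : csmooth F -> cD v (fun x => c * F x) x = c * cD v F x.
Proof.
move=> sF; rewrite (@cDM v (cst c) F x (csmooth_cst c) sF).
by rewrite cD_cst mulr0 addr0.
Qed.

Lemma cD_sum v (I : Type) (r : seq I) (P : pred I) (F : I -> V -> R[i]) x :
  (forall i, csmooth (F i)) ->
  cD v (fun x => \sum_(i <- r | P i) F i x) x = \sum_(i <- r | P i) cD v (F i) x.
Proof.
move=> sF; elim: r => [|i r IH].
  rewrite big_nil (_ : (fun x => _) = cst 0); first by rewrite cD_cst.
  by apply/funext => y; rewrite big_nil.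
rewrite (_ : (fun x => _) = if P i then
  (fun x => F i x + \sum_(j <- r | P j) F j x) else fun x => \sum_(j <- r | P j) F j x).
  rewrite big_cons; case: ifP => // _.
  by rewrite cDD ?IH //; exact: csmooth_sum.
by case: ifP => Pi; apply/funext => y; rewrite big_cons Pi.
Qed.

Lemma cD_comm u v F x : csmooth F -> cD v (cD u F) x = cD u (cD v F) x.
Proof.
move=> [F1 F2].
have E w z : cD w (cD z F) x = 'D_w ('D_z (fun y => complex.Re (F y))) x +i*
   'D_w ('D_z (fun y => complex.Im (F y))) x by [].
by rewrite E E (@smooth_derive_comm _ _ _ u v x F1) (@smooth_derive_comm _ _ _ u v x F2).
Qed.

Lemma cD_basis v F x : csmooth F ->
  cD v F x = \sum_i (v ord0 i)%:C * cD (delta_mx ord0 i) F x.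
Proof.
move=> [F1 F2]; rewrite /cD.
rewrite (@smooth_derive_basis _ _ _ v x F1) (@smooth_derive_basis _ _ _ v x F2).
apply/eqP; rewrite eq_complex !raddf_sum /=; apply/andP; split; apply/eqP/eq_bigr => i _.
  by rewrite /= mul0r subr0.
by rewrite /= mul0r addr0.
Qed.

Lemma cD_translate v F (c x : V) : cD v (fun y => F (y + c)) x = cD v F (x + c).
Proof. by rewrite /cD; congr (_ +i* _); exact: derive_translate. Qed.

Lemma csmooth_translate F (c : V) : csmooth F -> csmooth (fun x => F (x + c)).
Proof.
by move=> [F1 F2]; split; [exact: (smooth_translate c F1)|exact: (smooth_translate c F2)].
Qed.

(** [cderive] treats the real and imaginary parts of [v] separately; on a smooth function the result
    is C-linear in [v]. *)
Lemma cderiveE F x (v : 'rV[R[i]]_n) : csmooth F ->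
  cderive F x v = \sum_j v ord0 j * cD (delta_mx ord0 j) F x.
Proof.
move=> sF; rewrite /cderive -/(cD _ F x) -/(cD _ F x) !cD_basis //.
rewrite mulr_sumr -big_split; apply: eq_bigr => j _ /=; rewrite mulrA -mulrDl.
congr (_ * _); rewrite !mxE; case: (v ord0 j) => a b.
by apply/eqP; rewrite eq_complex /=; apply/andP; split; apply/eqP; ring.
Qed.

End ComplexSmooth.

Definition j1 : 'I_4 := @Ordinal 4 1 isT.
Definition j2 : 'I_4 := @Ordinal 4 2 isT.
Definition j3 : 'I_4 := @Ordinal 4 3 isT.

Section Frame.
Local Open Scope complex_scope.
Variables (R : realType) (s h : R).
Local Notation V := 'rV[R]_4.
Implicit Types (F : V -> R[i]) (x : V).

Definition pd (j : 'I_4) F : V -> R[i] := cD (delta_mx ord0 j) F.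
Definition ct x : R[i] := (cos (x ord0 ord0))%:C.
Definition st x : R[i] := (sin (x ord0 ord0))%:C.

(** Derivatives and trigonometric factors become variables, so that [ring] faces polynomial
    identities only. *)
Ltac gen_pd x :=
  repeat match goal with |- context [pd ?j ?G x] => generalize (pd j G x); intro end;
  generalize (ct x) (st x); do 2 intro.

(* The orthonormal frame d_t, n, e2, n x e2 of the header, where
   e2 = (- sin t, cos t, 0). *)
Definition vT : (V -> R[i]) -> V -> R[i] := pd ord0.
(** F1 and F3 lie in the plane of e1 = (cos t, sin t, 0) and d_z, with coordinates (s, h) and (- h,
    s); sharing one shape, they share one derivative formula. *)
Definition vE (p q : R[i]) F x : R[i] :=
  p * (ct x * pd j1 F x + st x * pd j2 F x) + q * pd j3 F x.
Definition vF1 : (V -> R[i]) -> V -> R[i] := vE s%:C h%:C.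
Definition vF2 F x : R[i] := - st x * pd j1 F x + ct x * pd j2 F x.
Definition vF3 : (V -> R[i]) -> V -> R[i] := vE (- h%:C) s%:C.

Lemma vF1E F x : vF1 F x =
  s%:C * (ct x * pd j1 F x + st x * pd j2 F x) + h%:C * pd j3 F x.
Proof. by []. Qed.

Lemma vF2E F x : vF2 F x = - st x * pd j1 F x + ct x * pd j2 F x.
Proof. by []. Qed.

Lemma vF3E F x : vF3 F x =
  - h%:C * (ct x * pd j1 F x + st x * pd j2 F x) + s%:C * pd j3 F x.
Proof. by []. Qed.

Lemma csmooth_ct : csmooth ct.
Proof. exact: csmooth_real (smooth_cos _ _). Qed.

Lemma csmooth_st : csmooth st.
Proof. exact: csmooth_real (smooth_sin _ _). Qed.

Lemma pd_ct j x : pd j ct x = if j == ord0 then - st x else 0.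
Proof.
rewrite /pd cD_real (@derive_val _ _ _ _ _ _ _ (is_derive_cos_coord _ _ _)) mxE eqxx /=.
rewrite eq_sym; case: eqP => _ /=; last by rewrite mulr0.
by rewrite mulr1 /st raddfN.
Qed.

Lemma pd_st j x : pd j st x = if j == ord0 then ct x else 0.
Proof.
rewrite /pd cD_real (@derive_val _ _ _ _ _ _ _ (is_derive_sin_coord _ _ _)) mxE eqxx /=.
rewrite eq_sym; case: eqP => _ /=; last by rewrite mulr0.
by rewrite mulr1.
Qed.

Lemma ct2_st2 x : ct x ^+ 2 + st x ^+ 2 = 1.
Proof. by rewrite /ct /st -!rmorphXn -rmorphD /= cos2Dsin2. Qed.

Lemma csmooth_pd j F : csmooth F -> csmooth (pd j F).
Proof. exact: csmooth_cD. Qed.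

Lemma pdM j F G x : csmooth F -> csmooth G ->
  pd j (fun x => F x * G x) x = F x * pd j G x + G x * pd j F x.
Proof. exact: cDM. Qed.

Lemma pd_comm j k F x : csmooth F -> pd j (pd k F) x = pd k (pd j F) x.
Proof. exact: cD_comm. Qed.

Opaque ct st.

Lemma is_linear_pd j : is_linear_op (@csmooth R 4) (pd j).
Proof.
split=> [F|c d e F G K sF sG sK x]; first exact: csmooth_pd.
Transparent pd.
rewrite /pd (@cDD _ _ _ (fun x => c * F x + d * G x) (fun x => e * K x)).
- rewrite (@cDD _ _ _ (fun x => c * F x) (fun x => d * G x)).
  + by rewrite !cDZ.
  + exact: csmoothZ.
  + exact: csmoothZ.
- exact: csmoothD (csmoothZ _ sF) (csmoothZ _ sG).
- exact: csmoothZ.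
Qed.

Lemma pdD j F G x : csmooth F -> csmooth G ->
  pd j (fun x => F x + G x) x = pd j F x + pd j G x.
Proof. exact: cDD. Qed.

Opaque pd.

Lemma csmooth_e1 F : csmooth F ->
  csmooth (fun x => ct x * pd j1 F x + st x * pd j2 F x).
Proof.
move=> sF; apply: csmoothD.
  exact: csmoothM csmooth_ct (csmooth_pd _ sF).
exact: csmoothM csmooth_st (csmooth_pd _ sF).
Qed.

Lemma csmooth_vE p q F : csmooth F -> csmooth (vE p q F).
Proof.
move=> sF; apply: csmoothD (csmoothZ _ (csmooth_pd _ sF)).
exact: csmoothZ (csmooth_e1 sF).
Qed.

Lemma csmooth_vF2 F : csmooth F -> csmooth (vF2 F).
Proof.
move=> sF; apply: csmoothD (csmoothM csmooth_ct (csmooth_pd _ sF)).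
rewrite (_ : (fun x => - st x * pd j1 F x) =
  (fun x => -1 * (st x * pd j1 F x))).
  exact: csmoothZ (csmoothM csmooth_st (csmooth_pd _ sF)).
by apply/funext => x; rewrite mulN1r mulNr.
Qed.

Lemma is_linear_vE p q : is_linear_op (@csmooth R 4) (vE p q).
Proof.
split=> [|c d e F G K sF sG sK x]; first exact: csmooth_vE.
have L j := linear_op3 (is_linear_pd j) c d e sF sG sK x.
by rewrite /vE !L; gen_pd x; ring.
Qed.

Lemma is_linear_vF2 : is_linear_op (@csmooth R 4) vF2.
Proof.
split=> [|c d e F G K sF sG sK x]; first exact: csmooth_vF2.
have L j := linear_op3 (is_linear_pd j) c d e sF sG sK x.
by rewrite /vF2 !L; gen_pd x; ring.
Qed.

Lemma pd_e1 j F x : csmooth F ->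
  pd j (fun x => ct x * pd j1 F x + st x * pd j2 F x) x =
  pd j ct x * pd j1 F x + ct x * pd j (pd j1 F) x +
  (pd j st x * pd j2 F x + st x * pd j (pd j2 F) x).
Proof.
move=> sF; have s1 := csmooth_pd j1 sF; have s2 := csmooth_pd j2 sF.
apply: (etrans (pdD j x (csmoothM csmooth_ct s1) (csmoothM csmooth_st s2))).
apply: (etrans (congr2 +%R (pdM j x csmooth_ct s1) (pdM j x csmooth_st s2))).
by gen_pd x; ring.
Qed.

Lemma pd_vE p q j F x : csmooth F ->
  pd j (vE p q F) x = p * (pd j ct x * pd j1 F x + ct x * pd j (pd j1 F) x +
    (pd j st x * pd j2 F x + st x * pd j (pd j2 F) x)) +
    q * pd j (pd j3 F) x.
Proof.
move=> sF; rewrite -pd_e1 //.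
exact: (linear_op2 (is_linear_pd j) p q (csmooth_e1 sF) (csmooth_pd _ sF)).
Qed.

Lemma pd_vF2 j F x : csmooth F ->
  pd j (vF2 F) x = - (pd j st x * pd j1 F x + st x * pd j (pd j1 F) x) +
    (pd j ct x * pd j2 F x + ct x * pd j (pd j2 F) x).
Proof.
move=> sF.
have s1 := csmooth_pd j1 sF; have s2 := csmooth_pd j2 sF.
have -> : vF2 F = fun x => -1 * (st x * pd j1 F x) + 1 * (ct x * pd j2 F x).
  by apply/funext => y; rewrite /vF2; gen_pd y; ring.
have m1 := pdM j x csmooth_st s1; have m2 := pdM j x csmooth_ct s2.
apply: (etrans (linear_op2 (is_linear_pd j) _ _ (csmoothM csmooth_st s1) (csmoothM csmooth_ct s2) x)).
apply: (etrans (congr2 (fun a b => -1 * a + 1 * b) m1 m2)).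
by gen_pd x; ring.
Qed.

(** Only e1 and e2 depend on t, with e1' = e2 and e2' = - e1. Writing - e1 as h F3 - s F1 uses s^2 +
    h^2 = 1. The fields F1, F2, F3 commute because their coefficients depend on t alone and none of
    them differentiates in t. *)
Lemma structure_frame : s ^+ 2 + h ^+ 2 = 1 ->
  structure_equations (@csmooth R 4) vT vF1 vF2 vF3 s%:C h%:C.
Proof.
move=> sh.
have i1 : j1 == ord0 = false by [].
have i2 : j2 == ord0 = false by [].
have i3 : j3 == ord0 = false by [].
have csh : s%:C * s%:C = 1 - h%:C * h%:C :> R[i].
  rewrite -!rmorphM -(rmorph1 (real_complex R)) -rmorphB; congr (_%:C).
  by rewrite -sh; ring.
split=> [|||| F x sF|F x sF|F x sF|F x sF|F x sF].
- exact: is_linear_pd.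
- exact: is_linear_vE.
- exact: is_linear_vF2.
- exact: is_linear_vE.
- rewrite /vT /vF1 pd_vE // pd_ct pd_st /= /vE /vF2.
  by rewrite !(pd_comm ord0) //; gen_pd x; ring.
- rewrite /vT pd_vF2 // pd_ct pd_st /= /vF1 /vF2 /vF3 /vE.
  by rewrite !(pd_comm ord0) //; gen_pd x; ring: csh.
- rewrite /vT /vF3 pd_vE // pd_ct pd_st /= /vE /vF2.
  by rewrite !(pd_comm ord0) //; gen_pd x; ring.
- rewrite (vF1E (vF2 F)) (vF2E (vF1 F)) /vF1 !pd_vE // !pd_vF2 // !pd_ct !pd_st !i1 !i2 !i3.
  rewrite (pd_comm j2 j1) // (pd_comm j3 j1) //.
  by rewrite (pd_comm j3 j2) //; gen_pd x; ring.
- rewrite (vF1E (vF3 F)) (vF3E (vF1 F)) /vF1 /vF3 !pd_vE // !pd_ct !pd_st !i1 !i2 !i3.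
  rewrite (pd_comm j2 j1) // (pd_comm j3 j1) //.
  by rewrite (pd_comm j3 j2) //; gen_pd x; ring.
Qed.

End Frame.

(** * The torus as a manifold *)

Section Angle.
Variable R : realType.
Implicit Types t : R.

(* The representative in ]-pi, pi[ of an angle with cosine c <> -1 and sine s. *)
Definition angle (c s : R) : R := 2 * atan (s / (1 + c)).

Lemma angle_itv c s : - pi < angle c s < pi.
Proof.
rewrite /angle; have := atan_gtNpi2 (s / (1 + c)); have := atan_ltpi2 (s / (1 + c)).
by move=> h1 h2; apply/andP; split; lra.
Qed.

(** With a = atan u, the identity 1 + tan^2 = 1 / cos^2 gives cos^2 a = (1 + c) / 2; the double
    angle formulas do the rest. *)
Lemma cos_sin_angle c s : c ^+ 2 + s ^+ 2 = 1 -> c != -1 ->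
  cos (angle c s) = c /\ sin (angle c s) = s.
Proof.
move=> cs c1; have c0 : 1 + c != 0 by rewrite addrC -(opprK 1) subr_eq0.
rewrite /angle; set u := s / (1 + c); set a := atan u.
have cg : 0 < cos a by apply: cos_gt0_pihalf; rewrite atan_gtNpi2 atan_ltpi2.
have c2 : cos a ^+ 2 = (1 + c) / 2.
  have := cos2_tan2 (lt0r_neq0 cg); rewrite atanK => H.
  have {}H : cos a ^+ 2 = (1 + u ^+ 2)^-1 by rewrite -H invrK.
  rewrite H /u -[RHS]invrK; congr (_^-1); rewrite invf_div.
  have s2 : s ^+ 2 = (1 + c) * (1 - c).
    have -> : s ^+ 2 = 1 - c ^+ 2 by rewrite -cs addrC addKr.
    by ring.
  by rewrite expr_div_n s2; field.
have s1 : sin a = u * cos a.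
  have := atanK u; rewrite -/a /tan => {1}<-.
  by rewrite divfK // lt0r_neq0.
rewrite mulr_natl; split.
  by rewrite cos_mulr2n c2 mulr2n; field.
by rewrite sin_mulr2n s1 mulrCA -expr2 c2 /u mulr2n; field.
Qed.

Lemma cos_neqN1 t : - pi < t < pi -> cos t != -1.
Proof.
move=> /andP[t1 t2]; have cg : 0 < cos (t / 2).
  by apply: cos_gt0_pihalf; apply/andP; split; lra.
have -> : t = (t / 2) *+ 2 by rewrite mulr2n; field.
rewrite cos_mulr2n -subr_eq0 opprK subrK mulrn_eq0 /=.
by rewrite expf_eq0 /= gt_eqF.
Qed.

Lemma angle_id t : - pi < t < pi -> angle (cos t) (sin t) = t.
Proof.
move=> /andP[t1 t2]; have cg : 0 < cos (t / 2).
  by apply: cos_gt0_pihalf; apply/andP; split; lra.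
have cn := lt0r_neq0 cg.
have E : t = (t / 2) *+ 2 by rewrite mulr2n; field.
have Es : sin t = (cos (t / 2) * sin (t / 2)) *+ 2 by rewrite {1}E sin_mulr2n.
have Ec : cos t = cos (t / 2) ^+ 2 *+ 2 - 1 by rewrite {1}E cos_mulr2n.
rewrite /angle Es Ec.
have -> : (cos (t / 2) * sin (t / 2)) *+ 2 / (1 + (cos (t / 2) ^+ 2 *+ 2 - 1)) = tan (t / 2).
  by rewrite /tan !mulr2n; field; rewrite cn /=; apply/eqP; nra.
rewrite tanK; first by field.
by rewrite in_itv /=; apply/andP; split; lra.
Qed.

(** As long as the right side stays in ]-pi, pi[, the angle is an affine function of t. The
    smoothness of the transition maps comes from this, not from differentiating [atan]. *)
Lemma angle_translate t0 t : cos t0 != -1 ->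
  let a := angle (cos t0) (sin t0) in
  - pi < a + (t - t0) < pi -> angle (cos t) (sin t) = a + (t - t0).
Proof.
move=> c0 a ha; have e : t = t0 + (t - t0) by ring.
have [ca sa] := cos_sin_angle (cos2Dsin2 t0) c0; rewrite -/a in ca sa.
have -> : cos t = cos (a + (t - t0)) by rewrite {1}e !cosD ca sa.
have -> : sin t = sin (a + (t - t0)) by rewrite {1}e !sinD ca sa.
exact: angle_id.
Qed.

End Angle.

Section RowVectors.
Variables (R : realType) (n : nat).

Lemma near_rV (x : 'rV[R]_n) (P : 'I_n -> R -> Prop) :
  (forall i, \forall t \near x ord0 i, P i t) ->
  nbhs x [set y : 'rV[R]_n | forall i, P i (y ord0 i)].
Proof.
move=> H; exists (fun _ i => P i); first by move=> i j; rewrite (ord1 i); exact: H.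
by move=> y /= Py i; exact: Py.
Qed.

Lemma rV_continuous (T : topologicalType) (f : T -> 'rV[R]_n) (x : T) :
  (forall i, {for x, continuous (fun y => f y ord0 i)}) -> {for x, continuous f}.
Proof.
move=> H A [P nP PA]; rewrite /nbhs /=.
have : \forall y \near x, forall i, P ord0 i (f y ord0 i).
  by apply: filter_forall => i; apply: H; exact: nP.
by apply: filterS => y Py; apply: PA => i j; rewrite (ord1 i).
Qed.

Lemma open_itv_box (a b : R) : open [set x : 'rV[R]_n | forall i, a < x ord0 i < b].
Proof.
rewrite openE => x /= Hx; rewrite /interior.
apply: (@near_rV x (fun i t => a < t < b)) => i.
have /andP[h1 h2] := Hx i.
near=> t; apply/andP; split; near: t; [exact: lt_nbhsr|exact: lt_nbhsl].
Unshelve. all: by end_near. Qed.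

End RowVectors.

Section Torus.
Variables (R : realType) (n : nat).
Local Notation V := 'rV[R]_n.
Implicit Types x y : V.

(** The quotient by (2 pi Z)^n is encoded as the image of this map. Points are equal when their
    cosines and sines are, and the Hausdorff property is inherited from the ambient space. *)
Definition torus_embed x : V * V := (\row_i cos (x ord0 i), \row_i sin (x ord0 i)).

Definition torus_set : Type := set_type (range torus_embed).

Definition torus_mk x : torus_set := exist _ (torus_embed x) (mem_set (imageT torus_embed x)).

HB.instance Definition _ := Choice.on torus_set.
HB.instance Definition _ := isPointed.Build torus_set (torus_mk 0).

Definition torus : Type := @initial_topology torus_set (V * V)%type val.

HB.instance Definition _ := PseudoMetric.on torus.
HB.instance Definition _ := Pointed.on torus.

End Torus.

Section TorusManifold.
Variables (R : realType) (n : nat).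
Local Notation V := 'rV[R]_n.
Local Notation T := (torus R n).
Implicit Types (x y : V) (p q : T).

Definition tproj x : T := torus_mk x.

Definition tcos p (i : 'I_n) : R := (val (p : torus_set R n)).1 ord0 i.
Definition tsin p (i : 'I_n) : R := (val (p : torus_set R n)).2 ord0 i.

Lemma tcosE x i : tcos (tproj x) i = cos (x ord0 i).
Proof. by rewrite /tcos /= mxE. Qed.

Lemma tsinE x i : tsin (tproj x) i = sin (x ord0 i).
Proof. by rewrite /tsin /= mxE. Qed.

Lemma torus_eq p q :
  (forall i, tcos p i = tcos q i) -> (forall i, tsin p i = tsin q i) -> p = q.
Proof.
move=> hc hs; apply: (@val_inj _ _ (torus_set R n)).
move: hc hs; rewrite /tcos /tsin; case: (val p) => a b; case: (val q) => c d /= hc hs.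
by congr (_, _); apply/rowP.
Qed.

Lemma tproj_surj p : exists x, tproj x = p.
Proof.
have [x _ xp] := set_mem (valP (p : torus_set R n)).
by exists x; apply: (@val_inj _ _ (torus_set R n)).
Qed.

(** A section of the covering picked by choice, without continuity or bounds. Charts add a fixed
    lift to their coordinates, and other uses concern periodic functions, which do not see the
    choice. *)
Definition tlift p : V := projT1 (cid (tproj_surj p)).

Lemma tliftK p : tproj (tlift p) = p.
Proof. exact: (projT2 (cid (tproj_surj p))). Qed.

Lemma tproj_eq x y : tproj x = tproj y <->
  forall i, cos (x ord0 i) = cos (y ord0 i) /\ sin (x ord0 i) = sin (y ord0 i).
Proof.
split=> [e i|H]; first by rewrite -!tcosE -!tsinE e.
by apply: torus_eq => i; rewrite ?tcosE ?tsinE; case: (H i).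
Qed.

Lemma tproj_translate x y z : tproj x = tproj y -> tproj (x + z) = tproj (y + z).
Proof.
move=> /tproj_eq H; apply/tproj_eq => i; have [hc hs] := H i.
by rewrite !mxE !cosD !sinD hc hs.
Qed.

Lemma tproj_periodic (x y : V) : (forall i, y ord0 i = x ord0 i \/
  y ord0 i = x ord0 i + pi *+ 2) -> tproj y = tproj x.
Proof.
by move=> h; apply/tproj_eq => i; case: (h i) => ->; rewrite ?cosD2pi ?sinD2pi.
Qed.

Lemma continuous_tval : continuous (fun p : T => val (p : torus_set R n)).
Proof. exact: initial_continuous. Qed.

Lemma continuous_tcos i : continuous (fun p => tcos p i).
Proof.
move=> p; apply: (@continuous_comp _ _ _ (fun p : T => val (p : torus_set R n))
  (fun z : V * V => z.1 ord0 i)); first exact: continuous_tval.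
apply: (@continuous_comp _ _ _ fst (fun z : V => z ord0 i)); first exact: cvg_fst.
exact: coord_continuous.
Qed.

Lemma continuous_tsin i : continuous (fun p => tsin p i).
Proof.
move=> p; apply: (@continuous_comp _ _ _ (fun p : T => val (p : torus_set R n))
  (fun z : V * V => z.2 ord0 i)); first exact: continuous_tval.
apply: (@continuous_comp _ _ _ snd (fun z : V => z ord0 i)); first exact: cvg_snd.
exact: coord_continuous.
Qed.

Lemma continuous_tproj : continuous tproj.
Proof.
apply: continuous_comp_initial => x.
have -> : val \o @torus_mk R n = (fun x => (\row_i cos (x ord0 i) : V, \row_i sin (x ord0 i) : V)).
  by [].
have c1 : {for x, continuous (fun x : V => \row_i cos (x ord0 i) : V)}.
  apply: rV_continuous => i.
  rewrite (_ : (fun _ => _) = fun x : V => cos (x ord0 i)).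
    exact: (smooth_continuous (smooth_cos _ _)).
  by apply/funext => y; rewrite mxE.
have c2 : {for x, continuous (fun x : V => \row_i sin (x ord0 i) : V)}.
  apply: rV_continuous => i.
  rewrite (_ : (fun _ => _) = fun x : V => sin (x ord0 i)).
    exact: (smooth_continuous (smooth_sin _ _)).
  by apply/funext => y; rewrite mxE.
move=> A [[B C] /= [nB nC] BC].
have n1 : nbhs x [set y : V | B (\row_i cos (y ord0 i))] := c1 _ nB.
have n2 : nbhs x [set y : V | C (\row_i sin (y ord0 i))] := c2 _ nC.
suff : nbhs x [set y : V | A (\row_i cos (y ord0 i), \row_i sin (y ord0 i))] by [].
by apply: filterS (filterI n1 n2) => y [By Cy]; exact: BC.
Qed.

Lemma torus_hausdorff : hausdorff_space T.
Proof.
move=> p q pq; apply: (@val_inj _ _ (torus_set R n)).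
apply: (@norm_hausdorff _ (V * V)%type) => A B pA qB.
have [z [zA zB]] := pq _ _ (continuous_tval pA) (continuous_tval qB).
by exists (val (z : torus_set R n)).
Qed.

Lemma reduce_angle (t : R) :
  exists2 u : R, - pi <= u <= pi & cos u = cos t /\ sin u = sin t.
Proof.
have [c1|c1] := eqVneq (cos t) (-1).
  (* [angle] never takes the value pi, so this angle is supplied by hand. *)
  exists pi; first by rewrite lexx andbT; have := pi_ge0 R; lra.
  rewrite cospi sinpi c1; split => //; apply/esym.
  by apply: cos1sin0; rewrite c1 normrN1.
exists (angle (cos t) (sin t)); last exact: cos_sin_angle (cos2Dsin2 t) c1.
by have /andP[/ltW -> /ltW ->] := angle_itv (cos t) (sin t).
Qed.

Lemma tproj_lift_pi p : exists c : V, (forall i, - pi <= c ord0 i <= pi) /\ tproj c = p.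
Proof.
have H i := reduce_angle (tlift p ord0 i).
exists (\row_i projT1 (cid2 (H i))); split=> [i|]; first by rewrite mxE; case: cid2.
by rewrite -[RHS]tliftK; apply/tproj_eq => i; rewrite mxE; case: cid2.
Qed.

Lemma torus_compact : compact [set: T].
Proof.
have -> : [set: T] = tproj @` [set x : V | forall i, `[- pi, pi]%classic (x ord0 i)].
  apply/seteqP; split=> // p _; have [c [cpi <-]] := tproj_lift_pi p.
  by exists c => // i; rewrite /= in_itv.
apply: continuous_compact.
  by apply: continuous_subspaceT; exact: continuous_tproj.
by apply: (@rV_compact _ n (fun _ => `[- pi, pi]%classic)) => i; exact: segment_compact.
Qed.

Lemma torus_second_countable : @second_countable T.
Proof. exact: compact_second_countable torus_compact. Qed.

(** Cosine and, next, sine of the coordinate difference from [p] to [q], written without lifts so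
    that continuity in [q] is visible. *)
Definition dcos p q i := tcos q i * tcos p i + tsin q i * tsin p i.
Definition dsin p q i := tsin q i * tcos p i - tcos q i * tsin p i.

Lemma dcosE x y i : dcos (tproj x) (tproj y) i = cos (y ord0 i - x ord0 i).
Proof. by rewrite /dcos !tcosE !tsinE cosB. Qed.

Lemma dsinE x y i : dsin (tproj x) (tproj y) i = sin (y ord0 i - x ord0 i).
Proof. by rewrite /dsin !tcosE !tsinE sinB. Qed.

Definition tdom p : set T := [set q | forall i, dcos p q i != -1].
Definition tchart p q : V := \row_i angle (dcos p q i) (dsin p q i).
Definition tcinv p x : T := tproj (tlift p + x).
Definition tbox : set V := [set x | forall i, - pi < x ord0 i < pi].

Lemma tbox_open : open tbox.
Proof. exact: open_itv_box. Qed.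

Lemma continuous_dcos p q i : {for q, continuous (fun q => dcos p q i)}.
Proof.
have c1 : {for q, continuous (fun q => tcos q i)} by exact: continuous_tcos.
have c2 : {for q, continuous (fun q => tsin q i)} by exact: continuous_tsin.
have k (c : R) : {for q, continuous (fun=> c)} by exact: cst_continuous.
exact: (continuousD (continuousM c1 (k _)) (continuousM c2 (k _))).
Qed.

Lemma continuous_dsin p q i : {for q, continuous (fun q => dsin p q i)}.
Proof.
have c1 : {for q, continuous (fun q => tcos q i)} by exact: continuous_tcos.
have c2 : {for q, continuous (fun q => tsin q i)} by exact: continuous_tsin.
have k (c : R) : {for q, continuous (fun=> c)} by exact: cst_continuous.
exact: (continuousB (continuousM c2 (k _)) (continuousM c1 (k _))).
Qed.

Lemma tdom_open p : open (tdom p).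
Proof.
rewrite openE => q Hq; rewrite /interior.
have H i : nbhs q [set z : T | dcos p z i != -1].
  have oN : open [set x : R | x != -1] by exact: open_neq.
  have nN : nbhs (dcos p q i) [set x : R | x != -1].
    by apply: open_nbhs_nbhs; split => //; exact: Hq.
  exact: (@continuous_dcos p q i _ nN).
exact: (filter_forall _ H).
Qed.

Lemma tdom_center p : tdom p p.
Proof.
move=> i; rewrite -(tliftK p) dcosE subrr cos0.
by rewrite gt_eqF // (lt_trans (ltrN10 R)) // ltr01.
Qed.

Lemma tchart_tproj x y i : tchart (tproj x) (tproj y) ord0 i =
  angle (cos (y ord0 i - x ord0 i)) (sin (y ord0 i - x ord0 i)).
Proof. by rewrite mxE dcosE dsinE. Qed.

Lemma tchart_near x y : tbox (y - x) -> tchart (tproj x) (tproj y) = y - x.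
Proof.
move=> H; apply/rowP => i; rewrite tchart_tproj angle_id ?mxE //.
by have := H i; rewrite !mxE.
Qed.

Lemma tcinvK p x : tbox x -> tchart p (tcinv p x) = x.
Proof.
move=> bx; rewrite -{1}(tliftK p) tchart_near addrC ?addKr ?addrA //.
Qed.

Lemma tcinv_dom p x : tbox x -> tdom p (tcinv p x).
Proof.
move=> bx i; rewrite -{1}(tliftK p) dcosE mxE [_ + x ord0 i]addrC addrK.
exact: cos_neqN1.
Qed.

Lemma tproj_tchart x y : tdom (tproj x) (tproj y) ->
  tproj (x + tchart (tproj x) (tproj y)) = tproj y.
Proof.
move=> xy; apply/tproj_eq => i; have := xy i; rewrite dcosE => c1.
rewrite mxE tchart_tproj.
have [ca sa] := cos_sin_angle (cos2Dsin2 (y ord0 i - x ord0 i)) c1.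
have e : y ord0 i = x ord0 i + (y ord0 i - x ord0 i) by ring.
split; first by rewrite [in RHS]e [LHS]cosD [RHS]cosD ca sa.
by rewrite [in RHS]e [LHS]sinD [RHS]sinD ca sa.
Qed.

Lemma tchartK p q : tdom p q -> tcinv p (tchart p q) = q.
Proof. by have := @tproj_tchart (tlift p) (tlift q); rewrite !tliftK. Qed.

Lemma tchart_image p : tchart p @` tdom p = tbox.
Proof.
apply/seteqP; split=> [_ [q pq <-] i|x bx]; first by rewrite mxE angle_itv.
by exists (tcinv p x); [exact: tcinv_dom|exact: tcinvK].
Qed.

Lemma tchart_continuous p : {within tdom p, continuous (tchart p)}.
Proof.
apply: continuous_in_subspaceT => q /set_mem qp.
apply: rV_continuous => i.
rewrite (_ : (fun _ => _) = fun q => angle (dcos p q i) (dsin p q i)); last first.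
  by apply/funext => z; rewrite mxE.
have k (c : R) : {for q, continuous (fun=> c)} by exact: cst_continuous.
have cd : {for q, continuous (fun q => 1 + dcos p q i)}.
  exact: (continuousD (k 1) (@continuous_dcos p q i)).
have c0 : 1 + dcos p q i != 0 by rewrite addrC -(opprK 1) subr_eq0; exact: qp.
have cv : {for q, continuous (fun q => (1 + dcos p q i)^-1)}.
  exact: (@continuousV _ _ (fun q => 1 + dcos p q i)).
have cq := continuousM (@continuous_dsin p q i) cv.
have ca : {for q, continuous (fun q => atan (dsin p q i / (1 + dcos p q i)))}.
  apply: (@continuous_comp _ _ _ (fun q => dsin p q i / (1 + dcos p q i)) (@atan R)).
    exact: cq.
  exact: continuous_atan.
exact: (continuousM (k 2) ca).
Qed.

Lemma tcinv_continuous p : {within tchart p @` tdom p, continuous (tcinv p)}.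
Proof.
apply: continuous_subspaceT => x.
apply: (@continuous_comp _ _ _ (fun x : V => tlift p + x) tproj); last first.
  exact: continuous_tproj.
have k : {for x, continuous (fun=> tlift p)} by exact: cst_continuous.
have c : {for x, continuous (fun x : V => x)} by [].
exact: (continuousD k c).
Qed.

(** Each coordinate of a transition map is locally a translation, but by amounts that differ between
    the components of the overlap. Hence an affine model is exhibited around every point [x1]. *)
Lemma ttransition_smooth p q (i : 'I_n) :
  smooth_on (tchart p @` (tdom p `&` tdom q)) (fun x => (tchart q (tcinv p x)) ord0 i).
Proof.
suff H x0 : (tchart p @` (tdom p `&` tdom q)) x0 -> exists U (f : V -> R),
    [/\ open U, U x0, smooth f & {in U, forall x, f x = (tchart q (tcinv p x)) ord0 i}].
  move=> s x0 /H[U [f [oU Ux sf fE]]].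
  exact: (smooth_on_eq oU fE (smooth_onW sf)).
move=> [z [zp zq] <-]; set x1 := tchart p z.
pose th x := tlift p ord0 i + x ord0 i - tlift q ord0 i.
have E x : tchart q (tcinv p x) ord0 i = angle (cos (th x)) (sin (th x)).
  by rewrite -{1}(tliftK q) tchart_tproj mxE.
have c1 : cos (th x1) != -1.
  have := zq i; rewrite -{1}(tliftK q) -(tchartK zp) dcosE mxE; exact.
pose a := angle (cos (th x1)) (sin (th x1)).
exists [set x : V | - pi < a + (x ord0 i - x1 ord0 i) < pi],
  (fun x : V => a + (x ord0 i - x1 ord0 i)); split.
- rewrite openE => x /= /andP[h1 h2]; rewrite /interior.
  have ci : {for x, continuous (fun x : V => a + (x ord0 i - x1 ord0 i))}.
    apply: smooth_continuous.
    exact: smoothD (smooth_cst _ _) (smoothB (smooth_coord _ _) (smooth_cst _ _)).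
  have nI : nbhs (a + (x ord0 i - x1 ord0 i)) [set u : R | - pi < u < pi].
    near=> u; apply/andP; split; near: u; [exact: lt_nbhsr|exact: lt_nbhsl].
  exact: (ci _ nI).
- by rewrite /= subrr addr0; exact: angle_itv.
- exact: smoothD (smooth_cst _ _) (smoothB (smooth_coord _ _) (smooth_cst _ _)).
- move=> x; rewrite inE /= => hx.
  have e : x ord0 i - x1 ord0 i = th x - th x1 by rewrite /th; ring.
  by rewrite E e; apply/esym; apply: angle_translate; rewrite // -e.
Unshelve. all: by end_near. Qed.

Definition torus_manifold : manifold R n :=
  @Manifold R n T tdom tchart tcinv torus_hausdorff torus_second_countable
    tdom_open tdom_center (fun p => eq_ind_r open tbox_open (tchart_image p))
    (fun p q => @tchartK p q) tchart_continuous tcinv_continuous ttransition_smooth.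

End TorusManifold.

Lemma diff_translation (R : realType) (V : normedModType R) (f : V -> V) x :
  (\forall y \near x, f y = y - x) -> 'd f x = idfun :> (V -> V).
Proof.
move=> H; apply: diff_unique; first by move=> y; exact: cvg_id.
have fx : f x = 0 by rewrite (nbhs_singleton H) subrr.
apply/eqaddoP => _/posnumP[e]; near=> h.
have -> : (f \o shift x - (cst (f x) + idfun)) h = 0.
  have fh : f (h + x) = h + x - x.
    near: h.
    by move: H; rewrite (near_shift 0) subr0.
  by rewrite /= -[LHS]/(f (h + x) - (f x + h)) fh fx addrK add0r subrr.
by rewrite normr0 mulr_ge0.
Unshelve. all: by end_near. Qed.

Section TorusJacobian.
Variables (R : realType) (n : nat).
Local Notation V := 'rV[R]_n.

Lemma tbox_near (x : V) : nbhs x [set y : V | tbox (y - x)].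
Proof.
have : nbhs x [set y : V | forall i, - pi < y ord0 i - x ord0 i < pi].
  apply: (@near_rV _ _ x (fun i t => - pi < t - x ord0 i < pi)) => i.
  near=> t; rewrite ltrBDr ltrBlDr; apply/andP; split; near: t.
    by apply: lt_nbhsr; rewrite gtrDr oppr_lt0 pi_gt0.
  by apply: lt_nbhsl; rewrite ltrDr pi_gt0.
by apply: filterS => y hy i; rewrite !mxE; exact: hy.
Unshelve. all: by end_near. Qed.

(** The chart at the point represented by [x], read in the chart at [p], is y |-> y - x near [x].
    Tensors on the torus are therefore plain matrix-valued functions. *)
Lemma torus_jac (p : torus_manifold R n) (x : V) : jac p x = 1%:M.
Proof.
rewrite /jac /jacobian.
have dE : 'd (chart (cinv p x) \o cinv p) x = idfun :> (V -> V).
  apply: diff_translation; apply: filterS (tbox_near x) => y hy.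
  have e : tlift p + y - (tlift p + x) = y - x by rewrite opprD addrACA subrr add0r.
  by rewrite /= /tcinv tchart_near ?e.
by apply/matrixP => i j; rewrite !mxE dE /= !mxE eq_sym.
Qed.

End TorusJacobian.

(** * The volume of the torus *)

Section Restriction.
Local Open Scope ereal_scope.
Context d (T : measurableType d) (R : realType).
Variables (mu nu : {measure set T -> \bar R}) (D : set T) (mD : measurable D).
Hypothesis nuE : forall A, measurable A -> nu A = mu (A `&` D).

Lemma ge0_integral_restriction (f : T -> \bar R) : measurable_fun setT f ->
  (forall x, 0 <= f x) -> \int[nu]_x f x = \int[mu]_(x in D) f x.
Proof.
move=> mf f0.
rewrite (@ge0_negligible_integral _ _ _ nu setT (~` D)) //.
- rewrite setTD setCK; apply: eq_measure_integral => A mA AD.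
  by rewrite nuE // setIidl.
- exact: measurableC.
- by rewrite nuE ?setICl ?measure0 //; exact: measurableC.
Qed.

Lemma integral_restriction (f : T -> \bar R) : measurable_fun setT f ->
  \int[nu]_x f x = \int[mu]_(x in D) f x.
Proof.
move=> mf; rewrite [LHS]integralE [RHS]integralE.
rewrite !ge0_integral_restriction //; first exact: measurable_funeneg.
exact: measurable_funepos.
Qed.

End Restriction.

Section Circle.
Local Open Scope ereal_scope.
Context {R : realType}.
Local Notation mu := (@lebesgue_measure R).
Local Notation RT := (measurableTypeR R).
Implicit Types (g : RT -> \bar R) (a c : R).

(** Uniqueness of Lebesgue measure: the pushforward gives half-open intervals their length. *)
Lemma lebesgue_measure_shift c (A : set RT) : measurable A ->
  pushforward mu (fun t : measurableTypeR R => (c + t)%R : measurableTypeR R) A = mu A.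
Proof.
move=> mA; apply/esym.
have mf : measurable_fun setT (fun t : measurableTypeR R => (c + t)%R : measurableTypeR R).
  exact: measurable_funD.
pose H := isMeasurableFun.Build _ _ _ _ _ mf.
apply: (@lebesgue_measure_unique _ (pushforward mu _ : {measure set _ -> \bar R})) => //.
move=> _ [[a b]] _ <-.
have E : (fun t : R => (c + t)%R) @^-1` `]a, b]%classic = `](a - c)%R, (b - c)%R]%classic.
  by apply/seteqP; split => t /=; rewrite !in_itv /= ltrBlDl lerBrDl.
apply: (@etrans _ _ (mu `](a - c)%R, (b - c)%R]%classic)); last by rewrite -E.
rewrite !lebesgue_measure_itv /= !lte_fin ltrD2r; case: ifP => // _.
by rewrite -!EFinB; congr (_%:E); ring.
Qed.

Lemma integral_shift g c (D : set RT) : measurable D -> measurable_fun [set: RT] g ->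
  (forall t, 0 <= g t) ->
  \int[mu]_(t in [set t | D (c + t)%R]) g (c + t)%R = \int[mu]_(t in D) g t.
Proof.
move=> mD mg g0.
have mf : measurable_fun setT (fun t : measurableTypeR R => (c + t)%R : measurableTypeR R).
  exact: measurable_funD.
rewrite -(ge0_integral_pushforward mf mu mD) //; last exact: measurable_funS mg.
apply: eq_measure_integral => A mA _; exact: lebesgue_measure_shift.
Qed.

(** Half-open, so that every angle has exactly one representative. *)
Definition circle_itv : set (measurableTypeR R) := `[(- pi)%R, pi[%classic.

Lemma measurable_circle_itv : measurable circle_itv.
Proof. exact: measurable_itv. Qed.

Lemma circle_itv_lty : (mu circle_itv < +oo)%E.
Proof. by rewrite /circle_itv lebesgue_measure_itv /=; case: ifP => // _; rewrite -EFinB ltry. Qed.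

Definition circle : {finite_measure set (measurableTypeR R) -> \bar R} :=
  mfrestr measurable_circle_itv circle_itv_lty.

Lemma integral_circle g : measurable_fun [set: RT] g ->
  \int[circle]_t g t = \int[mu]_(t in circle_itv) g t.
Proof.
move=> mf; have H A : measurable A -> circle A = mu (A `&` circle_itv) by [].
have := @integral_restriction _ _ _ mu circle _ measurable_circle_itv H _ mf.
exact.
Qed.

Variable g : RT -> \bar R.
Hypothesis mg : measurable_fun [set: RT] g.
Hypothesis g0 : forall t, 0 <= g t.
Hypothesis gp : forall t, g (t + pi *+ 2)%R = g t.

(** The two periods share the interval from [b] to a + 2 pi; what remains of them, [a, b[ and [a + 2
    pi, b + 2 pi[, are translates by one period. *)
Let itvS a b : (a <= b)%R -> (b <= a + pi *+ 2)%R ->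
  \int[mu]_(t in `[a, (a + pi *+ 2)%R[) g t = \int[mu]_(t in `[b, (b + pi *+ 2)%R[) g t.
Proof.
move=> ab ba.
have U x y z : (x <= y)%R -> (y <= z)%R ->
    \int[mu]_(t in `[x, z[) g t = \int[mu]_(t in `[x, y[) g t + \int[mu]_(t in `[y, z[) g t.
  move=> xy yz.
  rewrite -ge0_integral_setU //; first by rewrite (@itv_bndbnd_setU _ _ (BLeft x) (BLeft y)).
  - exact: measurable_funS mg.
  - apply/disj_set2P; apply/seteqP; split => // t /=; rewrite !in_itv /=.
    by move=> [/andP[_ t1] /andP[t2 _]]; move: (le_lt_trans t2 t1); rewrite ltxx.
have pi2 : (0 <= pi *+ 2 :> R)%R by rewrite mulrn_wge0 // pi_ge0.
have S : \int[mu]_(t in `[(a + pi *+ 2)%R, (b + pi *+ 2)%R[) g t = \int[mu]_(t in `[a, b[) g t.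
  rewrite -(@integral_shift g (pi *+ 2)%R `[(a + pi *+ 2)%R, (b + pi *+ 2)%R[) //.
  rewrite (_ : [set t | _] = `[a, b[%classic).
    by apply: eq_integral => t _; rewrite addrC gp.
  by apply/seteqP; split => t /=; rewrite !in_itv /= [(pi *+ 2 + t)%R]addrC lerD2r ltrD2r.
have E1 := U _ _ _ ab ba.
have E2 : \int[mu]_(t in `[b, (b + pi *+ 2)%R[) g t =
  \int[mu]_(t in `[b, (a + pi *+ 2)%R[) g t + \int[mu]_(t in `[a, b[) g t.
  by rewrite -S; apply: U => //; rewrite lerD2r.
by rewrite E1 E2 addeC.
Qed.

(** The left side is one variable of an integral in a chart: the indicator of the open box, with the
    centre at [c]. The missing endpoint is a null set, and a period may start anywhere. *)
Lemma integral_circle_shift c : (- pi <= c <= pi)%R ->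
  \int[mu]_t ((\1_`](- pi)%R, pi[ t)%:E * g (c + t)%R) = \int[circle]_t g t.
Proof.
move=> /andP[c1 c2]; rewrite integral_circle //.
have mgc : measurable_fun setT (fun t => g (c + t)%R).
  by apply: measurableT_comp => //; exact: measurable_funD.
transitivity (\int[mu]_(t in `](- pi)%R, pi[) g (c + t)%R).
  rewrite [RHS]integral_mkcond; apply: eq_integral => t _.
  by rewrite patchE indicE; case: ifP => _; rewrite ?mul1e ?mul0e.
rewrite integral_itv_obnd_cbnd; last exact: measurable_funS mgc.
have e x : (x - pi + pi *+ 2 = x + pi)%R by rewrite mulr2n addrA subrK.
transitivity (\int[mu]_(t in `[(c - pi)%R, (c - pi + pi *+ 2)%R[) g t).
  rewrite -(@integral_shift g c `[(c - pi)%R, (c - pi + pi *+ 2)%R[) // e; congr (integral _ _ _).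
  by apply/seteqP; split => t /=; rewrite !in_itv /= lerD2l ltrD2l.
have E : (- pi + pi *+ 2 = pi :> R)%R by rewrite mulr2n addrA addNr add0r.
have -> : circle_itv = `[(- pi)%R, (- pi + pi *+ 2)%R[%classic by rewrite E.
have [c0|c0] := leP 0%R c.
  have h1 : (- pi <= c - pi)%R by lra.
  have h2 : (c - pi <= - pi + pi *+ 2)%R by rewrite E; lra.
  exact/esym/(itvS h1 h2).
have h1 : (c - pi <= - pi)%R by lra.
have h2 : (- pi <= c - pi + pi *+ 2)%R by rewrite e; lra.
exact: itvS h1 h2.
Qed.

End Circle.

Section FiniteProduct.
Context d1 d2 (T1 : measurableType d1) (T2 : measurableType d2) (R : realType).
Variables (m1 : {finite_measure set T1 -> \bar R}) (m2 : {finite_measure set T2 -> \bar R}).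

(** A separate name lets the product carry a finite measure structure, which makes it possible to
    iterate it. *)
Definition finite_prod : set (T1 * T2)%type -> \bar R := product_measure1 m1 m2.

HB.instance Definition _ := Measure.copy finite_prod (product_measure1 m1 m2).

Lemma finite_prod_fin : fin_num_fun finite_prod.
Proof.
have H : (finite_prod [set: T1 * T2] < +oo)%E.
  have -> : finite_prod [set: T1 * T2] = (m1 setT * m2 setT)%E.
    by rewrite -product_measure1E // setXTT.
  by rewrite ltey_eq fin_numM ?fin_num_measure.
exact: (lty_fin_num_fun H).
Qed.

HB.instance Definition _ := Measure_isFinite.Build _ _ _ finite_prod finite_prod_fin.

Lemma finite_prodE A1 A2 : measurable A1 -> measurable A2 ->
  finite_prod (A1 `*` A2) = (m1 A1 * m2 A2)%E.
Proof. exact: product_measure1E. Qed.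

End FiniteProduct.

Section TorusVolume.
Variable R : realType.
Local Notation RT := (measurableTypeR R).
Local Notation RT4 := (RT * (RT * (RT * RT)))%type.
Local Notation V := 'rV[R]_4.
Local Notation T := (torus R 4).

(** The nesting copies that of [lebesgue_int], which makes [lebesgue_int4] true by conversion. *)
Definition row4 (u : RT4) : V :=
  row_mx (u.1%:M : 'rV_1) (row_mx (u.2.1%:M : 'rV_1)
    (row_mx (u.2.2.1%:M : 'rV_1) (row_mx (u.2.2.2%:M : 'rV_1) 0))).

Lemma row4E u (i : 'I_4) : row4 u ord0 i = tnth [tuple u.1; u.2.1; u.2.2.1; u.2.2.2] i.
Proof.
have scal (a : R) (k : 'I_1) : (a%:M : 'rV_1) ord0 k = a by rewrite mxE (ord1 k) eqxx mulr1n.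
have L n (A : 'rV[R]_1) (B : 'rV[R]_n) (k : 'I_(1 + n)) : k = 0%N :> nat ->
    row_mx A B ord0 k = A ord0 ord0.
  by move=> k0; have -> : k = lshift n ord0 by [exact: val_inj]; rewrite row_mxEl.
have Rr n (A : 'rV[R]_1) (B : 'rV[R]_n) (k : 'I_(1 + n)) (k' : 'I_n) :
    k = k'.+1 :> nat -> row_mx A B ord0 k = B ord0 k'.
  by move=> kk; have -> : k = rshift 1 k' by [exact: val_inj]; rewrite row_mxEr.
rewrite /row4; case: i => [[|[|[|[|//]]]] Hi]; rewrite (tnth_nth 0) /=.
- by rewrite L // scal.
- by rewrite (Rr _ _ _ _ (@Ordinal 3 0 isT)) // L // scal.
- rewrite (Rr _ _ _ _ (@Ordinal 3 1 isT)) // (Rr _ _ _ _ (@Ordinal 2 0 isT)) //.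
  by rewrite L // scal.
- rewrite (Rr _ _ _ _ (@Ordinal 3 2 isT)) // (Rr _ _ _ _ (@Ordinal 2 1 isT)) //.
  by rewrite (Rr _ _ _ _ (@Ordinal 1 0 isT)) // L // scal.
Qed.

Definition close_itv (a e : R) : set RT := `](a - e), (a + e)[%classic.

(** The product sigma-algebra is generated by rectangles, so an open set is exhausted by the
    countably many boxes with rational centres and radii 1 / (k + 1) that it contains. *)
Lemma measurable_row4_open (B : set V) : open B -> measurable (row4 @^-1` B).
Proof.
move=> oB.
pose box (q : (rat * (rat * (rat * rat))) * nat) : set RT4 :=
  close_itv (ratr q.1.1) q.2.+1%:R^-1 `*` (close_itv (ratr q.1.2.1) q.2.+1%:R^-1 `*`
   (close_itv (ratr q.1.2.2.1) q.2.+1%:R^-1 `*` close_itv (ratr q.1.2.2.2) q.2.+1%:R^-1)).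
pose box' q := if `[< box q `<=` row4 @^-1` B >] then box q else set0.
have -> : row4 @^-1` B = \bigcup_q box' q.
  apply/seteqP; split=> [u Bu|u [q _]]; last first.
    by rewrite /box'; case: ifP => // /asboolP; apply.
  have : nbhs (row4 u) B by exact: open_nbhs_nbhs.
  move=> /nbhs_ballP[e /= e0 eB].
  have e2 : 0 < e / 2 by rewrite divr_gt0.
  (* With radius below e / 2, any two points of one box differ by less than e in every
     coordinate. *)
  have [k ke] := filter_ex (near_infty_natSinv_lt (PosNum e2)); rewrite /= in ke.
  have k0 : 0 < k.+1%:R^-1 :> R by rewrite invr_gt0.
  have rat_near (a : R) : exists q : rat, close_itv (ratr q) k.+1%:R^-1 a.
    have [|q] := @rat_in_itvoo R (a - k.+1%:R^-1) (a + k.+1%:R^-1); first by rewrite ltrBlDr -addrA ltrDl addr_gt0.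
    rewrite in_itv /= => /andP[q1 q2]; exists q; rewrite /close_itv /= in_itv /=.
    by move: q1 q2; set ki := k.+1%:R^-1 => q1 q2; apply/andP; split; lra.
  have [q0 h0] := rat_near u.1; have [q1 h1] := rat_near u.2.1.
  have [q2 h2] := rat_near u.2.2.1; have [q3 h3] := rat_near u.2.2.2.
  exists ((q0, (q1, (q2, q3))), k) => //.
  rewrite /box' ifT //; apply/asboolP => w [w0 [w1 [w2 w3]]] /=.
  apply: eB; split=> // i j; rewrite (ord1 i) !row4E /ball /=.
  move: h0 h1 h2 h3 w0 w1 w2 w3; rewrite /close_itv /= !in_itv /=.
  set ki := k.+1%:R^-1 in ke k0 *.
  move=> /andP[? ?] /andP[? ?] /andP[? ?] /andP[? ?] /andP[? ?] /andP[? ?] /andP[? ?] /andP[? ?].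
  case: j => [[|[|[|[|//]]]] Hj]; rewrite !(tnth_nth 0) /= ltr_norml;
    apply/andP; split; lra.
apply: countable_bigcupT_measurable => [|q]; first exact: countableP.
rewrite /box'; case: ifP => // _; rewrite /box.
by do 3 (apply: measurableX; first exact: measurable_itv); exact: measurable_itv.
Qed.

Lemma measurable_torus_proj :
  measurable_fun setT (fun u : RT4 => tproj (row4 u) : borel T).
Proof.
apply: (@measurability _ _ _ (g_sigma_algebraType (@open T)) setT _ (@open T)) => //.
move=> _ [A oA <-]; rewrite setTI.
have -> : (fun u : RT4 => tproj (row4 u) : borel T) @^-1` A = row4 @^-1` (@tproj R 4 @^-1` A).
  by [].
apply: measurable_row4_open; apply: open_comp => // x _; exact: continuous_tproj.
Qed.

Definition circle2 : {finite_measure set (RT * RT)%type -> \bar R} :=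
  finite_prod circle circle.

Definition circle3 : {finite_measure set (RT * (RT * RT))%type -> \bar R} :=
  finite_prod circle circle2.

Definition circle4 : {finite_measure set RT4 -> \bar R} := finite_prod circle circle3.

Definition torus_volume : {measure set (borel T) -> \bar R} :=
  measure_function_pushforward__canonical__measure_function_Measure
    circle4 measurable_torus_proj.

Lemma torus_volumeE (A : set (borel T)) : torus_volume A =
  circle4 ((fun u => tproj (row4 u) : borel T) @^-1` A).
Proof. by []. Qed.

Lemma torus_volume_lty : (torus_volume setT < +oo)%E.
Proof. by rewrite torus_volumeE preimage_setT ltey_eq fin_num_measure. Qed.

Lemma circle_gt0 (a b : R) : - pi <= a -> a < b -> b <= pi ->
  (0 < @circle R `[a, b[%classic)%E.
Proof.
move=> ha ab hb; have -> : @circle R `[a, b[%classic = lebesgue_measure `[a, b[%classic.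
  rewrite /circle /= /mfrestr /mrestr setIidl // => t /=; rewrite /circle_itv /= !in_itv /=.
  move=> /andP[h1 h2]; rewrite (le_trans ha h1); exact: lt_le_trans h2 hb.
by rewrite lebesgue_measure_itv /= lte_fin ab -EFinB lte_fin subr_gt0.
Qed.

Definition box4 (a b : V) : set RT4 :=
  `[a ord0 ord0, b ord0 ord0[%classic `*` (`[a ord0 j1, b ord0 j1[%classic
  `*` (`[a ord0 j2, b ord0 j2[%classic `*` `[a ord0 j3, b ord0 j3[%classic)).

Lemma measurable_box4 a b : measurable (box4 a b).
Proof. by do 3 (apply: measurableX; first exact: measurable_itv); exact: measurable_itv. Qed.

Lemma circle4_gt0 (a b : V) : (forall i, - pi <= a ord0 i) ->
  (forall i, a ord0 i < b ord0 i) -> (forall i, b ord0 i <= pi) -> (0 < circle4 (box4 a b))%E.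
Proof.
move=> ha ab hb.
have mi i : measurable (`[a ord0 i, b ord0 i[%classic : set RT) by exact: measurable_itv.
have m2 := measurableX (mi j2) (mi j3); have m3 := measurableX (mi j1) m2.
have p2 := finite_prodE circle circle (mi j2) (mi j3).
have p3 := finite_prodE circle circle2 (mi j1) m2.
have p4 := finite_prodE circle circle3 (mi ord0) m3.
have g i : (0 < circle (`[a ord0 i, b ord0 i[%classic : set RT))%E by apply: circle_gt0.
have g2 : (0 < circle2 (`[a ord0 j2, b ord0 j2[%classic `*` `[a ord0 j3, b ord0 j3[%classic))%E.
  by rewrite [X in (0 < X)%E]p2 mule_gt0.
have g3 := mule_gt0 (g j1) g2; rewrite -[X in (0 < X)%E]p3 in g3.
by rewrite [X in (0 < X)%E]p4 mule_gt0.
Qed.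

(** This is the source of the definiteness of the L^2 product on continuous coefficients. *)
Lemma torus_volume_gt0 (U : set (borel T)) :
  @open T U -> U !=set0 -> (0 < torus_volume U)%E.
Proof.
move=> oU [p Up]; have mU : measurable U by exact: sub_sigma_algebra.
have [c [cb cp]] := tproj_lift_pi p.
have : nbhs c (@tproj R 4 @^-1` U).
  apply: open_nbhs_nbhs; split; last by rewrite /preimage /= cp.
  by apply: open_comp => // x _; exact: continuous_tproj.
move=> /nbhs_ballP[e /= e0 eU].
(* The lift [c] may sit on a face of the cube, so the box around it is cut off at - pi and pi; it
   keeps positive sides because [c] lies in the closed cube. *)
pose a : V := \row_i Num.max (- pi) (c ord0 i - e / 2).
pose b : V := \row_i Num.min pi (c ord0 i + e / 2).
have pi0 := pi_gt0 R.
apply: (@lt_le_trans _ _ (circle4 (box4 a b))).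
  apply: circle4_gt0 => i; rewrite !mxE ?le_max ?lexx ?ge_min ?lexx //.
  have /andP[c1 c2] := cb i.
  rewrite gt_max !lt_min; apply/andP; split; apply/andP; split; lra.
have mb := measurable_box4 a b.
have mp : measurable ((fun u : RT4 => tproj (row4 u) : borel T) @^-1` U).
  by rewrite -[X in measurable X]setTI; exact: (measurable_torus_proj measurableT mU).
suff sub : box4 a b `<=` (fun u : RT4 => tproj (row4 u) : borel T) @^-1` U.
  exact: (le_measure circle4 (mem_set mb) (mem_set mp) sub).
move=> u [/= u0 [u1 [u2 u3]]]; apply: eU; split=> // i j.
have {u0 u1 u2 u3} : a ord0 j <= row4 u ord0 j < b ord0 j.
  move: u0 u1 u2 u3; rewrite !in_itv /= => u0 u1 u2 u3.
  case: j => [[|[|[|[|//]]]] Hj]; rewrite row4E (tnth_nth 0) /=.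
  - by rewrite (_ : Ordinal Hj = ord0); [|exact: val_inj].
  - by rewrite (_ : Ordinal Hj = j1); [|exact: val_inj].
  - by rewrite (_ : Ordinal Hj = j2); [|exact: val_inj].
  - by rewrite (_ : Ordinal Hj = j3); [|exact: val_inj].
rewrite (ord1 i) ![X in X <= _ < _]mxE ![X in _ <= _ < X]mxE ge_max lt_min.
move=> /andP[/andP[_ h1] /andP[_ h2]]; rewrite /ball /= distrC ltr_norml.
by apply/andP; split; lra.
Qed.

End TorusVolume.

(** * Fubini and the volume in charts *)

Section FiniteProductIntegral.
Context d1 d2 (T1 : measurableType d1) (T2 : measurableType d2) (R : realType).
Variables (m1 : {finite_measure set T1 -> \bar R}) (m2 : {finite_measure set T2 -> \bar R}).

Lemma ge0_integral_finite_prod (f : T1 * T2 -> \bar R) :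
  measurable_fun setT f -> (forall u, 0 <= f u)%E ->
  (\int[finite_prod m1 m2]_u f u = \int[m1]_x \int[m2]_y f (x, y))%E.
Proof. by move=> mf f0; exact: (@fubini_tonelli1 _ _ _ _ _ m1 m2). Qed.

Lemma measurable_ge0_integral_section (f : T1 * T2 -> \bar R) :
  measurable_fun setT f -> (forall u, 0 <= f u)%E ->
  measurable_fun setT (fun x => \int[m2]_y f (x, y))%E.
Proof. by move=> mf f0; exact: (@measurable_fun_fubini_tonelli_F _ _ _ _ _ m2). Qed.

Lemma measurable_section (d : _) (T : measurableType d) (f : T1 * T2 -> T) x :
  measurable_fun setT f -> measurable_fun setT (fun y => f (x, y)).
Proof. by move=> mf; apply: measurableT_comp => //; exact: pair1_measurable. Qed.

(** Here the inner integral runs over the second factor, in the companion lemma over the first.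
    Boundedness supplies the integrability that Fubini requires. *)
Lemma finite_prod_integral0l (f : T1 * T2 -> R) :
  measurable_fun setT f -> [bounded f u | u in setT] ->
  (forall x, \int[m2]_y (f (x, y))%:E = 0)%E ->
  (\int[finite_prod m1 m2]_u (f u)%:E = 0)%E.
Proof.
move=> mf bf f0; have lt : (finite_prod m1 m2 setT < +oo)%E by rewrite ltey_eq fin_num_measure.
have intf := measurable_bounded_integrable measurableT lt mf bf.
rewrite -[LHS](@integral12_prod_meas1 _ _ _ _ _ m1 m2 (EFin \o f) intf).
by rewrite integral0_eq // => x _; exact: f0.
Qed.

Lemma finite_prod_integral0r (f : T1 * T2 -> R) :
  measurable_fun setT f -> [bounded f u | u in setT] ->
  (forall y, \int[m1]_x (f (x, y))%:E = 0)%E ->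
  (\int[finite_prod m1 m2]_u (f u)%:E = 0)%E.
Proof.
move=> mf bf f0; have lt : (finite_prod m1 m2 setT < +oo)%E by rewrite ltey_eq fin_num_measure.
have intf := measurable_bounded_integrable measurableT lt mf bf.
rewrite -[LHS](@integral21_prod_meas1 _ _ _ _ _ m1 m2 (EFin \o f) intf).
by rewrite integral0_eq // => x _; exact: f0.
Qed.

End FiniteProductIntegral.

Section Peel.
Variable R : realType.
Local Notation RT := (measurableTypeR R).
Local Notation mu := (@lebesgue_measure R).
Local Notation I := (\1_(`](- pi), pi[ : set R)).

(** In its applications [k] is the product of the indicators of the outer coordinates, constant for
    the inner integral. *)
Lemma integral_circle_scale_shift (g : RT -> \bar R) (k c : R) :
  measurable_fun setT g -> (forall t, 0 <= g t)%E -> (forall t, g (t + pi *+ 2) = g t) ->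
  - pi <= c <= pi -> 0 <= k ->
  (\int[mu]_t ((k * I t)%:E * g (c + t)%R) = k%:E * \int[circle]_t g t)%E.
Proof.
move=> mg g0 gp cpi k0; rewrite -(integral_circle_shift mg g0 gp cpi).
rewrite -ge0_integralZl_EFin //.
- by apply: eq_integral => t _; rewrite EFinM muleA.
- by move=> t _; rewrite mule_ge0.
- apply: emeasurable_funM.
    by apply/measurable_EFinP; apply: measurable_indic; exact: measurable_itv.
  by apply: measurableT_comp => //; exact: measurable_funD.
Qed.
End Peel.

Section RiemannianVolume.
Variable R : realType.
Local Notation RT := (measurableTypeR R).
Local Notation RT4 := (RT * (RT * (RT * RT)))%type.
Local Notation V := 'rV[R]_4.
Local Notation T := (torus R 4).
Local Notation mu := (@lebesgue_measure R).
Local Notation I := (\1_(`](- pi), pi[ : set R)).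

Lemma lebesgue_int4 (f : V -> \bar R) : lebesgue_int f =
  (\int[mu]_t0 \int[mu]_t1 \int[mu]_t2 \int[mu]_t3 f (row4 (t0, (t1, (t2, t3)))))%E.
Proof. by []. Qed.

Variables (g : RT4 -> \bar R) (c : V).
Hypotheses (mg : measurable_fun setT g) (g0 : forall u, (0 <= g u)%E).
Hypothesis gp : forall u v, (forall i, row4 v ord0 i = row4 u ord0 i \/
  row4 v ord0 i = row4 u ord0 i + pi *+ 2) -> g v = g u.
Hypothesis c_pi : forall i, - pi <= c ord0 i <= pi.

(** The variables are treated from the innermost outwards. The partial integrals [g3], [g2], [g1]
    remain periodic in what is left, so each step is a one-dimensional change of period. *)
Lemma integral_box_shift :
  (\int[mu]_t0 \int[mu]_t1 \int[mu]_t2 \int[mu]_t3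
    ((I t0 * I t1 * I t2 * I t3)%:E *
      g (c ord0 ord0 + t0, (c ord0 j1 + t1, (c ord0 j2 + t2, c ord0 j3 + t3)))%R) =
  \int[circle4 R]_u g u)%E.
Proof.
have I0 t : 0 <= I t :> R by rewrite indicE.
have ms1 a := measurable_section a mg.
have ms2 a b := measurable_section b (ms1 a).
have ms3 a b e := measurable_section e (ms2 a b).
have gp4 (u v : RT4) : (u.1 = v.1 \/ u.1 = v.1 + pi *+ 2) ->
    (u.2.1 = v.2.1 \/ u.2.1 = v.2.1 + pi *+ 2) ->
    (u.2.2.1 = v.2.2.1 \/ u.2.2.1 = v.2.2.1 + pi *+ 2) ->
    (u.2.2.2 = v.2.2.2 \/ u.2.2.2 = v.2.2.2 + pi *+ 2) -> g u = g v.
  move=> h0 h1 h2 h3; apply: gp => i; rewrite !row4E.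
  by case: i => [[|[|[|[|//]]]] Hi]; rewrite !(tnth_nth 0).
pose g3 a b e := (\int[circle]_t g (a, (b, (e, t))))%E.
pose g2 a b := (\int[circle2 R]_w g (a, (b, w)))%E.
pose g1 a := (\int[circle3 R]_w g (a, w))%E.
have g2E a b : g2 a b = (\int[circle]_t g3 a b t)%E.
  exact: (@ge0_integral_finite_prod _ _ _ _ _ circle circle (fun w => g (a, (b, w))) (ms2 a b)).
have g1E a : g1 a = (\int[circle]_t g2 a t)%E.
  exact: (@ge0_integral_finite_prod _ _ _ _ _ circle (circle2 R) (fun w => g (a, w)) (ms1 a)).
have gE : (\int[circle4 R]_u g u = \int[circle]_t g1 t)%E.
  exact: (@ge0_integral_finite_prod _ _ _ _ _ circle (circle3 R) g mg).
transitivity (\int[mu]_t0 \int[mu]_t1 \int[mu]_t2 ((I t0 * I t1 * I t2)%:E *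
    g3 (c ord0 ord0 + t0)%R (c ord0 j1 + t1)%R (c ord0 j2 + t2)%R))%E.
  do 3 (apply: eq_integral => ? _).
  apply: integral_circle_scale_shift; rewrite ?mulr_ge0 // => t.
  by apply: gp4; by [left|right].
transitivity (\int[mu]_t0 \int[mu]_t1 ((I t0 * I t1)%:E *
    g2 (c ord0 ord0 + t0)%R (c ord0 j1 + t1)%R))%E.
  do 2 (apply: eq_integral => ? _); rewrite g2E.
  apply: integral_circle_scale_shift; rewrite ?mulr_ge0 //.
  - exact: (@measurable_ge0_integral_section _ _ _ _ _ circle (fun w => g (_, (_, w)))).
  - by move=> t; exact: integral_ge0.
  - by move=> t; apply: eq_integral => ? _; apply: gp4; by [left|right].
transitivity (\int[mu]_t0 ((I t0)%:E * g1 (c ord0 ord0 + t0)%R))%E.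
  apply: eq_integral => ? _; rewrite g1E.
  apply: integral_circle_scale_shift; rewrite ?mulr_ge0 //.
  - exact: (@measurable_ge0_integral_section _ _ _ _ _ (circle2 R) (fun w => g (_, w))).
  - by move=> t; exact: integral_ge0.
  - by move=> t; apply: eq_integral => ? _; apply: gp4; by [left|right].
rewrite gE; apply: integral_circle_shift => //.
- exact: (@measurable_ge0_integral_section _ _ _ _ _ (circle3 R) g).
- by move=> t; exact: integral_ge0.
- by move=> t; apply: eq_integral => ? _; apply: gp4; by [left|right].
Qed.

End RiemannianVolume.

Section TorusRiemannianVolume.
Variable R : realType.
Local Notation RT := (measurableTypeR R).
Local Notation RT4 := (RT * (RT * (RT * RT)))%type.
Local Notation V := 'rV[R]_4.
Local Notation T := (torus R 4).
Local Notation I := (\1_(`](- pi), pi[ : set R)).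

Lemma tchart_imageE (p : T) (A : set T) (x : V) : A `<=` tdom p ->
  (tchart p @` A) x <-> tbox x /\ A (tcinv p x).
Proof.
move=> Ap; split=> [[q Aq <-]|[bx Ax]]; last by exists (tcinv p x) => //; exact: tcinvK.
split; last by rewrite tchartK //; exact: Ap.
by rewrite -(tchart_image p); exists q => //; exact: Ap.
Qed.

Lemma torus_volume_chart (p : T) (A : set (borel T)) : measurable A -> A `<=` tdom p ->
  torus_volume R A = lebesgue_int (fun x : V => (\1_(tchart p @` A) x)%:E).
Proof.
(* The change of period needs a centre in the closed cube, which [tlift p] need not be; [c] is
   another lift of [p], and both define the same inverse chart. *)
move=> mA Ap; have [c [cpi cp]] := tproj_lift_pi p.
pose g (u : RT4) : \bar R := (\1_A (tproj (row4 u) : borel T))%:E.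
have mg : measurable_fun setT g.
  have mi : measurable_fun setT (\1_A : borel T -> R) by apply: measurable_indic.
  have mc := measurableT_comp mi (@measurable_torus_proj R).
  exact: (measurableT_comp (@EFin_measurable R setT) mc).
have g0 u : (0 <= g u)%E by rewrite lee_fin indicE.
have gp u v : (forall i, row4 v ord0 i = row4 u ord0 i \/
    row4 v ord0 i = row4 u ord0 i + pi *+ 2) -> g v = g u.
  by move=> h; rewrite /g (tproj_periodic h).
rewrite lebesgue_int4.
transitivity (\int[circle4 R]_u g u)%E.
  rewrite torus_volumeE /g.
  have mp : measurable ((fun u : RT4 => tproj (row4 u) : borel T) @^-1` A).
    by rewrite -[X in measurable X]setTI; exact: (@measurable_torus_proj R).
  by rewrite (integral_indic (circle4 R) measurableT mp) setIT.
rewrite -(integral_box_shift mg g0 gp cpi).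
apply: eq_integral => t0 _; apply: eq_integral => t1 _.
apply: eq_integral => t2 _; apply: eq_integral => t3 _.
set x := row4 _; rewrite /g -EFinM; congr (_%:E).
have -> : row4 (c ord0 ord0 + t0, (c ord0 j1 + t1, (c ord0 j2 + t2, c ord0 j3 + t3))) = c + x.
  apply/rowP => i; rewrite [RHS]mxE /x !row4E.
  case: i => [[|[|[|[|//]]]] Hi]; rewrite !(tnth_nth 0) /=; congr (c ord0 _ + _); exact: val_inj.
have -> : tproj (c + x) = tcinv p x.
  by apply: tproj_translate; rewrite tliftK.
rewrite !indicE !mem_setE !in_itv /= -!natrM !mulnb; congr (_%:R); congr nat_of_bool.
apply/idP/idP => [/andP[/andP[/andP[/andP[b0 b1] b2] b3] gA]|].
  apply/mem_set; apply/(@tchart_imageE p A x Ap); split; last exact: set_mem gA.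
  by case=> [[|[|[|[|//]]]] Hi]; rewrite /x row4E (tnth_nth 0).
move=> /set_mem/(@tchart_imageE p A x Ap)[bx Ax].
by rewrite (mem_set Ax) andbT; have := bx ord0; have := bx j1; have := bx j2; have := bx j3;
  rewrite /x !row4E !(tnth_nth 0) /= => -> -> -> ->.
Qed.
End TorusRiemannianVolume.

(** * Integration of continuous functions on the torus *)

Section TorusFunctions.
Variables (R : realType) (n : nat).
Local Notation V := 'rV[R]_n.
Local Notation T := (torus R n).

Lemma tchart_continuous_at (p q : T) : tdom p q -> {for q, continuous (tchart p)}.
Proof.
move=> pq; have := @tchart_continuous R n p.
by rewrite continuous_open_subspace; [apply; rewrite inE|exact: tdom_open].
Qed.

(** Near [p], a point q is the projection of [tlift p + tchart p q], which is a local lift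
    continuous in q. *)
Lemma torus_continuous (U : topologicalType) (f : T -> U) :
  (forall x, {for x, continuous (fun x : V => f (tproj x))}) -> continuous f.
Proof.
move=> cf p.
have cc := tchart_continuous_at (tdom_center p).
have ct : {for p, continuous (fun q => tlift p + tchart p q)}.
  have k : {for p, continuous (fun=> tlift p)} by exact: cst_continuous.
  exact: (continuousD k cc).
have c2 : {for p, continuous (fun q => f (tproj (tlift p + tchart p q)))}.
  apply: (@continuous_comp _ _ _ (fun q => tlift p + tchart p q) (fun x => f (tproj x))).
    exact: ct.
  exact: cf.
have nd : nbhs p (tdom p) by apply: open_nbhs_nbhs; split; [exact: tdom_open|exact: tdom_center].
have E : \forall q \near p, f (tproj (tlift p + tchart p q)) = f q.
  by apply: filterS nd => q pq; rewrite -[tproj _]/(tcinv p _) tchartK.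
have fp := nbhs_singleton E.
move=> A; rewrite /= -fp => /c2 nA.
by apply: filterS2 E nA => q /= -> .
Qed.

End TorusFunctions.

Section TorusIntegral.
Variable R : realType.
Local Notation RT := (measurableTypeR R).
Local Notation RT4 := (RT * (RT * (RT * RT)))%type.
Local Notation V := 'rV[R]_4.
Local Notation T := (torus R 4).
Implicit Types f g : T -> R.

Lemma torus_measurable f : continuous f ->
  measurable_fun [set: borel T] (f : borel T -> R).
Proof.
move=> cf; apply: (measurability _ (RGenOpens.measurableE R)) => //.
move=> _ [_ [a [b ->]] <-]; rewrite setTI; apply: sub_sigma_algebra.
by apply: open_comp => [x _|]; [exact: cf|exact: interval_open].
Qed.

Lemma torus_bounded f : continuous f -> [bounded f p | p in [set: T]].
Proof.
move=> cf; have := continuous_compact (continuous_subspaceT cf) (@torus_compact R 4).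
by move=> /compact_bounded [M [Mr HM]]; exists M; split => // x Mx p _; apply: HM.
Qed.

Lemma torus_integrable f : continuous f ->
  (torus_volume R).-integrable setT (EFin \o (f : borel T -> R)).
Proof.
move=> cf; apply: measurable_bounded_integrable => //.
- exact: torus_volume_lty.
- exact: torus_measurable.
- exact: torus_bounded.
Qed.

Definition torus_int f : R :=
  Rintegral (torus_volume R) setT (fun p : borel T => f p).

Lemma torus_intD f g : continuous f -> continuous g ->
  torus_int (fun p => f p + g p) = torus_int f + torus_int g.
Proof. by move=> cf cg; apply: RintegralD => //; exact: torus_integrable. Qed.

Lemma torus_intZ f (c : R) : continuous f ->
  torus_int (fun p => c * f p) = c * torus_int f.
Proof. by move=> cf; apply: RintegralZl => //; exact: torus_integrable. Qed.

(** The set where [f] is positive is open and contained in a null set, hence empty. *)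
Lemma torus_int_eq0 f : continuous f -> (forall p, 0 <= f p) -> torus_int f = 0 ->
  forall p, f p = 0.
Proof.
move=> cf f0 i0 p; apply/eqP; rewrite eq_le f0 andbT leNgt; apply/negP => fp.
have mf := torus_measurable cf.
have := torus_integrable cf => intf.
have i0' : (\int[torus_volume R]_(p in [set: borel T]) `|(f p)%:E| = 0)%E.
  have E q : (`|(f q)%:E| = (f q)%:E)%E by rewrite gee0_abs // lee_fin.
  rewrite (eq_integral (fun q : borel T => (f q)%:E)); last by move=> q _; rewrite E.
  rewrite -[LHS]fineK; last exact: (integrable_fin_num measurableT intf).
  by move: i0; rewrite /torus_int /Rintegral => ->.
have mE : measurable_fun setT (fun p : borel T => (f p)%:E) by exact/measurable_EFinP.
have [N [mN N0 subN]] := (ae_eq_integral_abs (torus_volume R) measurableT mE).1 i0'.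
have oU : @open T [set q | 0 < f q].
  by apply: (@open_comp _ _ f [set x | 0 < x]) => [x _|]; [exact: cf|exact: open_gt].
have mU : measurable ([set q | 0 < f q] : set (borel T)) by exact: sub_sigma_algebra.
have : (torus_volume R [set q | 0 < f q]%R <= torus_volume R N)%E.
  apply: le_measure; rewrite ?inE //.
  by move=> q /= fq; apply: subN => /= /(_ I) [] /eqP; rewrite gt_eqF.
rewrite N0 leNgt => /negP; apply.
by apply: torus_volume_gt0 => //; exists p.
Qed.

Lemma circle_int_derive (f df : RT -> R) : (forall t : R, is_derive t 1 (f : R -> R) (df t)) ->
  continuous (df : R -> R) -> f (- pi) = f pi -> (\int[circle]_t (df t)%:E = 0)%E.
Proof.
move=> fd cdf fpi; have pi0 := pi_gt0 R.
have mdf : measurable_fun setT df by exact: continuous_measurable_fun.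
have mdE : measurable_fun setT (EFin \o df) by exact/measurable_EFinP.
rewrite integral_circle // integral_itv_bndo_bndc; last exact: measurable_funS mdE.
have cf : continuous (f : R -> R).
  by move=> t; apply: differentiable_continuous; apply/derivable1_diffP; case: (fd t).
rewrite (@continuous_FTC2 _ df f (- pi) pi).
- by rewrite fpi subee.
- by lra.
- exact: continuous_subspaceT.
- split => [t _||]; first by case: (fd t).
    by apply: cvg_at_right_filter; exact: cf.
  by apply: cvg_at_left_filter; exact: cf.
- by move=> t _; rewrite derive1E; case: (fd t).
Qed.

Lemma row4D (u : RT4) (t : R) :
  [/\ row4 (u.1 + t, u.2) = row4 u + t *: delta_mx ord0 ord0,
      row4 (u.1, (u.2.1 + t, u.2.2)) = row4 u + t *: delta_mx ord0 j1,
      row4 (u.1, (u.2.1, (u.2.2.1 + t, u.2.2.2))) = row4 u + t *: delta_mx ord0 j2 &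
      row4 (u.1, (u.2.1, (u.2.2.1, u.2.2.2 + t))) = row4 u + t *: delta_mx ord0 j3].
Proof.
have H (w v : RT4) j : (forall i, row4 w ord0 i = row4 v ord0 i + t * (i == j)%:R) ->
    row4 w = row4 v + t *: delta_mx ord0 j.
  move=> h; apply/rowP => i; have E : (t *: delta_mx ord0 j : V) ord0 i = t * (i == j)%:R.
    by rewrite !mxE eqxx.
  by rewrite h [RHS]mxE E.
by split; apply: H => i; rewrite !row4E; case: i => [[|[|[|[|//]]]] Hi];
  rewrite !(tnth_nth 0) /= ?mulr1 ?mulr0 ?addr0.
Qed.

Lemma torus_intE f : continuous f ->
  torus_int f = fine (\int[circle4 R]_u (f (tproj (row4 u)))%:E)%E.
Proof.
move=> cf; rewrite /torus_int /Rintegral; congr fine.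
have mf : measurable_fun [set: borel T] (EFin \o (f : borel T -> R)).
  by apply/measurable_EFinP; exact: torus_measurable.
have lt : (circle4 R setT < +oo)%E by rewrite ltey_eq fin_num_measure.
have mg := measurableT_comp (torus_measurable cf) (@measurable_torus_proj R).
have bg : [bounded f (tproj (row4 u)) | u in [set: RT4]].
  have [M [Mr HM]] := torus_bounded cf.
  by exists M; split => // x Mx u _; exact: HM.
have ig := measurable_bounded_integrable measurableT lt mg bg.
exact: (@integral_pushforward _ _ _ _ _ _ (@measurable_torus_proj R) (circle4 R)
  setT (EFin \o (f : borel T -> R)) mf ig measurableT).
Qed.

(** Integration by parts without boundary. The variables before [j] are frozen by
    [finite_prod_integral0l], then [finite_prod_integral0r] integrates over the [j]-th circle first,
    where a derivative over a full period has integral zero. *)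
Lemma torus_int_derive (H f : T -> R) j : smooth (fun x : V => H (tproj x)) ->
  (forall x, f (tproj x) = 'D_(delta_mx ord0 j) (fun x : V => H (tproj x)) x) ->
  torus_int f = 0.
Proof.
move=> sH fE; pose h (x : V) := H (tproj x); pose dh (x : V) := f (tproj x).
have dhE : dh = 'D_(delta_mx ord0 j) h by apply/funext => x; exact: fE.
have sdh : smooth dh by rewrite dhE; exact: smooth_derive.
have cf : continuous f by apply: torus_continuous => x; exact: (smooth_continuous sdh).
have line (x : V) : (\int[circle]_t (dh (x + (t : R) *: delta_mx ord0 j))%:E = 0)%E.
  apply: (@circle_int_derive (fun t : R => h (x + t *: delta_mx ord0 j))).
  - by move=> t; rewrite dhE; apply: is_derive_line; exact: smooth_derivable.
  - move=> t; apply: (@continuous_comp _ _ _ (fun t : R => x + t *: delta_mx ord0 j) dh).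
      have k : {for t, continuous (fun=> x)} by exact: cst_continuous.
      have k2 : {for t, continuous (fun t : R => t *: (delta_mx ord0 j : V))}.
        exact: scalel_continuous.
      exact: (continuousD k k2).
    exact: (smooth_continuous sdh).
  - rewrite /h; congr H; apply/esym/tproj_periodic => i; rewrite !mxE eqxx /=.
    by case: (i == j); [right; rewrite !mulr1 mulr2n; ring|left; rewrite !mulr0].
rewrite torus_intE //; suff -> : (\int[circle4 R]_u (f (tproj (row4 u)))%:E = 0)%E by [].
have mF := measurableT_comp (torus_measurable cf) (@measurable_torus_proj R).
have [M [Mr HM]] := torus_bounded cf.
have bF d (U : measurableType d) (r : U -> RT4) : [bounded f (tproj (row4 (r u))) | u in [set: U]].
  by exists M; split => // x Mx u _; exact: HM.
have mF1 a := measurable_section a mF.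
have mF2 a b := measurable_section b (mF1 a).
case: j @dh dhE sdh line {fE} => [[|[|[|[|//]]]] Hj] dh dhE sdh line.
- rewrite (_ : Ordinal Hj = ord0) in line; last exact: val_inj.
  apply: (@finite_prod_integral0r _ _ _ _ _ circle (circle3 R) _ mF (bF _ _ id)) => w.
  rewrite -[RHS](line (row4 (0, w))); apply: eq_integral => t _.
  by have [<- _ _ _] := row4D (0, w) t; rewrite /= add0r.
- rewrite (_ : Ordinal Hj = j1) in line; last exact: val_inj.
  apply: (@finite_prod_integral0l _ _ _ _ _ circle (circle3 R) _ mF (bF _ _ id)) => a.
  apply: (@finite_prod_integral0r _ _ _ _ _ circle (circle2 R) _ (mF1 a) (bF _ _ (pair a))) => w.
  rewrite -[RHS](line (row4 (a, (0, w)))); apply: eq_integral => t _.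
  by have [_ <- _ _] := row4D (a, (0, w)) t; rewrite /= add0r.
- rewrite (_ : Ordinal Hj = j2) in line; last exact: val_inj.
  apply: (@finite_prod_integral0l _ _ _ _ _ circle (circle3 R) _ mF (bF _ _ id)) => a.
  apply: (@finite_prod_integral0l _ _ _ _ _ circle (circle2 R) _ (mF1 a) (bF _ _ (pair a))) => b.
  apply: (@finite_prod_integral0r _ _ _ _ _ circle circle _ (mF2 a b)
    (bF _ _ (fun w => (a, (b, w))))) => w.
  rewrite -[RHS](line (row4 (a, (b, (0, w))))); apply: eq_integral => t _.
  by have [_ _ <- _] := row4D (a, (b, (0, w))) t; rewrite /= add0r.
- rewrite (_ : Ordinal Hj = j3) in line; last exact: val_inj.
  apply: (@finite_prod_integral0l _ _ _ _ _ circle (circle3 R) _ mF (bF _ _ id)) => a.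
  apply: (@finite_prod_integral0l _ _ _ _ _ circle (circle2 R) _ (mF1 a) (bF _ _ (pair a))) => b.
  apply: (@finite_prod_integral0l _ _ _ _ _ circle circle _ (mF2 a b)
    (bF _ _ (fun w => (a, (b, w))))) => e.
  rewrite -[RHS](line (row4 (a, (b, (e, 0))))); apply: eq_integral => t _.
  by have [_ _ _ <-] := row4D (a, (b, (e, 0))) t; rewrite /= add0r.
Qed.

End TorusIntegral.

(** * The almost Hermitian structure *)

Section TorusHermitian.
Local Open Scope complex_scope.
Variables (R : realType) (s h : R).
Hypothesis sh1 : s ^+ 2 + h ^+ 2 = 1.
Local Notation V := 'rV[R]_4.
Local Notation T := (torus R 4).

Definition quaternion_entry (n1 n2 n3 : R) (i j : nat) : R :=
  nth 0 (nth [::] [:: [:: 0; n1; n2; n3]; [:: - n1; 0; n3; - n2];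
                      [:: - n2; - n3; 0; n1]; [:: - n3; n2; - n1; 0]] i) j.

(* Left multiplication by the quaternion n1 i + n2 j + n3 k, acting on rows. *)
Definition quaternion_mx n1 n2 n3 : 'M[R]_4 :=
  \matrix_(i, j) quaternion_entry n1 n2 n3 i j.

Lemma quaternion_mx_sqr n1 n2 n3 : n1 ^+ 2 + n2 ^+ 2 + n3 ^+ 2 = 1 ->
  quaternion_mx n1 n2 n3 *m quaternion_mx n1 n2 n3 = - 1%:M.
Proof.
move=> n1E; apply/matrixP => i j; rewrite !mxE !big_ord_recl big_ord0 !mxE /quaternion_entry /=.
have E : n3 ^+ 2 = 1 - n1 ^+ 2 - n2 ^+ 2 by rewrite -n1E; ring.
case: i => [[|[|[|[|//]]]] Hi]; case: j => [[|[|[|[|//]]]] Hj];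
  rewrite -!val_eqE /= ?mulr1n ?mulr0n; ring: E.
Qed.

Lemma quaternion_mx_tr n1 n2 n3 : (quaternion_mx n1 n2 n3)^T = - quaternion_mx n1 n2 n3.
Proof.
apply/matrixP => i j; rewrite !mxE /quaternion_entry.
by case: i => [[|[|[|[|//]]]] Hi]; case: j => [[|[|[|[|//]]]] Hj]; rewrite /= ?opprK ?oppr0.
Qed.

Definition torusJ (p : T) : 'M[R]_4 := quaternion_mx (s * tcos p ord0) (s * tsin p ord0) h.

Lemma torusJ_sqr p : torusJ p *m torusJ p = - 1%:M.
Proof.
apply: quaternion_mx_sqr; rewrite -(tliftK p) tcosE tsinE.
by rewrite !exprMn -mulrDr cos2Dsin2 mulr1.
Qed.

Lemma smooth_torusJ i j : smooth (fun x : V => torusJ (tproj x) i j).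
Proof.
have sc : smooth (fun x : V => s * cos (x ord0 ord0)).
  exact: smoothM (smooth_cst _ s) (smooth_cos _ _).
have ss : smooth (fun x : V => s * sin (x ord0 ord0)).
  exact: smoothM (smooth_cst _ s) (smooth_sin _ _).
have -> : (fun x : V => torusJ (tproj x) i j) = fun x =>
    quaternion_entry (s * cos (x ord0 ord0)) (s * sin (x ord0 ord0)) h i j.
  by apply/funext => x; rewrite mxE tcosE tsinE.
by case: i => [[|[|[|[|//]]]] Hi]; case: j => [[|[|[|[|//]]]] Hj] /=;
  do ?[exact: smooth_cst|exact: sc|exact: ss|exact: smoothN sc|exact: smoothN ss].
Qed.

Lemma torusJ_smooth (p : torus_manifold R 4) (i j : 'I_4) :
  smooth_on (chart p @` dom p)
    (fun x => (jac p x *m torusJ (cinv p x) *m invmx (jac p x)) i j).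
Proof.
have -> : (fun x => (jac p x *m torusJ (cinv p x) *m invmx (jac p x)) i j) =
    fun x : V => torusJ (tproj (x + tlift p)) i j.
  by apply/funext => x; rewrite torus_jac invmx1 mul1mx mulmx1 /= /tcinv addrC.
exact: (smooth_onW (smooth_translate _ (smooth_torusJ i j))).
Qed.

Lemma torus_metric_smooth (p : torus_manifold R 4) (i j : 'I_4) :
  smooth_on (chart p @` dom p)
    (fun x => (jac p x *m 1%:M *m (jac p x)^T) i j).
Proof.
have -> : (fun x => (jac p x *m 1%:M *m (jac p x)^T) i j) = cst ((1%:M : 'M[R]_4) i j).
  by apply/funext => x; rewrite torus_jac trmx1 !mulmx1.
exact: (smooth_onW (smooth_cst _ _)).
Qed.

Lemma row_sqr_gt0 (v : V) : v != 0 -> 0 < (v *m 1%:M *m v^T) ord0 ord0.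
Proof.
move=> v0; rewrite mulmx1 mxE lt_def; apply/andP; split; last first.
  by apply: sumr_ge0 => i _; rewrite mxE -expr2 sqr_ge0.
apply: contraNneq v0 => /eqP; rewrite psumr_eq0; last first.
  by move=> i _; rewrite mxE -expr2 sqr_ge0.
move=> /allP H; apply/eqP/rowP => i; rewrite [RHS]mxE.
have := H i (mem_index_enum i); rewrite mxE -expr2 sqrf_eq0 => /eqP //.
Qed.

Lemma torusJ_invariant p : torusJ p *m 1%:M *m (torusJ p)^T = 1%:M.
Proof. by rewrite mulmx1 quaternion_mx_tr mulmxN torusJ_sqr opprK. Qed.

Definition hermitian_torus : almost_hermitian R 4 :=
  @AlmostHermitian R 4 (torus_manifold R 4) torusJ (fun=> 1%:M) torusJ_smooth torusJ_sqr
    torus_metric_smooth (fun=> trmx1 _ _) (fun=> row_sqr_gt0) torusJ_invariant.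

End TorusHermitian.

(** * Forms on the torus *)

Section TorusForms.
Local Open Scope complex_scope.
Variables (R : realType) (n : nat).
Local Notation V := 'rV[R]_n.
Local Notation C := R[i].
Local Notation W := 'rV[R[i]]_n.
Local Notation M := (torus_manifold R n).
Local Notation T := (torus R n).
Implicit Types (k : nat).

Lemma cmx1 : cmx (1%:M : 'M[R]_n) = 1%:M.
Proof. exact: map_mx1. Qed.

Lemma torus_in_chart k (al : cform M k) (p : M) (x : V) v :
  in_chart al p x v = al (tproj (tlift (p : T) + x)) v.
Proof.
rewrite /in_chart; congr (al _ _); apply/funext => i.
by rewrite torus_jac cmx1 mulmx1.
Qed.

(** In the chart at [p] the form is a translate of its lift to R^n. Conversely, the chart at
    [tproj x] covers a whole neighbourhood of [x], which is enough since smoothness is local. *)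
Lemma torus_form_smooth k (al : cform M k) v :
  (forall p, smooth_on (chart p @` dom p) (fun x => complex.Re (in_chart al p x v)) /\
    smooth_on (chart p @` dom p) (fun x => complex.Im (in_chart al p x v))) <->
  csmooth (fun x : V => al (tproj x) v).
Proof.
split=> [H|[Hr Hi] p].
  suff K (g : C -> R) : (forall p : M, smooth_on (chart p @` dom p)
      (fun x => g (in_chart al p x v))) -> smooth (fun x : V => g (al (tproj x) v)).
    by split; apply: K => p; case: (H p).
  move=> {}H; apply: smooth_locally => x.
  exists [set y : V | tbox (y - x)]; split.
  - have cx : continuous (fun y : V => y - x).
      move=> y; have cst : {for y, continuous (fun=> x)} by exact: cst_continuous.
      have c : {for y, continuous (fun y : V => y)} by [].
      exact: (continuousB c cst).
    exact: (open_comp (fun y _ => cx y) (@tbox_open R n)).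
  - by move=> i /=; rewrite !mxE subrr oppr_lt0 pi_gt0.
  - have := smooth_on_translate (c := - x) (H (tproj x)).
    rewrite [chart _ @` _]tchart_image => sm.
    rewrite (_ : (fun y : V => g (al (tproj y) v)) =
      fun y => g (in_chart al (tproj x : M) (y - x) v)) //.
    apply/funext => y; rewrite torus_in_chart; congr (g (al _ v)).
    by rewrite -{1}(subrK x y) [y - x + x]addrC; apply: tproj_translate; rewrite tliftK.
have E (g : C -> R) : (fun x : V => g (in_chart al p x v)) =
    fun x => g (al (tproj (x + tlift (p : T))) v).
  by apply/funext => x; rewrite torus_in_chart addrC.
split; [rewrite (E (@complex.Re R))|rewrite (E (@complex.Im R))];
  apply: smooth_onW.
- exact: (smooth_translate (tlift (p : T)) Hr).
- exact: (smooth_translate (tlift (p : T)) Hi).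
Qed.

Lemma form_csmooth k (al : cform M k) v : is_form al -> csmooth (fun x : V => al (tproj x) v).
Proof. by move=> [_ _ H]; apply/torus_form_smooth => p; exact: H. Qed.

Lemma torus_is_form k (al : cform M k) :
  (forall p v i (a : C) u w, al p (set_arg v i (a *: u + w)) =
        a * al p (set_arg v i u) + al p (set_arg v i w)) ->
  (forall p v i j, i != j -> v i = v j -> al p v = 0) ->
  (forall v, csmooth (fun x : V => al (tproj x) v)) -> is_form al.
Proof. by move=> h1 h2 h3; split=> // p v; have /torus_form_smooth := h3 v; apply. Qed.

Lemma tproj_addl (x y z : V) : tproj x = tproj y -> tproj (z + x) = tproj (z + y).
Proof. by move=> e; rewrite addrC [z + y]addrC; exact: tproj_translate. Qed.

Lemma cD_periodic (F : V -> C) u (a b : V) : (forall y, F (y + a) = F (y + b)) ->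
  cD u F a = cD u F b.
Proof.
move=> Fab; have E : (fun y => F (y + a)) = (fun y => F (y + b)) by exact/funext.
have := cD_translate u F a 0; have := cD_translate u F b 0.
by rewrite E !add0r => -> ->.
Qed.

(** Descent of a function from R^n to the torus. It is meaningful for periodic [P], where the value
    does not depend on the lift chosen. *)
Definition fun_form (P : V -> C) : cform M 0 := fun p _ => P (tlift (p : T)).

Lemma torus_fun_lift (U : Type) (P : V -> U) :
  (forall x y : V, tproj x = tproj y -> P x = P y) -> forall x, P (tlift (tproj x)) = P x.
Proof. by move=> pP x; apply: pP; rewrite tliftK. Qed.

Lemma is_form_fun_form (P : V -> C) : csmooth P ->
  (forall x y : V, tproj x = tproj y -> P x = P y) -> is_form (fun_form P).
Proof.
move=> sP pP; apply: torus_is_form => [p v []|p v []|v] //.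
by rewrite (_ : (fun x : V => _) = P) //; apply/funext => x; exact: torus_fun_lift.
Qed.

Definition along (v : W) (F : V -> C) : V -> C :=
  fun x => \sum_j v ord0 j * cD (delta_mx ord0 j) F x.

(** The chart at a point sends it to 0, and the form read there is a translate of its lift;
    periodicity carries the derivative from the chosen lift to [x]. *)
Lemma torus_dext k (al : cform M k) (x : V) v : is_form al ->
  dext al (tproj x : M) v = \sum_(i < k.+1) (-1) ^+ i *
    along (v i) (fun y => al (tproj y) (fun j => v (lift i j))) x.
Proof.
move=> fal; apply: eq_bigr => i _; congr (_ * _).
set w := fun j => v (lift i j).
have sF := form_csmooth w fal; set p : T := tproj x.
have c0 : chart (p : M) (p : M) = 0 :> V.
  rewrite [LHS](_ : _ = tchart (tproj (tlift p)) (tproj (tlift p))).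
    by rewrite tchart_near ?subrr // => j; rewrite !mxE oppr_lt0 pi_gt0.
  by rewrite tliftK.
rewrite c0 /along.
have -> : (fun y : V => in_chart al (p : M) y w) = fun y => al (tproj (y + tlift p)) w.
  by apply/funext => y; rewrite torus_in_chart addrC.
rewrite cderiveE; last exact: (csmooth_translate (tlift p) sF).
apply: eq_bigr => j _; congr (_ * _).
rewrite (@cD_translate _ _ _ (fun y : V => al (tproj y) w)) add0r.
apply: (@cD_periodic (fun y : V => al (tproj y) w)) => y; congr (al _ w).
by apply: tproj_addl; rewrite tliftK.
Qed.

End TorusForms.

(** * Multilinearity, low degrees and bidegree *)

Lemma ord2_cases (i : 'I_2) : i = ord0 \/ i = ord_max.
Proof. by case: i => [[|[|//]] Hi]; [left|right]; exact: val_inj. Qed.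

Section Multilinear.
Local Open Scope complex_scope.
Variables (R : realType) (n : nat) (M : manifold R n).
Local Notation W := 'rV[R[i]]_n.

Definition multilinear k (be : cform M k) : Prop := forall p v i (a : R[i]) u w,
  be p (set_arg v i (a *: u + w)) = a * be p (set_arg v i u) + be p (set_arg v i w).

Lemma form_multilinear k (al : cform M k) : is_form al -> multilinear al.
Proof. by case. Qed.

Lemma set_arg_id k (v : 'I_k -> W) i : set_arg v i (v i) = v.
Proof. by apply/funext => j; rewrite /set_arg; case: eqP => // ->. Qed.

Lemma multilinear0 k (be : cform M k) p v i : multilinear be -> v i = 0 -> be p v = 0.
Proof.
move=> ml vi; rewrite -(set_arg_id v i) vi.
by have := ml p v i (-1) 0 0; rewrite scaler0 addr0 mulN1r addNr.
Qed.

Lemma multilinear_expand k (be : cform M k) p v i (u : W) : multilinear be ->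
  be p (set_arg v i u) = \sum_j u ord0 j * be p (set_arg v i (delta_mx ord0 j)).
Proof.
move=> ml; have z : be p (set_arg v i 0) = 0.
  by apply: (@multilinear0 _ be p (set_arg v i 0) i ml); rewrite /set_arg eqxx.
have Z a w : be p (set_arg v i (a *: w)) = a * be p (set_arg v i w).
  by have := ml p v i a w 0; rewrite z !addr0.
have D w1 w2 : be p (set_arg v i (w1 + w2)) = be p (set_arg v i w1) + be p (set_arg v i w2).
  by have := ml p v i 1 w1 w2; rewrite scale1r mul1r.
rewrite {1}[u]row_sum_delta.
apply: (big_ind2 (fun x y => be p (set_arg v i x) = y)) => //.
  by move=> x1 y1 x2 y2 <- <-; exact: D.
Qed.

(** Induction on the number [m] of leading arguments that are still arbitrary; one of them is
    expanded in the basis at each step. *)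
Lemma multilinear_eq0 k (be : cform M k) p : multilinear be ->
  (forall I : {ffun 'I_k -> 'I_n}, be p (fun a => delta_mx ord0 (I a)) = 0) ->
  forall v, be p v = 0.
Proof.
move=> ml h0 v.
suff H (m : nat) : (m <= k)%N -> forall v : 'I_k -> W,
    (forall i : 'I_k, (m <= i)%N -> exists j, v i = delta_mx ord0 j) -> be p v = 0.
  by apply: (H k) => // i; rewrite leqNgt ltn_ord.
elim: m => [_|m IH mk] {}v hv.
  have {hv}hv i : exists j, v i = delta_mx ord0 j by exact: hv.
  have -> : v = fun a => delta_mx ord0 ([ffun i => projT1 (cid (hv i))] a).
    by apply/funext => i; rewrite ffunE; case: (cid (hv i)).
  exact: h0.
rewrite -(set_arg_id v (Ordinal mk)) multilinear_expand //.
apply: big1 => j _; rewrite IH ?mulr0 //; first exact: ltnW.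
move=> i mi; rewrite /set_arg; case: eqP => [_|/eqP im]; first by exists j.
apply: hv; rewrite ltn_neqAle mi andbT; apply: contraNneq im => e.
by apply/eqP/val_inj.
Qed.

Lemma form1E (al : cform M 1) p v : multilinear al ->
  al p v = \sum_j v ord0 ord0 j * al p (fun=> delta_mx ord0 j).
Proof.
move=> ml; rewrite -{1}(set_arg_id v ord0) multilinear_expand //.
apply: eq_bigr => j _; congr (_ * al p _).
by apply/funext => i; rewrite /set_arg (ord1 i).
Qed.

End Multilinear.

Section LowDegree.
Local Open Scope complex_scope.
Variables (R : realType) (n : nat).
Local Notation V := 'rV[R]_n.
Local Notation W := 'rV[R[i]]_n.
Local Notation M := (torus_manifold R n).

Definition coef (al : cform M 1) k (x : V) : R[i] :=
  al (tproj x) (fun=> delta_mx ord0 k).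

Lemma csmooth_coef (al : cform M 1) k : is_form al -> csmooth (coef al k).
Proof. exact: form_csmooth. Qed.

Lemma dext1E (al : cform M 1) (x : V) v : is_form al ->
  dext al (tproj x : M) v = \sum_j \sum_k v ord0 ord0 j * v ord_max ord0 k *
    (cD (delta_mx ord0 j) (coef al k) x - cD (delta_mx ord0 k) (coef al j) x).
Proof.
move=> fal; rewrite torus_dext // big_ord_recl big_ord1 expr0 mul1r expr1 mulN1r.
have E (u w : W) : along u (fun y => al (tproj y) (fun=> w)) x =
    \sum_j \sum_k u ord0 j * (w ord0 k * cD (delta_mx ord0 j) (coef al k) x).
  apply: eq_bigr => j _; rewrite -mulr_sumr; congr (_ * _).
  have -> : (fun y : V => al (tproj y) (fun=> w)) = fun y => \sum_k w ord0 k * coef al k y.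
    by apply/funext => y; rewrite form1E //; exact: form_multilinear.
  rewrite cD_sum; last by move=> k; apply: csmoothZ; exact: csmooth_coef.
  by apply: eq_bigr => k _; rewrite cDZ //; exact: csmooth_coef.
have -> : (fun y : V => al (tproj y) (fun j => v (lift ord0 j))) =
    fun y => al (tproj y) (fun=> v ord_max).
  by apply/funext => y; congr (al _ _); apply/funext => j; congr (v _); apply: val_inj; rewrite (ord1 j).
have -> : (fun y : V => al (tproj y) (fun j => v (lift (lift ord0 ord0) j))) =
    fun y => al (tproj y) (fun=> v ord0).
  by apply/funext => y; congr (al _ _); apply/funext => j; congr (v _); apply: val_inj; rewrite (ord1 j).
have -> : v (lift ord0 ord0) = v ord_max by congr (v _); exact: val_inj.
rewrite !E [X in _ - X]exchange_big /= -sumrB; apply: eq_bigr => j _.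
by rewrite -sumrB; apply: eq_bigr => k _; ring.
Qed.

Lemma multilinear_dext1 (al : cform M 1) : is_form al -> multilinear (dext al).
Proof.
move=> fal p v i a u w; rewrite -(tliftK p) !dext1E //.
rewrite mulr_sumr -big_split; apply: eq_bigr => j _ /=.
rewrite mulr_sumr -big_split; apply: eq_bigr => k _ /=.
by rewrite /set_arg; have [->|->] := ord2_cases i; rewrite -!val_eqE /= !mxE; ring.
Qed.

Definition no_arg : 'I_0 -> W := fun=> 0.

Lemma no_argE (v : 'I_0 -> W) : v = no_arg.
Proof. by apply/funext => -[]. Qed.

Lemma dext0E (f : cform M 0) (x : V) v : is_form f ->
  dext f (tproj x : M) v = along (v ord0) (fun y => f (tproj y) no_arg) x.
Proof. by move=> ff; rewrite torus_dext // big_ord1 expr0 mul1r (no_argE (fun j => _)). Qed.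

End LowDegree.

Section Bidegree.
Local Open Scope complex_scope.
Variables (R : realType) (n : nat) (M : almost_hermitian R n).

Lemma proj10D01 (p : M) : proj10 p + proj01 p = 1%:M.
Proof.
by apply/matrixP => i j; rewrite /proj10 /proj01 !mxE; field.
Qed.

Lemma multilinear_bidegree_part k r (be : cform M k) :
  multilinear be -> multilinear (bidegree_part r be).
Proof.
move=> ml p v i a u w; rewrite /bidegree_part mulr_sumr -big_split.
apply: eq_bigr => S _ /=.
have E (z : 'rV[R[i]]_n) : (fun j => set_arg v i z j *m (if j \in S then proj10 p else proj01 p)) =
    set_arg (fun j => v j *m (if j \in S then proj10 p else proj01 p)) i
      (z *m (if i \in S then proj10 p else proj01 p)).
  by apply/funext => j; rewrite /set_arg; case: eqP => // ->.
by rewrite !E mulmxDl -scalemxAl ml.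
Qed.

(** [S] marks the arguments of type (1,0), the others being of type (0,1). In any other summand some
    argument meets the projector that kills it. *)
Lemma bidegree_part_eigen k r (be : cform M k) p v (S : {set 'I_k}) : multilinear be ->
  (forall i, v i *m proj10 p = if i \in S then v i else 0) ->
  bidegree_part r be p v = if #|S| == r then be p v else 0.
Proof.
move=> ml v10.
have v01 i : v i *m proj01 p = if i \in S then 0 else v i.
  have <- : v i *m 1%:M - v i *m proj10 p = v i *m proj01 p.
    by rewrite -(proj10D01 p) mulmxDr addrC addKr.
  by rewrite v10 mulmx1; case: ifP; rewrite ?subrr ?subr0.
have H (S' : {set 'I_k}) : S' != S ->
    be p (fun i => v i *m (if i \in S' then proj10 p else proj01 p)) = 0.
  move=> SS'; have [i Hi] : exists i, (i \in S') != (i \in S).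
    apply/existsP; rewrite -negb_forall; apply: contraNN SS' => /forallP h.
    by apply/eqP/setP => i; apply/eqP/h.
  apply: (@multilinear0 _ _ _ _ be p _ i ml).
  case: ifP Hi => iS' Hi; rewrite ?v10 ?v01; by case: (i \in S) Hi.
have HS : (fun i => v i *m (if i \in S then proj10 p else proj01 p)) = v.
  by apply/funext => i; case: ifP => iS; rewrite ?v10 ?v01 iS.
rewrite /bidegree_part; case: ifP => Sr.
  by rewrite (bigD1 S) //= HS big1 ?addr0 // => S' /andP[_]; exact: H.
apply: big1 => S' Sr'; apply: H; apply: contraTneq Sr' => ->; by rewrite Sr.
Qed.

Lemma bidegree_part0 k r : bidegree_part r (0 : cform M k) = 0.
Proof. by apply/funext => p; apply/funext => v; rewrite /bidegree_part big1. Qed.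

End Bidegree.

(** * The L^2 product and harmonic 1-forms *)

Section HermitianProduct.
Local Open Scope complex_scope.
Variables (R : realType) (s h : R) (sh1 : s ^+ 2 + h ^+ 2 = 1).
Local Notation V := 'rV[R]_4.
Local Notation W := 'rV[R[i]]_4.
Local Notation T := (torus R 4).
Local Notation M := (hermitian_torus sh1).
Definition hermitian_volume : {measure set (borel M) -> \bar R} := torus_volume R.
Local Notation vol := hermitian_volume.

Definition basis_arg k (I : {ffun 'I_k -> 'I_4}) : 'I_k -> W :=
  fun a => delta_mx ord0 (I a).

(** The metric is the identity matrix, so only equal multi-indices survive. *)
Lemma torus_form_dot k (al be : cform M k) p : form_dot al be p =
  (k`!%:R)^-1 * \sum_I al p (basis_arg I) * conjc (be p (basis_arg I)).
Proof.
congr (_ * _); apply: eq_bigr => I _; rewrite (bigD1 I) //= [X in _ + X]big1 ?addr0.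
  rewrite (_ : (\prod_(a < k) _)%:C = 1) ?mul1r //; congr (_%:C).
  by apply: big1 => a _; rewrite invmx1 mxE eqxx.
move=> K KI; have [a Ia] : exists a, I a != K a.
  apply/existsP; rewrite -negb_forall; apply: contraNN KI => /forallP e.
  by apply/eqP/ffunP => a; apply/esym/eqP/e.
rewrite (_ : (\prod_(a < k) _)%:C = 0) ?mul0r //; congr (_%:C).
apply/eqP/prodf_eq0; exists a => //; by rewrite invmx1 mxE (negbTE Ia).
Qed.

Definition csmooth_form k (al : cform M k) : Prop :=
  forall v, csmooth (fun x : V => al (tproj x : T) v).

Lemma csmooth_form_dot k (al be : cform M k) : csmooth_form al -> csmooth_form be ->
  csmooth (fun x : V => form_dot al be (tproj x : T)).
Proof.
move=> sa sb; rewrite (_ : (fun x => _) = fun x : V => (k`!%:R)^-1 *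
  \sum_I al (tproj x : T) (basis_arg I) * conjc (be (tproj x : T) (basis_arg I))).
  apply: csmoothZ; apply: csmooth_sum => I.
  exact: csmoothM (sa _) (csmooth_conj (sb _)).
by apply/funext => x; rewrite torus_form_dot.
Qed.

(** Real parts suffice: squared norms are real, and the arguments below all end with the vanishing
    of a squared norm. *)
Definition re_dot k (al be : cform M k) (p : T) : R := complex.Re (form_dot al be p).

Lemma Re_L2_dot k (al be : cform M k) :
  complex.Re (L2_dot vol al be) = torus_int (re_dot al be).
Proof. by []. Qed.

Lemma continuous_re_dot k (al be : cform M k) : csmooth_form al -> csmooth_form be ->
  continuous (re_dot al be).
Proof.
move=> sa sb; apply: torus_continuous => x.
by apply: smooth_continuous; have [] := csmooth_form_dot sa sb.
Qed.

Lemma Re_sum (J : Type) (r : seq J) (F : J -> R[i]) :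
  complex.Re (\sum_(j <- r) F j) = \sum_(j <- r) complex.Re (F j).
Proof. by elim: r => [|j r IH]; rewrite ?big_nil ?big_cons // Re_add IH. Qed.

Lemma re_dotE k (al be : cform M k) p : re_dot al be p = (k`!%:R)^-1 *
  \sum_I (complex.Re (al p (basis_arg I)) * complex.Re (be p (basis_arg I)) +
          complex.Im (al p (basis_arg I)) * complex.Im (be p (basis_arg I))).
Proof.
rewrite /re_dot torus_form_dot.
have -> : (k`!%:R)^-1 = ((k`!%:R)^-1 : R)%:C :> R[i] by rewrite fmorphV rmorph_nat.
rewrite Re_mul /= mul0r subr0 Re_sum; congr (_ * _); apply: eq_bigr => I _.
by rewrite Re_mul; case: (be p _) => c d /=; rewrite mulrN opprK.
Qed.

Lemma re_dotC k (al be : cform M k) : re_dot al be = re_dot be al.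
Proof.
apply/funext => p; rewrite !re_dotE; congr (_ * _); apply: eq_bigr => I _.
by rewrite mulrC [X in _ + X]mulrC.
Qed.

Lemma re_dotN k (al be : cform M k) p : re_dot (- al) be p = -1 * re_dot al be p.
Proof.
rewrite !re_dotE mulrCA; congr (_ * _); rewrite mulr_sumr; apply: eq_bigr => I _.
by rewrite -[(- al) p _]/(- al p _); case: (al p _) => c d /=; ring.
Qed.

Lemma re_dot_ge0 k (al : cform M k) p : 0 <= re_dot al al p.
Proof.
rewrite re_dotE mulr_ge0 ?invr_ge0 ?ler0n //; apply: sumr_ge0 => I _.
by rewrite -!expr2 addr_ge0 ?sqr_ge0.
Qed.

Lemma Re_L2_dot_ge0 k (al : cform M k) : 0 <= torus_int (re_dot al al).
Proof. by apply: Rintegral_ge0 => p _; exact: re_dot_ge0. Qed.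

Lemma L2_dot_eq0 k (al : cform M k) : csmooth_form al -> torus_int (re_dot al al) = 0 ->
  forall p I, al p (basis_arg I) = 0.
Proof.
move=> sa i0 p I.
have := torus_int_eq0 (continuous_re_dot sa sa) (re_dot_ge0 al) i0 p.
rewrite re_dotE => /eqP; rewrite mulf_eq0 invr_eq0 pnatr_eq0 (gtn_eqF (fact_gt0 k)) /=.
have ge0 J : 0 <= complex.Re (al p (basis_arg J)) * complex.Re (al p (basis_arg J)) +
    complex.Im (al p (basis_arg J)) * complex.Im (al p (basis_arg J)).
  by rewrite -!expr2 addr_ge0 ?sqr_ge0.
rewrite psumr_eq0 // => /allP /(_ I (mem_index_enum I)) /=.
rewrite -!expr2 paddr_eq0 ?sqr_ge0 // !sqrf_eq0.
by case: (al p _) => c d /= /andP[/eqP -> /eqP ->].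
Qed.

Lemma csmooth_form_form k (al : cform M k) : is_form al -> csmooth_form al.
Proof. by move=> fal v; exact: form_csmooth. Qed.

Variable delta : forall k, cform M k -> cform M k.+1.

(** With [be] = delta^* al and [ga] = delta^* delta al, the real part of the pairing of delta be +
    ga = 0 with [al] is |be|^2 + |delta al|^2 = 0. The two adjoint relations are tested on [be] and
    on [al] themselves. Once [be] vanishes, its relation says that [al] is orthogonal to the image
    of delta. *)
Lemma harmonic1_closed (al : cform M 1) : is_form al -> csmooth_form (delta al) ->
    is_laplacian vol delta al 0 ->
  (forall p I, delta al p (basis_arg I) = 0) /\
  (forall f : cform M 0, is_form f -> torus_int (re_dot (delta f) al) = 0).
Proof.
move=> fal sd [be [ga [[fbe Hbe] [fga Hga] E]]].
have gaE : delta be = - ga by apply/eqP; rewrite -addr_eq0 -E.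
have := congr1 (@complex.Re R) (Hga _ fal); rewrite !Re_L2_dot => h1.
have := congr1 (@complex.Re R) (Hbe _ fbe); rewrite !Re_L2_dot gaE => h2.
have {}h2 : torus_int (re_dot be be) = - torus_int (re_dot (delta al) (delta al)).
  rewrite -h2 h1 (_ : re_dot (- ga) al = fun p => -1 * re_dot al ga p).
    rewrite torus_intZ ?mulN1r //; apply: continuous_re_dot; exact: csmooth_form_form.
  by apply/funext => p; rewrite re_dotN re_dotC.
have g1 := Re_L2_dot_ge0 (delta al); have g2 := Re_L2_dot_ge0 be.
have z1 : torus_int (re_dot (delta al) (delta al)) = 0 by lra.
have z2 : torus_int (re_dot be be) = 0 by lra.
split; first exact: L2_dot_eq0 sd z1.
have be0 := L2_dot_eq0 (csmooth_form_form fbe) z2.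
move=> f ff; have := congr1 (@complex.Re R) (Hbe _ ff); rewrite !Re_L2_dot => ->.
rewrite (_ : re_dot f be = fun=> 0); first by rewrite [LHS]Rintegral_cst // mul0r.
apply/funext => p; rewrite re_dotE big1 ?mulr0 // => I _.
by rewrite be0 /= !mulr0 addr0.
Qed.

End HermitianProduct.

(** * Harmonic (1,0)- and (0,1)-forms *)

Section Eigenframe.
Local Open Scope complex_scope.
Variables (R : realType) (s h : R) (sh1 : s ^+ 2 + h ^+ 2 = 1).
Local Notation V := 'rV[R]_4.
Local Notation W := 'rV[R[i]]_4.
Local Notation T := (torus R 4).
Local Notation M := (hermitian_torus sh1).
Implicit Types (e : R[i]) (x : V).

(* zt e and zf e are T + e F1 and F2 + e F3. They span the T^{1,0} spaces for
   e = - i and the T^{0,1} spaces for e = i. *)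
Definition zt e x : W := \row_j nth 0 [:: 1; e * s%:C * ct x; e * s%:C * st x; e * h%:C] j.

Definition zf e x : W := \row_j nth 0 [:: 0; - st x - e * h%:C * ct x;
  ct x - e * h%:C * st x; e * s%:C] j.

Lemma shC : s%:C ^+ 2 = 1 - h%:C ^+ 2 :> R[i].
Proof.
have -> : (1 : R[i]) = (s ^+ 2 + h ^+ 2)%:C by rewrite sh1.
by rewrite rmorphD /= !rmorphXn addrK.
Qed.

Lemma cmx_torusJ x : cmx (torusJ s h (tproj x)) = \matrix_(i, j)
  nth 0 (nth [::] [:: [:: 0; s%:C * ct x; s%:C * st x; h%:C];
     [:: - (s%:C * ct x); 0; h%:C; - (s%:C * st x)];
     [:: - (s%:C * st x); - h%:C; 0; s%:C * ct x];
     [:: - h%:C; s%:C * st x; - (s%:C * ct x); 0]] i) j.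
Proof.
apply/matrixP => i j; rewrite !mxE /ct /st -(tcosE x) -(tsinE x) -!rmorphM -!rmorphN.
by case: i => [[|[|[|[|//]]]] Hi]; case: j => [[|[|[|[|//]]]] Hj].
Qed.

(** J T = F1 and J F1 = - T give J (T + e F1) = F1 - e T, which is - e (T + e F1) when e^2 = -1. The
    same holds for the pair F2, F3. *)
Lemma zt_J e x : e * e = -1 -> zt e x *m cmx (torusJ s h (tproj x)) = - e *: zt e x.
Proof.
move=> ee; rewrite cmx_torusJ.
have cs := ct2_st2 x; have sE : st x ^+ 2 = 1 - ct x ^+ 2 by rewrite -cs addrC addKr.
have ss := shC.
apply/rowP => -[[|[|[|[|//]]]] Hj]; rewrite !mxE !big_ord_recl big_ord0 !mxE /=;
  move: sE ss; generalize (ct x) (st x) => c d sE ss;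
  ring: ee sE ss.
Qed.

Lemma zf_J e x : e * e = -1 -> zf e x *m cmx (torusJ s h (tproj x)) = - e *: zf e x.
Proof.
move=> ee; rewrite cmx_torusJ.
have cs := ct2_st2 x; have sE : st x ^+ 2 = 1 - ct x ^+ 2 by rewrite -cs addrC addKr.
have ss := shC.
apply/rowP => -[[|[|[|[|//]]]] Hj]; rewrite !mxE !big_ord_recl big_ord0 !mxE /=;
  move: sE ss; generalize (ct x) (st x) => c d sE ss;
  ring: ee sE ss.
Qed.

Local Notation ii := (Complex 0 1 : R[i]).

Lemma iiM : ii * ii = -1.
Proof. by apply/eqP; rewrite eq_complex /= !mul0r mulr0 mulr1 sub0r addr0 oppr0 !eqxx. Qed.

Lemma NiiM : (- ii) * (- ii) = -1.
Proof. by rewrite mulrNN iiM. Qed.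

(** The factor (1 + i e) / 2 is 1 for e = - i and 0 for e = i. *)
Lemma eigen_proj10 e x (u : W) : u *m cmx (torusJ s h (tproj x)) = - e *: u ->
  u *m proj10 (tproj x : M) = (2^-1 * (1 + ii * e)) *: u.
Proof.
move=> uJ; rewrite /proj10 -scalemxAr mulmxBr mulmx1 -scalemxAr uJ.
by rewrite -scalerA scalerDl scale1r scalerA mulrN scaleNr opprK.
Qed.

Lemma eigen_10 x (u : W) : u *m cmx (torusJ s h (tproj x)) = - (- ii) *: u ->
  u *m proj10 (tproj x : M) = u.
Proof.
move=> /eigen_proj10 ->; rewrite mulrN iiM opprK (_ : 2^-1 * (1 + 1) = 1) ?scale1r //.
by rewrite mulVf // pnatr_eq0.
Qed.

Lemma eigen_01 x (u : W) : u *m cmx (torusJ s h (tproj x)) = - ii *: u ->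
  u *m proj10 (tproj x : M) = 0.
Proof. by move=> /eigen_proj10 ->; rewrite iiM subrr mulr0 scale0r. Qed.

Lemma zt10 x : zt (- ii) x *m proj10 (tproj x : M) = zt (- ii) x.
Proof. exact/eigen_10/zt_J/NiiM. Qed.
Lemma zf10 x : zf (- ii) x *m proj10 (tproj x : M) = zf (- ii) x.
Proof. exact/eigen_10/zf_J/NiiM. Qed.
Lemma zt01 x : zt ii x *m proj10 (tproj x : M) = 0.
Proof. exact/eigen_01/zt_J/iiM. Qed.
Lemma zf01 x : zf ii x *m proj10 (tproj x : M) = 0.
Proof. exact/eigen_01/zf_J/iiM. Qed.

End Eigenframe.

Lemma sum4 (A : nmodType) (F : 'I_4 -> A) : \sum_j F j = F ord0 + (F j1 + (F j2 + F j3)).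
Proof.
rewrite !big_ord_recl big_ord0 addr0.
by congr (_ + (F _ + (F _ + F _))); exact: val_inj.
Qed.

Lemma antisym_sum (K : comPzRingType) (u w : 'I_4 -> K) (P : 'I_4 -> 'I_4 -> K) :
  \sum_j \sum_k u j * w k * (P j k - P k j) =
  (u ord0 * w j1 - u j1 * w ord0) * (P ord0 j1 - P j1 ord0) +
  (u ord0 * w j2 - u j2 * w ord0) * (P ord0 j2 - P j2 ord0) +
  (u ord0 * w j3 - u j3 * w ord0) * (P ord0 j3 - P j3 ord0) +
  (u j1 * w j2 - u j2 * w j1) * (P j1 j2 - P j2 j1) +
  (u j1 * w j3 - u j3 * w j1) * (P j1 j3 - P j3 j1) +
  (u j2 * w j3 - u j3 * w j2) * (P j2 j3 - P j3 j2).
Proof.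
rewrite !sum4; move: (u ord0) (u j1) (u j2) (u j3) (w ord0) (w j1) (w j2) (w j3).
move: (P ord0 ord0) (P ord0 j1) (P ord0 j2) (P ord0 j3) (P j1 ord0) (P j1 j1) (P j1 j2) (P j1 j3)
  (P j2 ord0) (P j2 j1) (P j2 j2) (P j2 j3) (P j3 ord0) (P j3 j1) (P j3 j2) (P j3 j3).
by intros; ring.
Qed.

(** A variant of [eq_of_eq] for d al on a pair of frame fields, which comes out as twice the wanted
    equation. *)
Lemma eq_of_half (K : unitRingType) (l r x y : K) : l = r -> x - y = 2^-1 * (l - r) -> x = y.
Proof. by move=> -> /eqP; rewrite subrr mulr0 subr_eq0 => /eqP. Qed.

(** * 1-forms of pure type in the rotating frame *)

Section TypeForms.
Local Open Scope complex_scope.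
Variables (R : realType) (s h : R) (sh1 : s ^+ 2 + h ^+ 2 = 1).
Local Notation V := 'rV[R]_4.
Local Notation W := 'rV[R[i]]_4.
Local Notation M := (torus_manifold R 4).
Implicit Types (x : V).
Variables (al : cform M 1) (e : R[i]).
Hypotheses (fal : is_form al) (ee : e * e = -1).
Hypothesis kt : forall x, al (tproj x) (fun=> zt s h e x) = 0.
Hypothesis kf : forall x, al (tproj x) (fun=> zf s h e x) = 0.

(* al takes the values fa, e fa, fb, e fb on the frame T, F1, F2, F3. *)
Definition fa : V -> R[i] := coef al ord0.
Definition fb x : R[i] := - st x * coef al j1 x + ct x * coef al j2 x.

Lemma csmooth_fa : csmooth fa.
Proof. exact: csmooth_coef. Qed.

Lemma csmooth_fb : csmooth fb.
Proof.
apply: csmoothD; apply: csmoothM; try exact: csmooth_coef; last exact: csmooth_ct.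
rewrite (_ : (fun x => - st x) = fun x => -1 * st x).
  exact/csmoothZ/csmooth_st.
by apply/funext => x; rewrite mulN1r.
Qed.

(** The coordinate coefficients of [al] along x, y and z all have this shape, so the single
    derivative formula [pd_comb] serves for all of them. *)
Definition comb (c1 c2 c3 c4 c5 c6 : R[i]) x : R[i] :=
  c1 * (fa x * ct x) + (c2 * (fa x * st x) + (c3 * (fb x * ct x) + (c4 * (fb x * st x)
  + (c5 * fa x + c6 * fb x)))).

(** The frame is orthonormal: each coefficient is the sum over F1, F2, F3 of the coordinate of the
    field times the value e fa, fb, e fb of [al] on it. *)
Lemma coef_comb : [/\ coef al j1 = comb (e * s%:C) 0 (- e * h%:C) (-1) 0 0,
  coef al j2 = comb 0 (e * s%:C) 1 (- e * h%:C) 0 0 &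
  coef al j3 = comb 0 0 0 0 (e * h%:C) (e * s%:C)].
Proof.
have ml := form_multilinear fal; have ss := shC sh1.
have H x : [/\ coef al j1 x = comb (e * s%:C) 0 (- e * h%:C) (-1) 0 0 x,
    coef al j2 x = comb 0 (e * s%:C) 1 (- e * h%:C) 0 0 x &
    coef al j3 x = comb 0 0 0 0 (e * h%:C) (e * s%:C) x].
  have := kt x; have := kf x; rewrite !form1E // !sum4 !mxE /=.
  rewrite -!/(coef al _ x) /comb /fa /fb.
  have cs := ct2_st2 x; have sE : st x ^+ 2 = 1 - ct x ^+ 2 by rewrite -cs addrC addKr.
  move: sE; generalize (ct x) (st x) (coef al ord0 x) (coef al j1 x) (coef al j2 x) (coef al j3 x).
  clear -ee ss => c d a a1 a2 a3 sE k1 k2.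
  (* [u] computes the value of [al] on e1 and [v] the one on d_z, by undoing the rotation that takes
     these two vectors to F1 and F3; [w1] and [w2] then undo the rotation by t. *)
  have u : c * a1 + d * a2 = e * s%:C * a - e * h%:C * (- d * a1 + c * a2).
    apply/eqP; rewrite -subr_eq0; apply/eqP.
    have := congr2 +%R (congr1 ( *%R (- (e * s%:C))) k2) (congr1 ( *%R (e * h%:C)) k1).
    by rewrite !mulr0 addr0 => <-; ring: ee ss sE.
  have v : a3 = e * h%:C * a + e * s%:C * (- d * a1 + c * a2).
    apply/eqP; rewrite -subr_eq0; apply/eqP.
    have := congr2 +%R (congr1 ( *%R (- (e * h%:C))) k2) (congr1 ( *%R (- (e * s%:C))) k1).
    by rewrite !mulr0 addr0 => <-; ring: ee ss sE.
  have w1 : a1 = c * (c * a1 + d * a2) - d * (- d * a1 + c * a2) by ring: sE.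
  have w2 : a2 = d * (c * a1 + d * a2) + c * (- d * a1 + c * a2) by ring: sE.
  split.
  - rewrite {1}w1 u; ring.
  - rewrite {1}w2 u; ring.
  - rewrite {1}v; ring.
by split; apply/funext => x; have [] := H x.
Qed.

(** Smoothness travels with the derivative, so that the sum and product rules chain without side
    conditions. *)
Definition pd_is j (F F' : V -> R[i]) : Prop := csmooth F /\ forall x, pd j F x = F' x.

Lemma pd_isD j F F' G G' : pd_is j F F' -> pd_is j G G' ->
  pd_is j (fun x => F x + G x) (fun x => F' x + G' x).
Proof.
move=> [sF dF] [sG dG]; split; first exact: csmoothD.
by move=> x; rewrite [LHS]pdD // dF dG.
Qed.

Lemma pd_isM j F F' G G' : pd_is j F F' -> pd_is j G G' ->
  pd_is j (fun x => F x * G x) (fun x => F x * G' x + G x * F' x).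
Proof.
move=> [sF dF] [sG dG]; split; first exact: csmoothM.
by move=> x; rewrite [LHS]pdM // dF dG.
Qed.

Lemma pd_isZ j c F F' : pd_is j F F' -> pd_is j (fun x => c * F x) (fun x => c * F' x).
Proof.
move=> [sF dF]; split; first exact: csmoothZ.
by move=> x; rewrite [LHS]cDZ // -[cD _ F x]/(pd j F x) dF.
Qed.

Lemma pd_is_pd j F : csmooth F -> pd_is j F (pd j F).
Proof. by []. Qed.

Lemma pd_comb j c1 c2 c3 c4 c5 c6 x : pd j (comb c1 c2 c3 c4 c5 c6) x =
  c1 * (fa x * pd j (@ct R) x + ct x * pd j fa x) +
  (c2 * (fa x * pd j (@st R) x + st x * pd j fa x) +
  (c3 * (fb x * pd j (@ct R) x + ct x * pd j fb x) +
  (c4 * (fb x * pd j (@st R) x + st x * pd j fb x) +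
  (c5 * pd j fa x + c6 * pd j fb x)))).
Proof.
have da := pd_is_pd j csmooth_fa; have db := pd_is_pd j csmooth_fb.
have dc := pd_is_pd j (@csmooth_ct R); have ds := pd_is_pd j (@csmooth_st R).
exact: (pd_isD (pd_isZ c1 (pd_isM da dc)) (pd_isD (pd_isZ c2 (pd_isM da ds))
  (pd_isD (pd_isZ c3 (pd_isM db dc)) (pd_isD (pd_isZ c4 (pd_isM db ds))
  (pd_isD (pd_isZ c5 da) (pd_isZ c6 db)))))).2.
Qed.

Definition curl j k x : R[i] := pd j (coef al k) x - pd k (coef al j) x.

Lemma dext_curl x v (u w : W) : v ord0 = u -> v ord_max = w ->
  dext al (tproj x : M) v =
  (u ord0 ord0 * w ord0 j1 - u ord0 j1 * w ord0 ord0) * curl ord0 j1 x +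
  (u ord0 ord0 * w ord0 j2 - u ord0 j2 * w ord0 ord0) * curl ord0 j2 x +
  (u ord0 ord0 * w ord0 j3 - u ord0 j3 * w ord0 ord0) * curl ord0 j3 x +
  (u ord0 j1 * w ord0 j2 - u ord0 j2 * w ord0 j1) * curl j1 j2 x +
  (u ord0 j1 * w ord0 j3 - u ord0 j3 * w ord0 j1) * curl j1 j3 x +
  (u ord0 j2 * w ord0 j3 - u ord0 j3 * w ord0 j2) * curl j2 j3 x.
Proof.
move=> v0 v1; rewrite dext1E // v0 v1.
exact: (antisym_sum (fun j => u ord0 j) (fun k => w ord0 k) (fun j k => pd j (coef al k) x)).
Qed.

Lemma curlE x : [/\
  curl ord0 j1 x = e * s%:C * (fa x * - st x + ct x * pd ord0 fa x)
    - e * h%:C * (fb x * - st x + ct x * pd ord0 fb x)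
    - (fb x * ct x + st x * pd ord0 fb x) - pd j1 fa x,
  curl ord0 j2 x = e * s%:C * (fa x * ct x + st x * pd ord0 fa x)
    + (fb x * - st x + ct x * pd ord0 fb x)
    - e * h%:C * (fb x * ct x + st x * pd ord0 fb x) - pd j2 fa x &
  curl ord0 j3 x = e * h%:C * pd ord0 fa x + e * s%:C * pd ord0 fb x - pd j3 fa x] /\ [/\
  curl j1 j2 x = e * s%:C * (st x * pd j1 fa x) + ct x * pd j1 fb x - e * h%:C * (st x * pd j1 fb x)
    - (e * s%:C * (ct x * pd j2 fa x) - e * h%:C * (ct x * pd j2 fb x) - st x * pd j2 fb x),
  curl j1 j3 x = e * h%:C * pd j1 fa x + e * s%:C * pd j1 fb x
    - (e * s%:C * (ct x * pd j3 fa x) - e * h%:C * (ct x * pd j3 fb x) - st x * pd j3 fb x) &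
  curl j2 j3 x = e * h%:C * pd j2 fa x + e * s%:C * pd j2 fb x
    - (e * s%:C * (st x * pd j3 fa x) + ct x * pd j3 fb x - e * h%:C * (st x * pd j3 fb x))].
Proof.
have [E1 E2 E3] := coef_comb.
rewrite /curl E1 E2 E3 -/fa !pd_comb !pd_ct !pd_st /=.
move: (fa x) (fb x) (ct x) (st x) (pd ord0 fa x) (pd j1 fa x) (pd j2 fa x) (pd j3 fa x)
   (pd ord0 fb x) (pd j1 fb x) (pd j2 fb x) (pd j3 fb x) => *.
by split; split; ring.
Qed.

Lemma st2E x : @st R x ^+ 2 = 1 - ct x ^+ 2.
Proof. by rewrite -(ct2_st2 x) addrC addKr. Qed.

Definition pair_arg (u w : W) : 'I_2 -> W := fun i => if i == ord0 then u else w.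

Ltac expand_dext x :=
  rewrite (@dext_curl x _ _ _ (erefl _) (erefl _)); have [[-> -> ->] [-> -> ->]] := curlE x;
  rewrite !mxE /= ?vF1E ?vF2E ?vF3E /vT; move: (shC sh1) (st2E x); clear -ee;
  move: (fa x) (fb x) (ct x) (st x) (pd ord0 fa x) (pd j1 fa x) (pd j2 fa x) (pd j3 fa x)
    (pd ord0 fb x) (pd j1 fb x) (pd j2 fb x) (pd j3 fb x).

(** For e = i this pair and the next three, each a (0,1)-field followed by a (1,0)-field, determine
    the (1,1)-part of d al. The terms of order zero come from the brackets of T with F1, F2, F3. *)
Lemma pde10_tt x : dext al (tproj x : M) (pair_arg (zt s h e x) (zt s h (- e) x)) = 0 ->
  vT fa x + e * vF1 s h fa x = - (e * s%:C) * fb x.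
Proof.
expand_dext x => a b c d a0 a1 a2 a3 b0 b1 b2 b3 ss sE E.
by apply: (eq_of_half E); field: ee ss sE; rewrite ?pnatr_eq0.
Qed.

Lemma pde10_ft x : dext al (tproj x : M) (pair_arg (zf s h e x) (zt s h (- e) x)) = 0 ->
  vF2 fa x + e * vF3 s h fa x = e * s%:C / 2 * fa x.
Proof.
expand_dext x => a b c d a0 a1 a2 a3 b0 b1 b2 b3 ss sE E.
by apply: (eq_of_half E); field: ee ss sE; rewrite ?pnatr_eq0.
Qed.

Lemma pde10_tf x : dext al (tproj x : M) (pair_arg (zt s h e x) (zf s h (- e) x)) = 0 ->
  vT fb x + e * vF1 s h fb x = e * h%:C * fb x - e * s%:C / 2 * fa x.
Proof.
expand_dext x => a b c d a0 a1 a2 a3 b0 b1 b2 b3 ss sE E.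
by apply: (eq_of_half E); field: ee ss sE; rewrite ?pnatr_eq0.
Qed.

Lemma pde10_ff x : dext al (tproj x : M) (pair_arg (zf s h e x) (zf s h (- e) x)) = 0 ->
  vF2 fb x + e * vF3 s h fb x = 0.
Proof.
expand_dext x => a b c d a0 a1 a2 a3 b0 b1 b2 b3 ss sE E.
move: E.
(* The coefficients of the three spatial curls are simplified first. The terms in the derivatives of
   [fa] cancel, and [I1], [I2], [I3] match twice the terms in the x, y and z derivatives of [fb]. *)
have -> : (- d - e * h%:C * c) * (c - - e * h%:C * d) - (c - e * h%:C * d) * (- d - - e * h%:C * c)
  = - (2 * e * h%:C) by ring: ee sE.
have -> : (- d - e * h%:C * c) * (- e * s%:C) - e * s%:C * (- d - - e * h%:C * c)
  = 2 * e * s%:C * d by ring: ee.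
have -> : (c - e * h%:C * d) * (- e * s%:C) - e * s%:C * (c - - e * h%:C * d)
  = - (2 * e * s%:C * c) by ring: ee.
have I1 : 2 * (- d * b1 + e * (- h%:C * (c * b1))) =
  - (2 * e * h%:C) * (c * b1 - e * h%:C * (d * b1)) + 2 * e * s%:C * d * (e * s%:C * b1).
  by ring: ee ss sE.
have I2 : 2 * (c * b2 + e * (- h%:C * (d * b2))) =
  - (2 * e * h%:C) * (e * h%:C * (c * b2) + d * b2) - 2 * e * s%:C * c * (e * s%:C * b2).
  by ring: ee ss sE.
have I3 : 2 * (e * (s%:C * b3)) = 2 * e * s%:C * d * (e * h%:C * (c * b3) + d * b3)
  + 2 * e * s%:C * c * (c * b3 - e * h%:C * (d * b3)) by ring: ee ss sE.
move=> E; apply: (@mulfI _ 2); first by rewrite pnatr_eq0.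
rewrite mulr0 -[RHS]E.
transitivity (2 * (- d * b1 + e * (- h%:C * (c * b1))) +
  2 * (c * b2 + e * (- h%:C * (d * b2))) + 2 * (e * (s%:C * b3))); first by ring.
by rewrite I1 I2 I3; ring.
Qed.

(** Since [al] kills both fields, d al on them is minus the value of [al] on their bracket. It has
    order zero, as a component of the Nijenhuis tensor, and equals e s fa. *)
Lemma pde01_tf x : dext al (tproj x : M) (pair_arg (zt s h e x) (zf s h e x)) = 0 ->
  s%:C * fa x = 0.
Proof.
expand_dext x => a b c d a0 a1 a2 a3 b0 b1 b2 b3 ss sE E.
rewrite -[RHS](mulr0 (- e)) -E; by ring: ee ss sE.
Qed.

Lemma pde01_bar x : (forall y, fa y = 0) -> dext al (tproj x : M) (pair_arg (zt s h (- e) x) (zf s h (- e) x)) = 0 ->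
  vT fb x - e * vF1 s h fb x = e * h%:C * fb x.
Proof.
move=> a0; have {}a0 : fa = cst 0 by [apply/funext].
rewrite (@dext_curl x _ _ _ (erefl _) (erefl _)).
have [[-> -> ->] [-> -> ->]] := curlE x.
rewrite !mxE /= ?vF1E ?vF2E ?vF3E /vT; have ss := shC sh1; have := st2E x.
have pa j : pd j fa x = 0 by rewrite a0 /pd cD_cst.
rewrite !pa a0 /cst; clear -ee ss.
move: (fb x) (ct x) (st x) (pd ord0 fb x) (pd j1 fb x) (pd j2 fb x) (pd j3 fb x).
move=> b c d b0 b1 b2 b3 sE E.
by apply: (eq_of_half E); field: ee ss sE; rewrite ?pnatr_eq0.
Qed.

End TypeForms.

Section BidegreeOne.
Local Open Scope complex_scope.
Variables (R : realType) (n : nat) (M : almost_hermitian R n).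

Lemma bidegree_part_0 k (be : cform M k) p v :
  bidegree_part 0 be p v = be p (fun i => v i *m proj01 p).
Proof.
rewrite /bidegree_part (big_pred1 (finset.set0 : {set 'I_k})) => [|S]; last by rewrite cards_eq0.
by congr (be p _); apply/funext => i; rewrite inE.
Qed.

Lemma bidegree_part_full k (be : cform M k) p v :
  bidegree_part k be p v = be p (fun i => v i *m proj10 p).
Proof.
rewrite /bidegree_part (big_pred1 [set: 'I_k]%SET) => [|S].
  by congr (be p _); apply/funext => i; rewrite inE.
rewrite /= eqEcard finset.subsetT /= cardsT card_ord.
by have := max_card S; rewrite card_ord eqn_leq => ->.
Qed.

Lemma bidegree_part_sum1 (al : cform M 1) : multilinear al ->
  bidegree_part 0 al + bidegree_part 1 al = al.
Proof.
move=> ml; apply/funext => p; apply/funext => v.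
rewrite -[LHS]/(bidegree_part 0 al p v + bidegree_part 1 al p v).
rewrite bidegree_part_0 bidegree_part_full.
have D (u w : 'rV[R[i]]_n) : al p (fun=> u) + al p (fun=> w) = al p (fun=> u + w).
  rewrite !form1E // -big_split; apply: eq_bigr => j _ /=; by rewrite !mxE mulrDl.
have E (A : 'M[R[i]]_n) : (fun i => v i *m A) = fun=> v ord0 *m A.
  by apply/funext => i; rewrite (ord1 i).
transitivity (al p (fun=> v ord0 *m proj01 p) + al p (fun=> v ord0 *m proj10 p)).
  by congr (al p _ + al p _); exact: E.
rewrite (D (v ord0 *m proj01 p) (v ord0 *m proj10 p)).
rewrite -mulmxDr [proj01 p + _]addrC proj10D01 mulmx1.
by congr (al p _); apply/funext => i; rewrite (ord1 i).
Qed.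

Lemma dext_0 k : dext (0 : cform M k) = 0.
Proof.
apply/funext => p; apply/funext => v; rewrite /dext big1 // => i _.
rewrite [X in _ * X](_ : _ = 0) ?mulr0 // /cderive !derive_cst.
by apply/eqP; rewrite eq_complex /= !(mulr0, mul0r, addr0, subr0) eqxx.
Qed.

Lemma sum_ord_int (A : nmodType) (m k : nat) (F : nat -> A) :
  \sum_(s < m | s%:Z == k%:Z) F s = if (k < m)%N then F k else 0.
Proof.
case: ifP => km; last first.
  apply: big1 => t /eqP[tk]; by rewrite -tk ltn_ord in km.
by rewrite (big_pred1 (Ordinal km)).
Qed.

Lemma delbar_opE k (al : cform M k) :
  delbar_op al = \sum_(r < k.+1) bidegree_part r (dext (bidegree_part r al)).
Proof.
apply: eq_bigr => r _; rewrite addr0.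
rewrite (sum_ord_int k.+2 r (fun t => bidegree_part t (dext (bidegree_part r al)))).
by rewrite ltnS ltnW.
Qed.

(** The type r + 2 may not exceed the degree k + 1; in degree one this leaves r = 0 alone. *)
Lemma mu_opE k (al : cform M k) : mu_op al = \sum_(r < k.+1)
  if (r.+2 < k.+2)%N then bidegree_part r.+2 (dext (bidegree_part r al)) else 0.
Proof.
apply: eq_bigr => r _; rewrite -[X in X + _]/(r%:Z) -PoszD addn2.
exact: (sum_ord_int k.+2 r.+2 (fun t => bidegree_part t (dext (bidegree_part r al)))).
Qed.

Lemma delbar_op1E (al : cform M 1) : delbar_op al =
  bidegree_part 0 (dext (bidegree_part 0 al)) + bidegree_part 1 (dext (bidegree_part 1 al)).
Proof. by rewrite delbar_opE big_ord_recl big_ord1. Qed.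

Lemma mu_op1E (al : cform M 1) : mu_op al = bidegree_part 2 (dext (bidegree_part 0 al)).
Proof. by rewrite mu_opE big_ord_recl big_ord1 /= addr0. Qed.

Lemma delbar_op0E (f : cform M 0) : delbar_op f = bidegree_part 0 (dext (bidegree_part 0 f)).
Proof. by rewrite delbar_opE big_ord1. Qed.

End BidegreeOne.

Section HarmonicForms.
Local Open Scope complex_scope.
Variables (R : realType) (s h : R) (sh1 : s ^+ 2 + h ^+ 2 = 1).
Local Notation V := 'rV[R]_4.
Local Notation W := 'rV[R[i]]_4.
Local Notation T := (torus R 4).
Local Notation M := (hermitian_torus sh1).
Local Notation vol := (hermitian_volume sh1).
Local Notation ii := (Complex 0 1 : R[i]).
Implicit Types (x : V).

Lemma csmooth_proj (x0 : 'I_1) (b : bool) (w : W) (j : 'I_4) : csmooth (fun x : V =>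
  (w *m (if b then proj10 (tproj x : M) else proj01 (tproj x : M))) x0 j).
Proof.
have sJ l : csmooth (fun x : V => ii * (torusJ s h (tproj x) l j)%:C).
  exact/csmoothZ/csmooth_real/smooth_torusJ.
rewrite (_ : (fun _ => _) = fun x : V => \sum_l w x0 l *
    (2^-1 * ((1%:M : 'M[R[i]]_4) l j + (if b then -1 else 1) * (ii * (torusJ s h (tproj x) l j)%:C)))).
  apply: csmooth_sum => l; apply/csmoothZ/csmoothZ.
  exact: csmoothD (csmooth_cst _ _) (csmoothZ _ (sJ l)).
apply/funext => x; rewrite mxE; apply: eq_bigr => l _; congr (_ * _).
by case: b; rewrite !mxE ?mulN1r ?mul1r.
Qed.

(** Supplies the smoothness of delta al that [harmonic1_closed] demands, for both delbar and mu. *)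
Lemma csmooth_bidegree_dext r (al : cform M 1) : is_form al ->
  csmooth_form (bidegree_part r (dext al) : cform M 2).
Proof.
move=> fal v.
pose P x (S : {set 'I_2}) i := v i *m (if i \in S then proj10 (tproj x : M) else proj01 (tproj x : M)).
rewrite (_ : (fun x : V => _) = fun x : V => \sum_(S : {set 'I_2} | #|S| == r) \sum_j \sum_k
  P x S ord0 ord0 j * P x S ord_max ord0 k *
  (cD (delta_mx ord0 j) (coef al k) x - cD (delta_mx ord0 k) (coef al j) x)).
  apply: csmooth_sum => S; apply: csmooth_sum => j; apply: csmooth_sum => k.
  apply: csmoothM; first by apply: csmoothM; exact: csmooth_proj.
  rewrite (_ : (fun x : V => _ - _) = fun x => cD (delta_mx ord0 j) (coef al k) x +
    -1 * cD (delta_mx ord0 k) (coef al j) x); last by apply/funext => x; rewrite mulN1r.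
  by apply: csmoothD; first apply: csmooth_cD; last apply/csmoothZ/csmooth_cD; exact: csmooth_coef.
by apply/funext => x; apply: eq_bigr => S _; rewrite (dext1E _ _ fal).
Qed.

Lemma bidegree_dext_eq0 r (al : cform M 1) : is_form al ->
  (forall p I, bidegree_part r (dext al) p (basis_arg R I) = 0) ->
  forall p v, bidegree_part r (dext al) p v = 0.
Proof.
move=> fal h0 p; apply: multilinear_eq0 => [|I]; last exact: h0.
by apply: multilinear_bidegree_part; exact: multilinear_dext1.
Qed.

Lemma dext_eigen_eq0 (al : cform M 1) r (S : {set 'I_2}) x (u w : W) : is_form al ->
  (forall p v, bidegree_part r (dext al) p v = 0) -> #|S| == r ->
  u *m proj10 (tproj x : M) = (if ord0 \in S then u else 0) ->
  w *m proj10 (tproj x : M) = (if ord_max \in S then w else 0) ->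
  dext al (tproj x : M) (pair_arg u w) = 0.
Proof.
move=> fal h0 Sr hu hw.
have ml : multilinear (dext al) := multilinear_dext1 fal.
have := @bidegree_part_eigen _ _ M 2 r (dext al) (tproj x) (pair_arg u w) S ml.
rewrite h0 Sr => <- // i; rewrite /pair_arg.
by have [->|->] := ord2_cases i; [exact: hu|exact: hw].
Qed.

Lemma coef_eq0 (al : cform M 1) e : is_form al -> e * e = -1 ->
  (forall x, al (tproj x) (fun=> zt s h e x) = 0) ->
  (forall x, al (tproj x) (fun=> zf s h e x) = 0) ->
  (forall x, fa al x = 0) -> (forall x, fb al x = 0) -> al = 0.
Proof.
move=> fal ee kt kf a0 b0.
have [E1 E2 E3] := coef_comb sh1 fal ee kt kf.
have c0 j x : coef al j x = 0.
  have ce c1 c2 c3 c4 c5 c6 : comb al c1 c2 c3 c4 c5 c6 x = 0.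
    by rewrite /comb a0 b0 !(mul0r, mulr0, addr0).
  case: j => [[|[|[|[|//]]]] Hj].
  - by rewrite (_ : Ordinal Hj = ord0) //; [exact: a0|exact: val_inj].
  - by rewrite (_ : Ordinal Hj = j1) ?E1 //; exact: val_inj.
  - by rewrite (_ : Ordinal Hj = j2) ?E2 //; exact: val_inj.
  - by rewrite (_ : Ordinal Hj = j3) ?E3 //; exact: val_inj.
apply/funext => p; apply/funext => v; rewrite form1E; last exact: form_multilinear.
rewrite big1 // => j _; rewrite -(tliftK p).
by rewrite -[al _ _]/(coef al j (tlift p)) c0 mulr0.
Qed.

Hypotheses (s0 : s != 0) (hs : h ^+ 2 != 2 * s ^+ 2).

Lemma harmonic10_eq0 (al : cform M 1) : @Defs.harmonic R 4 M vol (@delbar_op R 4 M) 1 0 al -> al = 0.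
Proof.
move=> [fal bal lap]; have ml := form_multilinear fal.
have b0 : bidegree_part 0 al = 0.
  have e := @bidegree_part_sum1 _ _ M al ml; rewrite bal in e.
  by apply: (addIr al); rewrite e add0r.
have dE : delbar_op al = bidegree_part 1 (dext al).
  by rewrite delbar_op1E b0 dext_0 bidegree_part0 add0r bal.
have sd : csmooth_form (delbar_op al) by rewrite dE; exact: csmooth_bidegree_dext.
have [dz _] := harmonic1_closed fal sd lap; rewrite dE in dz.
have {}dz := bidegree_dext_eq0 fal dz.
have kill x (u : W) : u *m proj10 (tproj x : M) = 0 -> al (tproj x) (fun=> u) = 0.
  move=> u0; rewrite -bal.
  have := @bidegree_part_eigen _ _ M 1 1 al (tproj x) (fun=> u) finset.set0 ml.
  by rewrite cards0 => -> // i; rewrite inE.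
have kt x := kill x _ (zt01 sh1 x); have kf x := kill x _ (zf01 sh1 x).
have z S x u w := @dext_eigen_eq0 al 1 S x u w fal dz.
(* The pairs below carry their (1,0)-field in second place, so the marked set is the last index. *)
have S1 : #|[set (ord_max : 'I_2)]%SET| == 1%N by rewrite cards1.
have m1 : (ord0 : 'I_2) \in [set (ord_max : 'I_2)]%SET = false by rewrite inE.
have m2 : (ord_max : 'I_2) \in [set (ord_max : 'I_2)]%SET = true by rewrite inE.
have {}z x u w : u *m proj10 (tproj x : M) = 0 -> w *m proj10 (tproj x : M) = w ->
    dext al (tproj x : M) (pair_arg u w) = 0.
  by move=> u0 w0; apply: (z _ _ _ _ S1); rewrite ?m1 ?m2.
have iic := iiM R.
have [] : (forall x, fa al x = 0) /\ (forall x, fb al x = 0); last exact: coef_eq0 kt kf.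
suff H x : fa al x = 0 /\ fb al x = 0 by split=> x; case: (H x).
have C0 (a : R) : a != 0 -> a%:C != 0 :> R[i] by rewrite eq_complex /= eqxx andbT.
apply: (rigidity10 (structure_frame sh1) iic (csmooth_fa fal) (csmooth_fb fal) (C0 _ s0)).
- have -> : 2 * s%:C ^+ 2 = (2 * s ^+ 2)%:C :> R[i] by rewrite rmorphM rmorphXn /= rmorph_nat.
  by rewrite -rmorphXn /= eq_complex /= eqxx andbT.
- by move=> y; apply: (pde10_tt sh1 fal iic kt kf); apply: z; [exact: zt01|exact: zt10].
- by move=> y; apply: (pde10_ft sh1 fal iic kt kf); apply: z; [exact: zf01|exact: zt10].
- by move=> y; apply: (pde10_tf sh1 fal iic kt kf); apply: z; [exact: zt01|exact: zf10].
- by move=> y; apply: (pde10_ff sh1 fal iic kt kf); apply: z; [exact: zf01|exact: zf10].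
Qed.

End HarmonicForms.

(** * The divergence of a coclosed (0,1)-form *)

Section Coclosed.
Local Open Scope complex_scope.
Variables (R : realType) (s h : R) (sh1 : s ^+ 2 + h ^+ 2 = 1).
Local Notation V := 'rV[R]_4.
Local Notation W := 'rV[R[i]]_4.
Local Notation T := (torus R 4).
Local Notation M := (hermitian_torus sh1).
Local Notation vol := (hermitian_volume sh1).
Local Notation ii := (Complex 0 1 : R[i]).
Implicit Types (x : V).

Lemma form_dot1 (al be : cform M 1) p : form_dot al be p =
  \sum_j al p (fun=> delta_mx ord0 j) * conjc (be p (fun=> delta_mx ord0 j)).
Proof.
rewrite torus_form_dot [X in X^-1](_ : _ = 1) ?invr1 ?mul1r; last by rewrite factS fact0.
rewrite (reindex (fun j : 'I_4 => [ffun=> j] : {ffun 'I_1 -> 'I_4})) /=; last first.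
  exists (fun I : {ffun 'I_1 -> 'I_4} => I ord0) => [j _|I _]; first by rewrite ffunE.
  by apply/ffunP => k; rewrite ffunE (ord1 k).
apply: eq_bigr => j _.
have -> : basis_arg R ([ffun=> j] : {ffun 'I_1 -> 'I_4}) = fun=> delta_mx ord0 j; last by [].
by apply/funext => k; rewrite /basis_arg ffunE.
Qed.

Lemma conj_sum (F : 'I_4 -> R[i]) : conjc (\sum_j F j) = \sum_j conjc (F j).
Proof. exact: rmorph_sum. Qed.

Lemma cD_conj (F : V -> R[i]) v x : csmooth F ->
  cD v (fun y => conjc (F y)) x = conjc (cD v F x).
Proof.
move=> [sr si]; have E : (fun y => conjc (F y)) =
    fun y => complex.Re (F y) +i* (- complex.Im (F y)).
  by apply/funext => y; case: (F y).
rewrite E /cD /=; congr (_ +i* _); rewrite deriveN //; exact: smooth_derivable.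
Qed.

Lemma cD_tproj (F : V -> R[i]) v : (forall x y : V, tproj x = tproj y -> F x = F y) ->
  forall x y : V, tproj x = tproj y -> cD v F x = cD v F y.
Proof.
by move=> pF x y xy; apply: cD_periodic => z; apply: pF; exact: tproj_addl.
Qed.

Lemma torus_int_pd (F : V -> R[i]) k : csmooth F ->
  (forall x y : V, tproj x = tproj y -> F x = F y) ->
  torus_int (fun p : T => complex.Re (pd k F (tlift p))) = 0.
Proof.
move=> [sr si] pF.
have E : (fun x : V => complex.Re (F (tlift (tproj x)))) = fun x => complex.Re (F x).
  by apply/funext => x; rewrite (torus_fun_lift pF).
apply: (@torus_int_derive _ (fun p => complex.Re (F (tlift p))) _ k); rewrite E //.
by move=> x; rewrite /pd (torus_fun_lift (cD_tproj (delta_mx ord0 k) pF)).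
Qed.

Lemma delbar_fun_form (P : V -> R[i]) x v : csmooth P ->
  (forall x y : V, tproj x = tproj y -> P x = P y) ->
  delbar_op (fun_form P : cform M 0) (tproj x : M) v =
  along (v ord0 *m proj01 (tproj x : M)) P x.
Proof.
move=> sP pP; have b0 : bidegree_part 0 (fun_form P : cform M 0) = fun_form P.
  by apply/funext => p; apply/funext => w; rewrite bidegree_part_0.
rewrite delbar_op0E b0 bidegree_part_0 (dext0E _ _ (is_form_fun_form sP pP)).
have fE : (fun y : V => fun_form P (tproj y : T) (@no_arg R 4)) = P.
  by apply/funext => y; exact: torus_fun_lift.
exact: (congr1 (fun F => along (v ord0 *m proj01 (tproj x : M)) F x) fE).
Qed.

(** J is skew for the identity metric, so [proj01] is a Hermitian matrix. *)
Lemma conj_proj01 (p : M) j k : conjc (proj01 p j k) = proj01 p k j.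
Proof.
have Jt : torusJ s h p j k = - torusJ s h p k j.
  by have /matrixP/(_ k j) := quaternion_mx_tr (s * tcos (p : T) ord0) (s * tsin (p : T) ord0) h;
    rewrite !mxE => ->.
have E a b : proj01 p a b =
    2^-1 * ((1%:M : 'M[R[i]]_4) a b + ii * (torusJ s h p a b)%:C) by rewrite !mxE.
have h2 : (2^-1 : R[i]) = (2^-1 : R)%:C by rewrite fmorphV rmorph_nat.
have d a b : (1%:M : 'M[R[i]]_4) a b = ((a == b)%:R : R)%:C by rewrite mxE rmorph_nat.
rewrite !E Jt h2 !d (eq_sym k j).
by apply/eqP; rewrite eq_complex; apply/andP; split; apply/eqP => /=; ring.
Qed.

Variable al : cform M 1.
Hypotheses (fal : is_form al) (bal : bidegree_part 0 al = al).

(** The Hermitian projector moves from dP to [al], which it fixes; hence delbar P and dP have the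
    same product with [al]. *)
Lemma form_dot_delbar (P : V -> R[i]) x : csmooth P ->
  (forall x y : V, tproj x = tproj y -> P x = P y) ->
  form_dot (delbar_op (fun_form P : cform M 0)) al (tproj x : M) =
  \sum_k pd k P x * conjc (coef al k x).
Proof.
move=> sP pP; rewrite form_dot1.
transitivity (\sum_j \sum_k proj01 (tproj x : M) j k * pd k P x * conjc (coef al j x)).
  apply: eq_bigr => j _; rewrite delbar_fun_form // -mulr_suml; congr (_ * _).
  apply: eq_bigr => k _; congr (_ * _).
  by rewrite -rowE mxE.
rewrite exchange_big; apply: eq_bigr => k _ /=.
have -> : coef al k x = \sum_j proj01 (tproj x : M) k j * coef al j x.
  rewrite /coef -{1}bal bidegree_part_0 form1E; last exact: form_multilinear.
  by apply: eq_bigr => j _; rewrite -rowE mxE.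
have conjM (a b : R[i]) : conjc (a * b) = conjc a * conjc b by exact: rmorphM.
rewrite conj_sum mulr_sumr; apply: eq_bigr => j _.
rewrite conjM conj_proj01; ring.
Qed.

Hypothesis coclosed : forall f : cform M 0, is_form f ->
  torus_int (re_dot (delbar_op f) al) = 0.

(** For a (0,1)-form, delbar^* al is minus the divergence. Testing coclosedness on the divergence
    [P] itself and integrating by parts leaves minus the squared norm of [P]. *)
Lemma coclosed_div x : \sum_k pd k (coef al k) x = 0.
Proof.
pose P x := \sum_k pd k (coef al k) x.
have sA k : csmooth (coef al k) by exact: csmooth_coef.
have sP : csmooth P by apply: csmooth_sum => k; exact: csmooth_pd.
have pA k x1 x2 : tproj x1 = tproj x2 -> coef al k x1 = coef al k x2.
  by rewrite /coef => ->.
have pP (x1 x2 : V) : tproj x1 = tproj x2 -> P x1 = P x2.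
  by move=> e; apply: eq_bigr => k _; exact: (cD_tproj _ (pA k) e).
pose G k x := P x * conjc (coef al k x).
have sG k : csmooth (G k) by apply: csmoothM => //; exact: csmooth_conj.
have pG k (x1 x2 : V) : tproj x1 = tproj x2 -> G k x1 = G k x2.
  by move=> e; rewrite /G (pP _ _ e) (pA k _ _ e).
have GE k y : pd k (G k) y = pd k P y * conjc (coef al k y) + P y * conjc (pd k (coef al k) y).
  rewrite [LHS]pdM //; last exact: csmooth_conj.
  by rewrite [pd k (fun _ => _) y]cD_conj // addrC mulrC.
pose q (p : T) : R := complex.Re (P (tlift p) * conjc (P (tlift p))).
have dotE : re_dot (delbar_op (fun_form P : cform M 0)) al = fun p : T =>
    complex.Re (pd ord0 (G ord0) (tlift p)) + (complex.Re (pd j1 (G j1) (tlift p)) +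
    (complex.Re (pd j2 (G j2) (tlift p)) + (complex.Re (pd j3 (G j3) (tlift p)) + -1 * q p))).
  apply/funext => p; rewrite /re_dot -{1}(tliftK p) form_dot_delbar //.
  set y := tlift p.
  have -> : \sum_k pd k P y * conjc (coef al k y) =
      \sum_k pd k (G k) y - P y * conjc (P y).
    rewrite {3}/P conj_sum mulr_sumr -sumrB; apply: eq_bigr => k _.
    by rewrite GE addrK.
  have ReB (a b : R[i]) : complex.Re (a - b) = complex.Re a + -1 * complex.Re b.
    by rewrite mulN1r; case: a b => ? ? [? ?].
  by rewrite ReB sum4 !Re_add !addrA.
have cont (F : V -> R[i]) : csmooth F -> (forall x1 x2 : V, tproj x1 = tproj x2 -> F x1 = F x2) ->
    continuous (fun p : T => complex.Re (F (tlift p))).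
  move=> [sr _] pF; apply: torus_continuous => y.
  rewrite (_ : (fun y : V => _) = fun y => complex.Re (F y)); first exact: smooth_continuous.
  by apply/funext => z; rewrite (torus_fun_lift pF).
have cg k : continuous (fun p : T => complex.Re (pd k (G k) (tlift p))).
  by apply: cont; [exact: csmooth_pd|exact: (cD_tproj _ (pG k))].
have cq : continuous q.
  apply: (cont (fun y => P y * conjc (P y))); first by apply: csmoothM => //; exact: csmooth_conj.
  by move=> x1 x2 e; rewrite (pP _ _ e).
have cD (f g : T -> R) : continuous f -> continuous g -> continuous (fun p => f p + g p).
  by move=> cf cg' p; exact: (continuousD (cf p) (cg' p)).
have cq' : continuous (fun p => -1 * q p).
  move=> p; have k : {for p, continuous (fun=> (-1 : R))} by exact: cst_continuous.
  exact: (continuousM k (cq p)).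
have := coclosed (is_form_fun_form sP pP).
have c3 := cD _ _ (cg j3) cq'; have c2 := cD _ _ (cg j2) c3; have c1 := cD _ _ (cg j1) c2.
rewrite dotE (torus_intD (cg ord0) c1) (torus_intD (cg j1) c2) (torus_intD (cg j2) c3).
rewrite (torus_intD (cg j3) cq') (torus_intZ _ cq) mulN1r.
have z k : torus_int (fun p : T => complex.Re (pd k (G k) (tlift p))) = 0.
  by apply: torus_int_pd; [exact: sG|exact: pG].
rewrite (z ord0) (z j1) (z j2) (z j3) !add0r => /eqP.
rewrite oppr_eq0 => /eqP q0.
have q_ge0 p : 0 <= q p.
  by rewrite /q; case: (P _) => a b /=; rewrite mulrN opprK -!expr2 addr_ge0 ?sqr_ge0.
have := torus_int_eq0 cq q_ge0 q0 (tproj x).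
rewrite /q -[X in _ -> X]/(P x = 0) -(torus_fun_lift pP x).
case: (P _) => a b /=; rewrite mulrN opprK -!expr2 => /eqP.
by rewrite paddr_eq0 ?sqr_ge0 // !sqrf_eq0 => /andP[/eqP -> /eqP ->].
Qed.

End Coclosed.

Section Rotation.
Local Open Scope complex_scope.
Variables (R : realType) (h : R).
Local Notation V := 'rV[R]_4.
Local Notation ii := (Complex 0 1 : R[i]).
Local Notation e0 := (delta_mx ord0 ord0 : V).

(* The left side is the real part of (u + i v) e^{i h t}. *)
Lemma rotation_const (u v : V -> R) (x : V) : smooth u -> smooth v ->
  (forall y, 'D_e0 u y = h * v y) -> (forall y, 'D_e0 v y = - h * u y) ->
  forall t : R, u (x + t *: e0) * cos (h * (x ord0 ord0 + t)) - v (x + t *: e0) * sin (h * (x ord0 ord0 + t)) =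
    u x * cos (h * x ord0 ord0) - v x * sin (h * x ord0 ord0).
Proof.
move=> su sv du dv t.
pose f (y : V) : R := u y * cos (h * y ord0 ord0) - v y * sin (h * y ord0 ord0).
have e00 : e0 ord0 ord0 = 1 by rewrite mxE !eqxx.
have fd y : is_derive y e0 f 0.
  have Du : is_derive y e0 u (h * v y) by rewrite -du; apply: DeriveDef => //; exact: smooth_derivable.
  have Dv : is_derive y e0 v (- h * u y) by rewrite -dv; apply: DeriveDef => //; exact: smooth_derivable.
  have Dh (r : R) : is_derive r 1 (fun r : R => h * r) h.
    have := is_deriveZ h (is_derive_id r 1); rewrite /GRing.scale /= mulr1; exact.
  have Ch (r : R) : is_derive r 1 (fun r : R => cos (h * r)) (- sin (h * r) * h).
    have k := @is_derive1_comp R (@cos R) (fun r => h * r) r _ _ (is_derive_cos _) (Dh r).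
    exact: k.
  have Sh (r : R) : is_derive r 1 (fun r : R => sin (h * r)) (cos (h * r) * h).
    have k := @is_derive1_comp R (@sin R) (fun r => h * r) r _ _ (is_derive_sin _) (Dh r).
    exact: k.
  have Dc : is_derive y e0 (fun y : V => cos (h * y ord0 ord0))
      (- sin (h * y ord0 ord0) * h * e0 ord0 ord0).
    exact: (is_derive_comp_coord e0 (Ch _)).
  have Ds : is_derive y e0 (fun y : V => sin (h * y ord0 ord0))
      (cos (h * y ord0 ord0) * h * e0 ord0 ord0).
    exact: (is_derive_comp_coord e0 (Sh _)).
  rewrite e00 in Dc Ds.
  set C := cos (h * y ord0 ord0) in Ds; set S := sin (h * y ord0 ord0) in Dc.
  have D : is_derive y e0 f ((u y * (- S * h * 1) + C * (h * v y)) -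
    (v y * (C * h * 1) + S * (- h * u y))).
    exact: is_deriveB (is_deriveM Du Dc) (is_deriveM Dv Ds).
  by move: D; rewrite (_ : _ - _ = 0 :> R) //; ring.
have [z _] := @MVT_line R V f x e0 t (fun y => @ex_derive _ _ _ _ _ _ _ (fd y)).
rewrite (@derive_val _ _ _ _ _ _ _ (fd _)) mulr0 => /eqP.
by rewrite subr_eq0 /f => /eqP; rewrite !mxE !eqxx mulr1.
Qed.

(** The product b e^{i h t} is constant along t-lines. After one period [b] returns while the
    exponential gains the factor e^{2 pi i h}, which differs from 1. *)
Lemma rotation_periodic_eq0 (b : V -> R[i]) : csmooth b -> cos (h * (pi *+ 2)) != 1 ->
  (forall x y : V, tproj x = tproj y -> b x = b y) ->
  (forall x, pd ord0 b x = - (ii * h%:C) * b x) -> forall x, b x = 0.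
Proof.
move=> [sr si] c1 pb db x.
set u := (fun x => complex.Re (b x)) in sr; set v := (fun x => complex.Im (b x)) in si.
have du y : 'D_e0 u y = h * v y.
  by have := congr1 (@complex.Re R) (db y); rewrite /v; case: (b y) => c d /= ->; ring.
have dv y : 'D_e0 v y = - h * u y.
  by have := congr1 (@complex.Im R) (db y); rewrite /u; case: (b y) => c d /= ->; ring.
have pe : b (x + (pi *+ 2) *: e0) = b x.
  by apply/pb/tproj_periodic => i; rewrite !mxE eqxx /=; case: (i == ord0);
    [right; rewrite mulr1|left; rewrite mulr0 addr0].
(* The pair (- v, u) represents i b and satisfies the same system; it gives the imaginary part of
   the conservation law. *)
have dnv y : 'D_e0 (fun x => - v x) y = h * u y.
  rewrite deriveN; [by rewrite dv mulNr opprK|exact: smooth_derivable].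
have dnu y : 'D_e0 u y = - h * (- v y) by rewrite du mulrNN.
have := rotation_const x sr si du dv (pi *+ 2).
have := rotation_const x (smoothN si) sr dnv dnu (pi *+ 2).
rewrite /u /v pe mulrDr cosD sinD; move: c1 (cos2Dsin2 (h * x ord0 ord0)).
move: (cos (h * x ord0 ord0)) (sin (h * x ord0 ord0)) (cos (h * (pi *+ 2))) (sin (h * (pi *+ 2))).
case: (b x) => c d /= C S K L K1 CS E2 E1.
have z : c ^+ 2 + d ^+ 2 = 0.
  have K0 : K - 1 != 0 by rewrite subr_eq0.
  have SE : S ^+ 2 = 1 - C ^+ 2 by rewrite -CS addrC addKr.
  apply: (mulfI K0); rewrite mulr0.
  have -> : c ^+ 2 + d ^+ 2 = (c * C - d * S) ^+ 2 + (c * S + d * C) ^+ 2 by ring: SE.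
  (* With X + i Y = b e^{i h t}, the equations [e1] and [e2] are the real and imaginary parts of (K
     + i L - 1) (X + i Y) = 0. Adding X times the first and Y times the second cancels L. *)
  have e1 : (K - 1) * (c * C - d * S) = L * (c * S + d * C).
    by apply/eqP; rewrite -subr_eq0; apply/eqP; move/eqP: E1; rewrite -subr_eq0 => /eqP <-; ring.
  have e2 : (K - 1) * (c * S + d * C) = - L * (c * C - d * S).
    by apply/eqP; rewrite -subr_eq0 -oppr_eq0; apply/eqP; move/eqP: E2; rewrite -subr_eq0 => /eqP <-; ring.
  by rewrite mulrDr !expr2 !mulrA e1 e2; ring.
move/eqP: z; rewrite paddr_eq0 ?sqr_ge0 // !sqrf_eq0 => /andP[/eqP -> /eqP ->].
by [].
Qed.
End Rotation.

Section Harmonic01.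
Local Open Scope complex_scope.
Variables (R : realType) (s h : R) (sh1 : s ^+ 2 + h ^+ 2 = 1).
Local Notation V := 'rV[R]_4.
Local Notation W := 'rV[R[i]]_4.
Local Notation T := (torus R 4).
Local Notation M := (hermitian_torus sh1).
Local Notation vol := (hermitian_volume sh1).
Local Notation ii := (Complex 0 1 : R[i]).
Implicit Types (x : V).

Hypotheses (s0 : s != 0) (hc : cos (h * (pi *+ 2)) != 1).

Lemma harmonic01_eq0 (al : cform M 1) : @Defs.harmonic R 4 M vol (@delbar_op R 4 M) 0 1 al ->
  @Defs.harmonic R 4 M vol (@mu_op R 4 M) 0 1 al -> al = 0.
Proof.
move=> [fal bal lapd] [_ _ lapm]; have ml := form_multilinear fal.
have b1 : bidegree_part 1 al = 0.
  have e := @bidegree_part_sum1 _ _ M al ml; rewrite bal in e.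
  by apply: (addrI al); rewrite e addr0.
have dE : delbar_op al = bidegree_part 0 (dext al).
  by rewrite delbar_op1E b1 dext_0 bidegree_part0 addr0 bal.
have mE : mu_op al = bidegree_part 2 (dext al) by rewrite mu_op1E bal.
have sd : csmooth_form (delbar_op al) by rewrite dE; exact: csmooth_bidegree_dext.
have sm : csmooth_form (mu_op al) by rewrite mE; exact: csmooth_bidegree_dext.
have [dz coclosed] := harmonic1_closed fal sd lapd; rewrite dE in dz.
have {}dz := bidegree_dext_eq0 fal dz.
have [mz _] := harmonic1_closed fal sm lapm; rewrite mE in mz.
have {}mz := bidegree_dext_eq0 fal mz.
have kill x (u : W) : u *m proj10 (tproj x : M) = u -> al (tproj x) (fun=> u) = 0.
  move=> u0; rewrite -bal.
  have := @bidegree_part_eigen _ _ M 1 0 al (tproj x) (fun=> u) [set: 'I_1]%SET ml.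
  by rewrite cardsT card_ord => -> // i; rewrite inE.
have kt x := kill x _ (zt10 sh1 x); have kf x := kill x _ (zf10 sh1 x).
have ee := NiiM R.
(* The (2,0)-part of d al is mu al; it gives the first coefficient without any derivative. *)
have a0 x : fa al x = 0.
  have z : dext al (tproj x : M) (pair_arg (zt s h (- ii) x) (zf s h (- ii) x)) = 0.
    apply: (@dext_eigen_eq0 _ _ _ sh1 al 2 [set: 'I_2]%SET x _ _ fal mz); rewrite ?inE.
    - by rewrite cardsT card_ord.
    - exact: zt10.
    - exact: zf10.
  have /eqP := pde01_tf sh1 fal ee kt kf z; rewrite mulf_eq0 => /orP[|/eqP //].
  by rewrite eq_complex /= eqxx andbT (negbTE s0).
have bb x : vT (fb al) x + ii * vF1 s h (fb al) x = - (ii * h%:C) * fb al x.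
  have z : dext al (tproj x : M) (pair_arg (zt s h (- - ii) x) (zf s h (- - ii) x)) = 0.
    rewrite opprK.
    apply: (@dext_eigen_eq0 _ _ _ sh1 al 0 finset.set0 x _ _ fal dz); rewrite ?inE.
    - by rewrite cards0.
    - exact: zt01.
    - exact: zf01.
  by have := pde01_bar sh1 fal ee kt kf a0 z; rewrite !mulNr opprK.
have [E1 E2 E3] := coef_comb sh1 fal ee kt kf.
have fa0 : fa al = cst 0 by apply/funext.
(* The frame fields are divergence free, so with [fa] = 0 the divergence of [al] is F2 fb + e F3 fb
   for e = - i. *)
have div x : vF2 (fb al) x - ii * vF3 s h (fb al) x = 0.
  rewrite -[RHS](coclosed_div fal bal coclosed x) sum4 E1 E2 E3 !pd_comb //.
  have -> : coef al ord0 = cst 0 by [].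
  have pa j : pd j (fa al) x = 0 by rewrite fa0 /pd cD_cst.
  have pc j : pd j (cst 0 : V -> R[i]) x = 0 by rewrite /pd cD_cst.
  rewrite !pa !pc a0 !pd_ct !pd_st vF2E vF3E /=.
  by move: (fb al x) (ct x) (st x) (pd j1 _ x) (pd j2 _ x) (pd j3 _ x) => *; ring.
have s0C : s%:C != 0 :> R[i] by rewrite eq_complex /= eqxx andbT.
have H := rigidity01 (structure_frame sh1) (iiM R) (csmooth_fb fal) s0C bb div.
suff b0 x : fb al x = 0 by exact: coef_eq0 fal ee kt kf a0 b0.
apply: (rotation_periodic_eq0 (csmooth_fb fal) hc) => [y z yz|y]; last by have [] := H y.
by rewrite /fb /coef /ct /st -!tcosE -!tsinE yz.
Qed.

End Harmonic01.

(** * The first Betti number *)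

Section Poincare.
Variables (R : realType) (n : nat).
Local Notation V := 'rV[R]_n.
Local Notation mu := (@lebesgue_measure R).

Lemma bounded_on_box (f : V -> R) (m : R) : continuous f ->
  exists B : R, forall y : V, (forall i, `|y ord0 i| <= m) -> `|f y| <= B.
Proof.
move=> cf; pose K := [set y : V | forall i, `[- m, m]%classic (y ord0 i)].
have cK : compact K.
  by apply: (@rV_compact _ n (fun _ => `[- m, m]%classic)) => i; exact: segment_compact.
have /compact_bounded[B [_ HB]] := continuous_compact (continuous_subspaceT cf) cK.
exists (B + 1) => y ym; apply: HB; first by rewrite ltrDl.
by exists y => // i; rewrite /= in_itv /= -ler_norml.
Qed.

Variable G : 'I_n -> V -> R.
Hypothesis sG : forall k, smooth (G k).
Hypothesis closedG : forall j k x,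
  'D_(delta_mx ord0 j) (G k) x = 'D_(delta_mx ord0 k) (G j) x.

(** The Poincaré primitive: the integral of the 1-form with coefficients [G] along the segment from
    0 to [x]. *)
Definition primitive (x : V) : R :=
  (\int[mu]_(t in `[0%R, 1%R]) (\sum_j x ord0 j * G j ((t : R) *: x)))%R.

Variables x v : V.

Let K (r t : R) : R := \sum_j (x ord0 j + r * v ord0 j) * G j (t *: (x + r *: v)).
Let dK (r t : R) : R := \sum_j (v ord0 j * G j (t *: (x + r *: v)) +
  (x ord0 j + r * v ord0 j) * (t * 'D_v (G j) (t *: (x + r *: v)))).

Let K_derive (r t : R) : is_derive r 1 (fun q : R => K q t : R) (dK r t).
Proof.
have E : (fun q : R => K q t : R) = \sum_j (fun r : R => (x ord0 j + r * v ord0 j) * G j (t *: (x + r *: v))).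
  by apply/funext => q; rewrite /K fct_sumE.
rewrite E; apply: is_derive_sum => j.
have d1 : is_derive r 1 (fun r : R => x ord0 j + r * v ord0 j) (v ord0 j).
  have d := is_deriveD (is_derive_cst (x ord0 j) r 1) (is_deriveZ (v ord0 j) (is_derive_id r 1)).
  rewrite /GRing.scale /= mulr1 add0r in d.
  by rewrite (_ : (fun r : R => _) = cst (x ord0 j) + v ord0 j \*: id) //;
    apply/funext => q /=; rewrite /GRing.scale /= mulrC.
have d2 : is_derive r 1 (fun r : R => G j (t *: (x + r *: v))) (t * 'D_v (G j) (t *: (x + r *: v))).
  have F : (fun r : R => G j (t *: (x + r *: v))) = fun r : R => G j (t *: x + r *: (t *: v)).
    by apply/funext => q; rewrite scalerDr !scalerA mulrC.
  have -> : t *: (x + r *: v) = t *: x + r *: (t *: v) by rewrite scalerDr !scalerA mulrC.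
  rewrite F -smooth_derive_scale //; apply: is_derive_line; exact: smooth_derivable.
have d := is_deriveM d1 d2; rewrite /GRing.scale /= in d.
by move: d; rewrite addrC [G j _ * _]mulrC.
Qed.

Let line_continuous (f : V -> R) (y : V) : continuous f -> continuous (fun t : R => f (t *: y)).
Proof.
move=> cf t; apply: (@continuous_comp _ _ _ (fun t : R => t *: y) f); last exact: cf.
exact: scalel_continuous.
Qed.

Let sum_continuous (F : 'I_n -> R -> R) : (forall j, continuous (F j)) ->
  continuous (fun t => \sum_j F j t).
Proof.
move=> cF; elim: (index_enum _) => [|j r IH] t.
  by rewrite (_ : (fun _ => _) = cst 0); [exact: cst_continuous|apply/funext => q; rewrite big_nil].
rewrite (_ : (fun _ => _) = fun q => F j q + \sum_(j <- r) F j q).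
  exact: (continuousD (cF j t) (IH t)).
by apply/funext => q; rewrite big_cons.
Qed.

Let K_continuous r : continuous (K r).
Proof.
apply: sum_continuous => j t.
have k : {for t, continuous (fun=> x ord0 j + r * v ord0 j : R)} by exact: cst_continuous.
have c1 : {for t, continuous (fun t : R => G j (t *: (x + r *: v)))}.
  exact: (line_continuous (smooth_continuous (sG j))).
exact: (continuousM k c1).
Qed.

(** The constant dominating function that differentiation under the integral at r = 0 requires. *)
Let dK_bounded : exists B : R, forall r t, `]-1, 1[%classic r -> `[0, 1]%classic t ->
  `|dK r t| <= B.
Proof.
pose m := \sum_i (`|x ord0 i| + `|v ord0 i|).
have m_le i : `|x ord0 i| + `|v ord0 i| <= m.
  by rewrite /m (bigD1 i) //= lerDl sumr_ge0 // => k _; rewrite addr_ge0.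
have bG (f : V -> R) : continuous f -> exists B : R, forall r t : R, `|r| <= 1 -> `|t| <= 1 ->
    `|f (t *: (x + r *: v))| <= B.
  move=> cf; have [B HB] := bounded_on_box m cf; exists B => r t r1 t1; apply: HB => i.
  rewrite !mxE normrM -[m]mul1r; apply: ler_pM => //.
  apply: le_trans (m_le i); apply: le_trans (ler_normD _ _) _; rewrite lerD2l.
  by rewrite normrM -[X in _ <= X]mul1r; apply: ler_pM.
have /choice[B1 H1] j := bG _ (smooth_continuous (sG j)).
have /choice[B2 H2] j := bG _ (smooth_continuous (smooth_derive v (sG j))).
exists (\sum_j (m * B1 j + m * B2 j)) => r t.
rewrite /= !in_itv /= => /andP[r1 r2] /andP[t1 t2].
have r_le : `|r| <= 1 by rewrite ler_norml !ltW.
have t_le : `|t| <= 1 by rewrite ler_norml t2 andbT (le_trans _ t1) // lerN10.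
apply: le_trans (ler_norm_sum _ _ _) _; apply: ler_sum => j _.
apply: le_trans (ler_normD _ _) _; apply: lerD; rewrite normrM.
  by apply: ler_pM => //; [rewrite (le_trans _ (m_le j)) // lerDr|exact: H1].
apply: ler_pM => //.
  apply: le_trans (m_le j); apply: le_trans (ler_normD _ _) _; rewrite lerD2l.
  by rewrite normrM -[X in _ <= X]mul1r; apply: ler_pM.
by rewrite normrM -[X in _ <= X]mul1r; apply: ler_pM => //; exact: H2.
Qed.

(** Closedness exchanges the two indices, replacing the sum of x_j D_v G_j by that of v_j D_x G_j;
    the result is an exact t-derivative. *)
Let dK0 t : dK 0 t = \sum_j v ord0 j * (G j (t *: x) + t * 'D_x (G j) (t *: x)).
Proof.
rewrite /dK; under eq_bigr => j _ do rewrite scale0r addr0 mul0r addr0.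
rewrite big_split /=; under [RHS]eq_bigr => j _ do rewrite mulrDr.
rewrite big_split /=; congr (_ + _).
under eq_bigr => j _ do rewrite smooth_derive_basis // !mulr_sumr.
under [RHS]eq_bigr => j _ do rewrite smooth_derive_basis // !mulr_sumr.
rewrite exchange_big; apply: eq_bigr => j _; apply: eq_bigr => k _ /=.
by rewrite closedG; ring.
Qed.

Let dK0_integral : (\int[mu]_(t in `[0%R, 1%R]) dK 0 t)%R = \sum_j v ord0 j * G j x.
Proof.
(* The integrand is the derivative in t of t <v, G (t x)>. *)
pose P (t : R) : R := \sum_j v ord0 j * (t * G j (t *: x)).
have P_derive (t : R) : is_derive t 1 (P : R -> R) (dK 0 t).
  rewrite dK0; have -> : P = \sum_j (fun t : R => v ord0 j * (t * G j (t *: x))).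
    by apply/funext => q; rewrite /P fct_sumE.
  apply: is_derive_sum => j.
  have d2 : is_derive t 1 (fun t : R => G j (t *: x)) ('D_x (G j) (t *: x)).
    have := @is_derive_line _ _ (G j) 0 x t; rewrite add0r => D.
    have E : (fun t : R => G j (t *: x)) = fun t : R => G j (0 + t *: x).
      by apply/funext => q; rewrite add0r.
    by rewrite E; apply: D; exact: smooth_derivable.
  have d := is_deriveZ (v ord0 j) (is_deriveM (is_derive_id t 1) d2).
  rewrite /GRing.scale /= mulr1 in d.
  by move: d; rewrite addrC.
have cdK : continuous (dK 0).
  have -> : dK 0 = fun t => \sum_j v ord0 j * (G j (t *: x) + t * 'D_x (G j) (t *: x)).
    by apply/funext => t; exact: dK0.
  apply: sum_continuous => j t.
  have k : {for t, continuous (fun=> v ord0 j : R)} by exact: cst_continuous.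
  have c1 : {for t, continuous (fun t : R => G j (t *: x))}.
    exact: (line_continuous (smooth_continuous (sG j))).
  have c2 : {for t, continuous (fun t : R => 'D_x (G j) (t *: x))}.
    exact: (line_continuous (smooth_continuous (smooth_derive x (sG j)))).
  have c3 : {for t, continuous (fun t : R => t)} by [].
  exact: (continuousM k (continuousD c1 (continuousM c3 c2))).
have cP : continuous P.
  by move=> t; apply: differentiable_continuous; apply/derivable1_diffP; case: (P_derive t).
rewrite /Rintegral (@continuous_FTC2 _ (dK 0) P 0 1 ltr01).
- have -> : P 0 = 0 by rewrite /P big1 // => j _; rewrite mul0r mulr0.
  by rewrite -EFinB subr0 /=; apply: eq_bigr => j _; rewrite scale1r mul1r.
- exact: continuous_subspaceT.
- split => [t _||]; first by case: (P_derive t).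
    by apply: cvg_at_right_filter; exact: cP.
  by apply: cvg_at_left_filter; exact: cP.
- by move=> t _; rewrite derive1E; case: (P_derive t).
Qed.

Lemma primitive_is_derive : is_derive x v primitive (\sum_j v ord0 j * G j x).
Proof.
have [B HB] := dK_bounded.
have I0 : (`]-1, 1[%classic : set R) 0 by rewrite /= in_itv /= ltrN10 ltr01.
have m01 : measurable (`[0, 1]%classic : set (measurableTypeR R)) by exact: measurable_itv.
have integrable (f : R -> R) : continuous f -> mu.-integrable `[0%R, 1%R] (EFin \o f).
  by move=> cf; apply: continuous_compact_integrable;
    [exact: segment_compact|exact: continuous_subspaceT].
have B0 : 0 <= B.
  have h01 : (`[0, 1]%classic : set R) 0 by rewrite /= in_itv /= lexx ler01.
  exact: le_trans (normr_ge0 _) (HB _ _ I0 h01).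
have derf r t : derivable (fun q : R => K q t : R) r 1 by case: (K_derive r t).
have dKE r t : partial1of2 K r t = dK r t by rewrite partial1of2E; case: (K_derive r t).
have D : h^-1 *: ((\int[mu]_(t in `[0%R, 1%R]) K (h + 0) t)%R -
    (\int[mu]_(t in `[0%R, 1%R]) K 0 t)%R) @[h --> 0^'] --> \sum_j v ord0 j * G j x.
  rewrite -dK0_integral.
  rewrite (_ : (\int[mu]_(t in `[0%R, 1%R]) dK 0 t)%R =
    (\int[mu]_(t in `[0%R, 1%R]) partial1of2 K 0 t)%R); last first.
    by apply: eq_Rintegral => t _; rewrite dKE.
  apply: (@cvg_differentiation_under_integral R _ _ mu K `[0%R, 1%R]%classic m01 0 (-1) 1 I0
    (fun r _ => integrable _ (@K_continuous r)) (fun r t _ _ => derf r t) (fun=> B)) => //.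
  - by apply: integrable; exact: cst_continuous.
  - by move=> r t Ir It; rewrite dKE; exact: HB.
have PE (h : R) : primitive (h *: v + x) = (\int[mu]_(t in `[0%R, 1%R]) K (h + 0) t)%R.
  by apply: eq_Rintegral => t _; apply: eq_bigr => j _; rewrite addr0 !mxE addrC [h *: v + x]addrC.
have PE0 : primitive x = (\int[mu]_(t in `[0%R, 1%R]) K 0 t)%R.
  by rewrite -[x in LHS]add0r -(scale0r v) PE addr0.
have D' : h^-1 *: ((primitive \o shift x) (h *: v) - primitive x) @[h --> 0^'] -->
    \sum_j v ord0 j * G j x.
  rewrite (_ : (fun h : R => _) = fun h : R => h^-1 *: ((\int[mu]_(t in `[0%R, 1%R]) K (h + 0) t)%R -
    (\int[mu]_(t in `[0%R, 1%R]) K 0 t)%R)) //.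
  by apply/funext => h; rewrite PE0 -PE.
apply: DeriveDef; first by apply/cvg_ex; eexists; exact: D'.
exact: (cvg_lim _ D').
Qed.

End Poincare.

Section DeltaSums.
Local Open Scope complex_scope.
Variables (K : nzRingType) (n : nat).

Lemma delta_mxE (k j : 'I_n) : (delta_mx ord0 k : 'rV[K]_n) ord0 j = (j == k)%:R.
Proof. by rewrite mxE eqxx. Qed.

Lemma sum_delta_mx (F : 'I_n -> K) j :
  \sum_l (delta_mx ord0 j : 'rV[K]_n) ord0 l * F l = F j.
Proof.
rewrite (bigD1 j) //= delta_mxE eqxx mul1r big1 ?addr0 // => l lj.
by rewrite delta_mxE (negbTE lj) mul0r.
Qed.

Lemma sum_delta_mx2 (F : 'I_n -> 'I_n -> K) j k :
  \sum_i \sum_l (delta_mx ord0 j : 'rV[K]_n) ord0 i * (delta_mx ord0 k : 'rV[K]_n) ord0 l * F i l =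
  F j k.
Proof.
rewrite -[RHS](sum_delta_mx (F j)) -[RHS](sum_delta_mx (fun i => \sum_l _ ord0 l * F i l)).
by apply: eq_bigr => i _; rewrite mulr_sumr; apply: eq_bigr => l _; rewrite mulrA.
Qed.

End DeltaSums.

Section Primitive.
Local Open Scope complex_scope.
Variables (R : realType) (n : nat).
Local Notation V := 'rV[R]_n.

Lemma smooth_sum (I : Type) (r : seq I) (f : I -> V -> R) : (forall i, smooth (f i)) ->
  smooth (fun x => \sum_(i <- r) f i x).
Proof.
move=> sf; elim: r => [|i r IH].
  by rewrite (_ : (fun _ => _) = cst 0); [exact: smooth_cst|apply/funext => q; rewrite big_nil].
rewrite (_ : (fun _ => _) = fun q => f i q + \sum_(j <- r) f j q); first exact: smoothD.
by apply/funext => q; rewrite big_cons.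
Qed.

Lemma smooth_affine (f : V -> R) (c : 'I_n -> R) : smooth f ->
  (forall k y, 'D_(delta_mx ord0 k) f y = c k) ->
  forall x z, f (x + z) = f x + \sum_k z ord0 k * c k.
Proof.
move=> sf df x z.
have [t _] := @MVT_line R V f x z 1 (fun y => smooth_derivable sf).
rewrite scale1r mul1r smooth_derive_basis // => E.
rewrite -(subrK (f x) (f (x + z))) E addrC; congr (_ + _).
by apply: eq_bigr => k _; rewrite df.
Qed.

Variables (G : 'I_n -> V -> R) (F : V -> R).
Hypothesis sG : forall k, smooth (G k).
Hypothesis dF : forall x v, is_derive x v F (\sum_j v ord0 j * G j x).

(** Directional derivatives alone do not give continuity. The mean value theorem on the segment from
    [x] to y does, with the [G j] bounded on a box that contains it. *)
Lemma continuous_of_derive : continuous F.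
Proof.
move=> x; pose m := \sum_i `|x ord0 i| + 1.
have m_le i : `|x ord0 i| + 1 <= m.
  by rewrite lerD2r (bigD1 i) //= lerDl sumr_ge0.
have /choice[B HB] j := bounded_on_box m (smooth_continuous (sG j)).
pose C := \sum_j B j.
have B0 j : 0 <= B j.
  apply: le_trans (normr_ge0 _) (HB j 0 _) => i; rewrite mxE normr0.
  by apply: addr_ge0 => //; apply: sumr_ge0.
have C0 : 0 <= C by apply: sumr_ge0.
move=> A /nbhs_ballP[e /= e0 eA].
pose d := Num.min 1 (e / (C + 1)).
have C1 : 0 < C + 1 by rewrite ltr_wpDl.
have d0 : 0 < d by rewrite lt_min ltr01 divr_gt0.
have [d1 d2] : d <= 1 /\ d <= e / (C + 1) by rewrite !ge_min !lexx orbT.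
have dC : d * C < e.
  apply: (@le_lt_trans _ _ (e / (C + 1) * C)); first exact: ler_wpM2r.
  by rewrite -mulrA gtr_pMr // mulrC ltr_pdivrMr // mul1r ltrDl.
clearbody d.
have nd : nbhs x [set y : V | forall i, `|x ord0 i - y ord0 i| < d].
  apply: (@near_rV _ _ x (fun i t => `|x ord0 i - t| < d)) => i.
  have : {for x ord0 i, continuous (fun t : R => t)} by [].
  by move=> /cvgrPdist_lt /(_ _ d0).
suff : nbhs x [set y : V | A (F y)] by [].
apply: filterS nd => y yd; apply: eA; rewrite /ball /=.
have [t t1 E] := @MVT_line R V F x (y - x) 1 (fun z => @ex_derive _ _ _ _ _ _ _ (dF z (y - x))).
have xy : x + 1 *: (y - x) = y by rewrite scale1r addrC subrK.
rewrite xy mul1r in E.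
rewrite distrC E (@derive_val _ _ _ _ _ _ _ (dF _ _)).
apply: le_lt_trans dC; apply: le_trans (ler_norm_sum _ _ _) _.
rewrite /C mulr_sumr; apply: ler_sum => j _; rewrite normrM; apply: ler_pM => //.
  by rewrite !mxE distrC ltW.
apply: HB => i; apply: le_trans (m_le i); rewrite !mxE.
apply: le_trans (ler_normD _ _) _; rewrite lerD2l normrM -[X in _ <= X]mul1r.
apply: ler_pM => //; first by rewrite normr1 in t1.
by rewrite distrC (le_trans (ltW (yd i))).
Qed.

(** Only [F] itself has to be examined: each of its derivatives is already a smooth function. *)
Lemma smooth_of_derive : smooth F.
Proof.
have DF v : 'D_v F = fun x => \sum_j v ord0 j * G j x.
  by apply/funext => x; case: (dF x v).
have sDF v : smooth ('D_v F).
  rewrite DF; apply: smooth_sum => j; exact: smoothM (smooth_cst _ _) (sG j).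
split; apply: (@smooth_on_coind _ _ setT (fun f => f = F \/ smooth f)).
- move=> f [->|sf] x _.
    by split; [exact: continuous_of_derive|move=> v; case: (dF x v)].
  by split; [exact: smooth_continuous|move=> v; exact: smooth_derivable].
- by move=> f v [->|sf]; right; [exact: sDF|exact: smooth_derive].
- by left.
Qed.

End Primitive.

Lemma periodic_int (U : zmodType) (T : Type) (f : U -> T) (a : U) :
  (forall x, f (x + a) = f x) -> forall x (m : int), f (x + a *~ m) = f x.
Proof.
move=> fa; have nat_case k x : f (x + a *+ k) = f x.
  by elim: k x => [|k IH] x; rewrite ?mulr0n ?addr0 // mulrSr addrA fa IH.
move=> x [k|k]; first exact: nat_case.
by rewrite NegzE mulrNz -(nat_case k.+1) -pmulrn subrK.
Qed.

Lemma cos_sin_eq_int (R : realType) (a b : R) : cos a = cos b -> sin a = sin b ->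
  exists m : int, a = b + (pi *+ 2) *~ m.
Proof.
move=> ec es; have pi0 := pi_gt0 R; have p2 : 0 < pi *+ 2 :> R by rewrite pmulrn_lgt0.
(* This floor puts [d] into [-pi, pi[. As cos d = 1 rules out - pi, [angle_id] identifies [d] with
   the angle of cosine 1 and sine 0. *)
pose m := Num.floor ((a - b + pi) / (pi *+ 2)).
exists m; pose d := a - b + (pi *+ 2) *~ (- m).
have cd : cos d = 1.
  rewrite /d (periodic_int (@cosD2pi R)) cosB ec es -!expr2; exact: cos2Dsin2.
have sd : sin d = 0.
  by rewrite /d (periodic_int (@sinD2pi R)) sinB ec es mulrC subrr.
have dm : d = a - b - (pi *+ 2) * m%:~R by rewrite /d mulrNz -mulrzr.
have d_ge : - pi <= d.
  have := Num.Theory.floor_le ((a - b + pi) / (pi *+ 2)); rewrite -/m ler_pdivlMr // dm; lra.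
have d_lt : d < pi.
  have := Num.Theory.floorD1_gt ((a - b + pi) / (pi *+ 2)); rewrite -/m ltr_pdivrMr // intrD dm.
  by rewrite mulrDl mul1r mulr2n; lra.
suff d0 : d = 0 by move: d0; rewrite /d mulrNz => /eqP; rewrite subr_eq0 subr_eq addrC => /eqP.
have d_gt : - pi < d.
  rewrite lt_neqAle d_ge andbT; apply/eqP => dpi.
  by move: cd; rewrite -dpi cosN cospi; lra.
have := @angle_id R d; rewrite d_gt d_lt cd sd /angle mul0r atan0 mulr0; by move=> <-.
Qed.

Section Periods.
Local Open Scope complex_scope.
Variables (R : realType) (n : nat).
Local Notation V := 'rV[R]_n.
Local Notation e k := (delta_mx ord0 k : V).

Lemma tproj_periods (x y : V) : tproj x = tproj y ->
  exists m : 'I_n -> int, y = x + \sum_k ((pi *+ 2) *: e k) *~ m k.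
Proof.
move=> /esym/tproj_eq xy.
have /choice[m Hm] k : exists m : int, y ord0 k = x ord0 k + (pi *+ 2) *~ m.
  by have [c s] := xy k; exact: cos_sin_eq_int.
exists m; apply/rowP => j; rewrite [RHS]mxE summxE Hm; congr (_ + _).
have E k : (((pi *+ 2) *: e k) *~ m k : V) ord0 j = (if j == k then (pi *+ 2) *~ m k else 0).
  rewrite -scaler_int mxE mxE delta_mxE.
  by case: (j == k); rewrite ?mulr1 ?mulr0 // mulrC mulrzr.
rewrite (bigD1 j) //= E eqxx big1 ?addr0 // => k kj.
by rewrite E eq_sym (negbTE kj).
Qed.

Lemma periodic_tproj (T : Type) (H : V -> T) :
  (forall k x, H (x + (pi *+ 2) *: e k) = H x) ->
  forall x y : V, tproj x = tproj y -> H x = H y.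
Proof.
move=> He x y /tproj_periods[m ->].
elim: (index_enum _) x => [|k r IH] x; first by rewrite big_nil addr0.
rewrite big_cons addrA -IH; apply/esym; exact: (periodic_int (He k)).
Qed.

Variable G : 'I_n -> V -> R.
Hypothesis sG : forall k, smooth (G k).
Hypothesis closedG : forall j k x, 'D_(e j) (G k) x = 'D_(e k) (G j) x.
Hypothesis pG : forall k (x y : V), tproj x = tproj y -> G k x = G k y.

(** By periodicity of [G], the increment of the primitive over one period has zero gradient and is
    constant. Subtracting the linear function with the same increments makes the primitive periodic;
    its slopes are the [c k]. *)
Lemma primitive_mod_periods : exists (c : 'I_n -> R) (H : V -> R),
  [/\ smooth H, forall x y : V, tproj x = tproj y -> H x = H y &
      forall k x, 'D_(e k) H x = G k x - c k].
Proof.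
pose F := primitive G; have dF := primitive_is_derive sG closedG.
have sF : smooth F := smooth_of_derive sG dF.
have DF k x : 'D_(e k) F x = G k x.
  by have [_ ->] := dF x (e k); exact: sum_delta_mx.
have pi2 : pi *+ 2 != 0 :> R by rewrite mulrn_eq0 /= gt_eqF // pi_gt0.
pose c k := (F ((pi *+ 2) *: e k) - F 0) / (pi *+ 2).
pose L (x : V) := \sum_k x ord0 k * c k.
have sL : smooth L.
  by apply: smooth_sum => j; exact: smoothM (smooth_coord _ _) (smooth_cst _ _).
have LD x z : L (x + z) = L x + L z.
  by rewrite /L -big_split; apply: eq_bigr => k _ /=; rewrite mxE mulrDl.
have LZ a x : L (a *: x) = a * L x.
  by rewrite /L mulr_sumr; apply: eq_bigr => k _; rewrite mxE mulrA.
have Le k : L (e k) = c k by exact: sum_delta_mx.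
have DL k x : 'D_(e k) L x = c k.
  have -> : L = \sum_j (fun x : V => c j * x ord0 j).
    by apply/funext => q; rewrite /L fct_sumE; apply: eq_bigr => j _; rewrite mulrC.
  have d j : is_derive x (e k) (fun x : V => c j * x ord0 j) (c j * (e k) ord0 j).
    exact: (is_deriveZ (c j) (is_derive_coord x (e k) j)).
  have [_ ->] := is_derive_sum d.
  by rewrite -[RHS]Le; apply: eq_bigr => j _; rewrite mulrC.
exists c, (fun x => F x - L x); split=> [||k x]; first exact: smoothB.
  apply: periodic_tproj => k x.
  pose f (y : V) := F (y + (pi *+ 2) *: e k) - F y.
  have sf : smooth f by apply: smoothB => //; exact: smooth_translate.
  have f0 : f x = f 0.
    rewrite -[x in LHS]add0r (smooth_affine (c := fun=> 0) sf) => [|j y].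
      by rewrite big1 ?addr0 // => j _; rewrite mulr0.
    rewrite smooth_deriveB //; last exact: smooth_translate.
    rewrite derive_translate !DF; apply/eqP; rewrite subr_eq0; apply/eqP/pG.
    apply: tproj_periodic => i; rewrite !mxE eqxx /=.
    by case: (i == k); [right; rewrite mulr1|left; rewrite mulr0 addr0].
  have : F (x + (pi *+ 2) *: e k) - F x = (pi *+ 2) * c k.
    by rewrite -[LHS]/(f x) f0 /f add0r /c mulrC divfK.
  rewrite LD LZ Le => E.
  by move/eqP: E; rewrite subr_eq => /eqP ->; ring.
by rewrite smooth_deriveB // DF DL.
Qed.

End Periods.

Section Betti.
Local Open Scope complex_scope.
Variables (R : realType) (n : nat).
Local Notation V := 'rV[R]_n.
Local Notation W := 'rV[R[i]]_n.
Local Notation M := (torus_manifold R n).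
Local Notation e k := (delta_mx ord0 k : V).

Definition coord_form (k : 'I_n) : cform M 1 := fun _ v => v ord0 ord0 k.

Lemma coef_coord_form k j x : coef (coord_form k) j x = (k == j)%:R.
Proof. by rewrite /coef /coord_form delta_mxE. Qed.

Lemma is_form_coord_form k : is_form (coord_form k).
Proof.
apply: torus_is_form => [p v i a u w|p v i j|v]; last exact: csmooth_cst.
  by rewrite /coord_form /set_arg (ord1 i) eqxx !mxE.
by rewrite (ord1 i) (ord1 j).
Qed.

Lemma closed_coord_form k : dext (coord_form k) = 0.
Proof.
apply/funext => p; apply/funext => v; rewrite -(tliftK p) dext1E; last exact: is_form_coord_form.
apply: big1 => i _; apply: big1 => j _.
have E l : coef (coord_form k) l = cst (k == l)%:R by apply/funext => x; exact: coef_coord_form.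
by rewrite !E !cD_cst subrr mulr0.
Qed.

Lemma closed_coef (z : cform M 1) j k x : is_form z -> dext z = 0 ->
  cD (e j) (coef z k) x = cD (e k) (coef z j) x.
Proof.
move=> fz z0; apply/eqP; rewrite -subr_eq0; apply/eqP.
have E := dext1E x (fun i : 'I_2 => if i == ord0 then delta_mx ord0 j else delta_mx ord0 k) fz.
rewrite z0 /= in E; apply: etrans (esym E).
exact/esym/(sum_delta_mx2 (fun j k => cD (e j) (coef z k) x - cD (e k) (coef z j) x)).
Qed.

Lemma dext_fun_form (P : V -> R[i]) x v : csmooth P ->
  (forall x y : V, tproj x = tproj y -> P x = P y) ->
  dext (fun_form P : cform M 0) (tproj x) v = \sum_k v ord0 ord0 k * cD (e k) P x.
Proof.
move=> sP pP; rewrite dext0E; last exact: is_form_fun_form.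
rewrite (_ : (fun y : V => fun_form P (tproj y) (@no_arg R n)) = P) //.
by apply/funext => y; exact: torus_fun_lift.
Qed.

Lemma csmooth_affine (P : V -> R[i]) (c : 'I_n -> R[i]) x z : csmooth P ->
  (forall k y, cD (e k) P y = c k) -> P (x + z) = P x + \sum_k (z ord0 k)%:C * c k.
Proof.
move=> [sr si] dP.
have Er := smooth_affine (c := fun k => complex.Re (c k)) sr
  (fun k y => congr1 (@complex.Re R) (dP k y)) x z.
have Ei := smooth_affine (c := fun k => complex.Im (c k)) si
  (fun k y => congr1 (@complex.Im R) (dP k y)) x z.
have S (r : seq 'I_n) : \sum_(k <- r) (z ord0 k)%:C * c k =
   (\sum_(k <- r) z ord0 k * complex.Re (c k)) +i* (\sum_(k <- r) z ord0 k * complex.Im (c k)).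
  elim: r => [|k r IH]; first by rewrite !big_nil.
  rewrite !big_cons IH; case: (c k) => a b /=; congr (_ +i* _); ring.
rewrite S; move: Er Ei; case: (P (x + z)) => a b /=; case: (P x) => a' b' /= -> ->.
by [].
Qed.

(** The difference of [f] and [g] lifts to a function with constant partial derivatives, hence
    affine; being periodic it has zero slopes. *)
Lemma constant_form_exact (c : 'I_n -> R[i]) (f g : cform M 0) : is_form f -> is_form g ->
  (forall p v, dext f p v - dext g p v = \sum_k v ord0 ord0 k * c k) -> forall k, c k = 0.
Proof.
move=> ff fg E k.
pose P x := f (tproj x) (@no_arg R n) + -1 * g (tproj x) (@no_arg R n).
have sf : csmooth (fun x : V => f (tproj x) (@no_arg R n)) := form_csmooth _ ff.
have sg : csmooth (fun x : V => g (tproj x) (@no_arg R n)) := form_csmooth _ fg.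
have sP : csmooth P by apply: csmoothD => //; exact: csmoothZ.
have dP j y : cD (e j) P y = c j.
  rewrite [LHS]cDD //; last exact: csmoothZ.
  rewrite [X in _ + X]cDZ // mulN1r.
  have := E (tproj y) (fun=> delta_mx ord0 j); rewrite !dext0E // /along.
  by rewrite !sum_delta_mx.
have p0 : P (0 + (pi *+ 2) *: e k) = P 0.
  rewrite /P (_ : tproj (0 + (pi *+ 2) *: e k) = tproj 0) //.
  apply: tproj_periodic => i; rewrite !mxE eqxx /=.
  by case: (i == k); [right; rewrite mulr1|left; rewrite mulr0 addr0].
have := csmooth_affine 0 ((pi *+ 2) *: e k) sP dP.
rewrite p0 => /eqP; rewrite -[X in X == _]addr0 (inj_eq (addrI _)) eq_sym.
rewrite (bigD1 k) //= big1 ?addr0 => [|j jk]; last first.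
  by rewrite mxE delta_mxE (negbTE jk) mulr0 mul0r.
rewrite mxE delta_mxE eqxx mulr1 mulf_eq0 => /orP[|/eqP //].
by rewrite eq_complex /= eqxx andbT mulrn_eq0 /= gt_eqF // pi_gt0.
Qed.

(** The classes of the dx_k form a basis. They span because a closed form minus its mean periods is
    exact, shown for real and imaginary parts separately; uniqueness of the coefficients is
    [constant_form_exact]. *)
Lemma torus_betti1 : is_betti M 1 n.
Proof.
exists coord_form; split=> [k|z [fz dz]].
  by split; [exact: is_form_coord_form|exact: closed_coord_form].
have sc k := csmooth_coef k fz.
have pc k (x y : V) : tproj x = tproj y -> coef z k x = coef z k y by rewrite /coef => ->.
have cl j k x := closed_coef j k x fz dz.
have [cr [Hr [sHr pHr dHr]]] := @primitive_mod_periods R n (fun k x => complex.Re (coef z k x))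
  (fun k => (sc k).1) (fun j k x => congr1 (@complex.Re R) (cl j k x))
  (fun k x y xy => congr1 (@complex.Re R) (pc k x y xy)).
have [ci [Hi [sHi pHi dHi]]] := @primitive_mod_periods R n (fun k x => complex.Im (coef z k x))
  (fun k => (sc k).2) (fun j k x => congr1 (@complex.Im R) (cl j k x))
  (fun k x y xy => congr1 (@complex.Im R) (pc k x y xy)).
pose P x := Hr x +i* Hi x.
have sP : csmooth P by [].
have pP x y : tproj x = tproj y -> P x = P y by move=> xy; rewrite /P (pHr x y xy) (pHi x y xy).
have dP k x : cD (e k) P x = coef z k x - (cr k +i* ci k).
  by rewrite /cD /P /= dHr dHi; case: (coef z k x).
have evalE (c : 'rV[R[i]]_n) p (v : 'I_1 -> W) :
    (z - \sum_i c ord0 i *: coord_form i) p v = z p v - \sum_i c ord0 i * v ord0 ord0 i.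
  congr (z p v - _); rewrite fct_sumE; elim: (index_enum _) => [|j r IH]; first by rewrite !big_nil.
  by rewrite !big_cons -IH.
pose c0 := \row_k (cr k +i* ci k) : 'rV[R[i]]_n.
have ez : z - \sum_i c0 ord0 i *: coord_form i = dext (fun_form P : cform M 0).
  apply/funext => p; apply/funext => v; rewrite evalE -(tliftK p) dext_fun_form //.
  rewrite form1E; last exact: form_multilinear.
  rewrite -sumrB; apply: eq_bigr => k _; rewrite dP -/(coef z k _) /c0 mxE; ring.
exists c0; split; first by exists (fun_form P); split; [exact: is_form_fun_form|].
move=> c [f [ff fE]]; apply/rowP => k; apply/eqP; rewrite -subr_eq0; apply/eqP.
apply: (@constant_form_exact (fun k => c0 ord0 k - c ord0 k) f (fun_form P) ff).
  exact: is_form_fun_form.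
move=> p v; rewrite -fE -ez !evalE.
transitivity (\sum_i c0 ord0 i * v ord0 ord0 i - \sum_i c ord0 i * v ord0 ord0 i); first by ring.
by rewrite -sumrB; apply: eq_bigr => i _; ring.
Qed.

End Betti.

(** * The fundamental form *)

Section FundamentalForm.
Local Open Scope complex_scope.
Variables (R : realType) (s h : R) (sh1 : s ^+ 2 + h ^+ 2 = 1).
Local Notation V := 'rV[R]_4.
Local Notation W := 'rV[R[i]]_4.
Local Notation T := (torus R 4).
Local Notation M := (hermitian_torus sh1).
Local Notation omega := (fundamental_form (M := M)).

Lemma fundamental_formE (p : T) v : omega p v =
  \sum_j \sum_k v ord0 ord0 j * v ord_max ord0 k * (torusJ s h p j k)%:C.
Proof.
rewrite /fundamental_form mulmx1 mxE exchange_big; apply: eq_bigr => k _.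
rewrite mxE mulr_suml; apply: eq_bigr => j _; rewrite [in LHS]mxE [X in _ * X]mxE.
by rewrite mulrAC.
Qed.

Lemma is_form_fundamental_form : is_form omega.
Proof.
apply: torus_is_form => [p v i a u w|p v i j ij vij|v].
- rewrite !fundamental_formE mulr_sumr -big_split; apply: eq_bigr => j _ /=.
  rewrite mulr_sumr -big_split; apply: eq_bigr => k _ /=.
  by rewrite /set_arg; have [->|->] := ord2_cases i; rewrite -!val_eqE /= !mxE; ring.
- have v01 : v ord_max = v ord0.
    by move: ij vij; have [->|->] := ord2_cases i; have [->|->] := ord2_cases j; rewrite ?eqxx.
  have Jt j' k : torusJ s h p k j' = - torusJ s h p j' k.
    by have /matrixP/(_ j' k) := quaternion_mx_tr (s * tcos p ord0) (s * tsin p ord0) h;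
      rewrite !mxE => ->.
  have E : omega p v = - omega p v.
    rewrite [in LHS]fundamental_formE exchange_big fundamental_formE v01 -sumrN.
    apply: eq_bigr => k _; rewrite -sumrN; apply: eq_bigr => j' _ /=.
    have -> : (torusJ s h p k j')%:C = - (torusJ s h p j' k)%:C by rewrite Jt rmorphN.
    by move: (torusJ s h p j' k)%:C => q; ring.
  by move/eqP: E; rewrite -addr_eq0 -mulr2n mulrn_eq0 => /eqP.
- rewrite (_ : (fun _ => _) = fun x : V => \sum_j \sum_k v ord0 ord0 j * v ord_max ord0 k *
      (torusJ s h (tproj x) j k)%:C); last by apply/funext => x; rewrite fundamental_formE.
  apply: csmooth_sum => j; apply: csmooth_sum => k; apply/csmoothZ/csmooth_real.
  exact: smooth_torusJ.
Qed.

Lemma fundamental_form_basis (p : T) (v : 'I_2 -> W) j k :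
  v ord0 = delta_mx ord0 j -> v ord_max = delta_mx ord0 k -> omega p v = (torusJ s h p j k)%:C.
Proof.
move=> v0 v1; rewrite fundamental_formE v0 v1; exact: sum_delta_mx2.
Qed.

Lemma along_basis j (F : V -> R[i]) x : along (delta_mx ord0 j) F x = pd j F x.
Proof. exact: sum_delta_mx. Qed.

(** At the origin, on (d_t, d_z, d_x), the first term is the t-derivative of omega(d_z, d_x) = s sin
    t, namely s. The other two differentiate s cos t along d_z and the constant h along d_x. *)
Lemma fundamental_form_not_closed : s != 0 -> dext omega <> 0.
Proof.
move=> s0 w0.
pose v (i : 'I_3) : W := delta_mx ord0 (tnth [tuple ord0; j3; j1] i).
have F a b (w : 'I_2 -> W) : w ord0 = delta_mx ord0 a -> w ord_max = delta_mx ord0 b ->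
    (fun y : V => omega (tproj y : T) w) = fun y => (torusJ s h (tproj y) a b)%:C.
  by move=> wa wb; apply/funext => y; exact: fundamental_form_basis.
pose i1 : 'I_3 := @Ordinal 3 1 isT; pose i2 : 'I_3 := @Ordinal 3 2 isT.
have E : dext omega (tproj (0 : V)) v = \sum_(i < 3) (-1) ^+ i *
    along (v i) (fun y => omega (tproj y : T) (fun j => v (lift i j))) (0 : V).
  exact: torus_dext is_form_fundamental_form.
have z : dext omega (tproj (0 : V)) v = 0 by rewrite w0.
have {z}E := etrans (esym z) E.
have vE i (l : 'I_4) : tnth [tuple ord0; j3; j1] i = l -> v i = delta_mx ord0 l by move=> <-.
have v0 : v ord0 = delta_mx ord0 ord0 by apply: vE; rewrite (tnth_nth ord0).
have v1 : v i1 = delta_mx ord0 j3 by apply: vE; rewrite (tnth_nth ord0).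
have v2 : v i2 = delta_mx ord0 j1 by apply: vE; rewrite (tnth_nth ord0).
have l00 : lift ord0 ord0 = i1 :> 'I_3 by exact: val_inj.
have l01 : lift ord0 ord_max = i2 :> 'I_3 by exact: val_inj.
have l10 : lift i1 ord0 = ord0 :> 'I_3 by exact: val_inj.
have l11 : lift i1 ord_max = i2 :> 'I_3 by exact: val_inj.
have l20 : lift i2 ord0 = ord0 :> 'I_3 by exact: val_inj.
have l21 : lift i2 ord_max = i1 :> 'I_3 by exact: val_inj.
have F0 := F j3 j1 (fun j => v (lift ord0 j)).
have F1 := F ord0 j1 (fun j => v (lift i1 j)).
have F2 := F ord0 j3 (fun j => v (lift i2 j)).
rewrite l00 l01 v1 v2 in F0; rewrite l10 l11 v0 v2 in F1; rewrite l20 l21 v0 v1 in F2.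
have {}F0 := F0 erefl erefl; have {}F1 := F1 erefl erefl; have {}F2 := F2 erefl erefl.
have J31 : (fun y : V => (torusJ s h (tproj y) j3 j1)%:C) = fun y => s%:C * st y.
  by apply/funext => y; rewrite mxE /= tsinE rmorphM.
have J01 : (fun y : V => (torusJ s h (tproj y) ord0 j1)%:C) = fun y => s%:C * ct y.
  by apply/funext => y; rewrite mxE /= tcosE rmorphM.
have J03 : (fun y : V => (torusJ s h (tproj y) ord0 j3)%:C) = cst h%:C.
  by apply/funext => y; rewrite mxE.
have D0 : along (v ord0) (fun y => omega (tproj y : T) (fun j => v (lift ord0 j))) (0 : V) = s%:C.
  rewrite F0 J31 v0 along_basis [LHS]cDZ; last exact: csmooth_st.
  by rewrite -[cD _ _ _]/(pd ord0 (@st R) 0) pd_st /= /ct mxE cos0 mulr1.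
have D1 : along (v i1) (fun y => omega (tproj y : T) (fun j => v (lift i1 j))) (0 : V) = 0.
  rewrite F1 J01 v1 along_basis [LHS]cDZ; last exact: csmooth_ct.
  by rewrite -[cD _ _ _]/(pd j3 (@ct R) 0) pd_ct /= mulr0.
have D2 : along (v i2) (fun y => omega (tproj y : T) (fun j => v (lift i2 j))) (0 : V) = 0.
  by rewrite F2 J03 v2 along_basis /pd cD_cst.
have sum3 (H : 'I_3 -> R[i]) : \sum_i H i = H ord0 + (H i1 + H i2).
  rewrite !big_ord_recl big_ord0 addr0; congr (_ + (H _ + H _)); exact: val_inj.
move: E; rewrite sum3 D0 D1 D2 !mulr0 !addr0 expr0 mul1r => /esym/eqP.
by rewrite eq_complex /= eqxx andbT (negbTE s0).
Qed.

End FundamentalForm.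

Section Constants.
Local Open Scope complex_scope.
Variable R : realType.

Lemma three_fourfifths : (4 / 5) ^+ 2 + (3 / 5) ^+ 2 = 1 :> R.
Proof. by field. Qed.

(** The angle 6 pi / 5 exceeds pi by pi / 5, so its cosine is negative. *)
Lemma cos_sixfifths_pi : cos (3 / 5 * (pi *+ 2)) != 1 :> R.
Proof.
have pi0 := pi_gt0 R.
have -> : 3 / 5 * (pi *+ 2) = pi / 5 + pi :> R by rewrite mulr2n; field.
have c0 : 0 < cos (pi / 5) :> R by apply: cos_gt0_pihalf; apply/andP; split; lra.
by rewrite cosDpi; apply/eqP => e; move: c0; rewrite -[cos _]opprK e; lra.
Qed.

End Constants.

Lemma is_dim0 (R : realType) (V : lmodType R[i]) (Z : set V) :
  (forall z, Z z -> z = 0) -> is_dim Z 0.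
Proof.
move=> Z0; exists (fun=> 0); split=> [[]//|z Zz].
exists 0; split=> [|c _]; last by apply/rowP => -[].
by rewrite /= big_ord0 subr0; exact: Z0.
Qed.

Theorem theorem3p1 (R : realType) :
  exists (M : almost_hermitian R 4) (vol : {measure set (borel M) -> \bar R}),
    [/\ compact [set: M],
        riemannian_volume vol,
        exists l10 l01 b1 : nat,
          [/\ is_hodge_number vol 1 0 l10,
              is_hodge_number vol 0 1 l01,
              is_betti M 1 b1
            & l10 = l01 /\ (l01%:R < b1%:R / 2 :> rat)]
      & dext (fundamental_form (M := M)) <> 0].
Proof.
pose s : R := 4 / 5; pose h : R := 3 / 5.
have sh1 : s ^+ 2 + h ^+ 2 = 1 := three_fourfifths R.
have s0 : s != 0 by apply: lt0r_neq0; rewrite /s; lra.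
have hs : h ^+ 2 != 2 * s ^+ 2.
  by rewrite lt_eqF // /s /h !expr2; lra.
exists (hermitian_torus sh1), (hermitian_volume sh1); split.
- exact: torus_compact.
(* Metric and Jacobian are the identity, so the density in every chart is 1. *)
- move=> p A mA Ap.
  rewrite [LHS](torus_volume_chart mA Ap); congr lebesgue_int; apply/funext => x.
  by rewrite /gram /= torus_jac trmx1 !mulmx1 det1 sqrtr1 mul1r.
- exists 0%N, 0%N, 4%N.
  have d10 : is_hodge_number (hermitian_volume sh1) 1 0 0.
    by apply: is_dim0 => z [hz _]; exact: (harmonic10_eq0 s0 hs hz).
  have d01 : is_hodge_number (hermitian_volume sh1) 0 1 0.
    by apply: is_dim0 => z [hz mz]; exact: (harmonic01_eq0 s0 (cos_sixfifths_pi R) hz mz).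
  have b1 : is_betti (hermitian_torus sh1) 1 4 := @torus_betti1 R 4.
  have r : 0%:R < 4%:R / 2 :> rat by rewrite mulr0n mulr_gt0 ?invr_gt0 ?ltr0n.
  exact: And4 d10 d01 b1 (conj erefl r).
- exact: fundamental_form_not_closed.
Qed.
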